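(* Let $\delta>0$ and let $\{x_j:j\in\mathbb{N}\}$ be a complete interpolating sequence for $S_\delta=[-\delta,\delta]^2$. If $0<\beta<(3-\sqrt8)\delta$ and $f\in PW_{B_\beta}$, then \[ \lim_{\alpha\to\infty}|f(x)-I_\alpha[f](x)|=0 \] uniformly for $x\in\mathbb{R}^2$.
   Context: Fourier transform on $\mathbb{R}^2$: $\hat g(\xi)=(2\pi)^{-1}\int g(x)e^{-i\langle\xi,x\rangle}dx$, extended to $L^2$. $PW_S=\{f\in L^2(\mathbb{R}^2):\hat f=0\text{ a.e. outside }S\}$ (such $f$ with $S$ bounded are identified with their continuous representatives), and $B_\beta=\{\xi\in\mathbb{R}^2:|\xi|\le\beta\}$. $\{x_j\}$ is a complete interpolating sequence for $S_\delta$ if $\{e^{i\langle\cdot,x_j\rangle}\}$ is a Riesz basis of $L^2(S_\delta)$. Poisson kernel $g_\alpha(x)=(2\pi)^{-1}\alpha(\alpha^2+|x|^2)^{-3/2}$. For $f\in PW_{S_\delta}$ and $\alpha>0$, the Poisson interpolant is $I_\alpha[f](x)=\sum_ja_jg_\alpha(x-x_j)$, where $\{a_j\}\in\ell^2$ is the (unique) sequence with $I_\alpha[f](x_k)=f(x_k)$ for all $k\in\mathbb{N}$. *)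

(* Defs.v *)
(* Complex numbers are mathcomp's R[i]
   (real_closed/complex.v); since R[i] carries no topology/measure structure
   in mathcomp-analysis, analytic statements about complex-valued functions
   are expressed through their real and imaginary parts. *)
From mathcomp Require Import all_boot all_algebra.
From mathcomp Require Import complex.
From mathcomp Require Import all_classical all_reals all_analysis.
Import numFieldNormedType.Exports.
Import GRing.Theory Num.Theory.

Set Implicit Arguments.
Unset Strict Implicit.
Unset Printing Implicit Defensive.

Local Open Scope classical_set_scope.
Local Open Scope ring_scope.

Section Defs.
Variable R : realType.

Definition mu2 := (@lebesgue_measure R \x @lebesgue_measure R)%E.

Definition reC (z : R[i]) : R := @complex.Re R z.
Definition imC (z : R[i]) : R := @complex.Im R z.

Definition dot2 (x y : R * R) : R := x.1 * y.1 + x.2 * y.2.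
Definition sub2 (x y : R * R) : R * R := (x.1 - y.1, x.2 - y.2).
Definition norm2 (x : R * R) : R := Num.sqrt (x.1 ^+ 2 + x.2 ^+ 2).

Definition csq (z : R[i]) : R := (reC z) ^+ 2 + (imC z) ^+ 2.
Definition cabs (z : R[i]) : R := Num.sqrt (csq z).

Definition expi (t : R) : R[i] := Complex (cos t) (sin t).

Definition cint (D : set (R * R)) (h : R * R -> R[i]) : R[i] :=
  Complex (Rintegral mu2 D (fun x => reC (h x)))
          (Rintegral mu2 D (fun x => imC (h x))).

Definition L2_on (D : set (R * R)) (h : R * R -> R[i]) : Prop :=
  [/\ measurable_fun D (fun x => reC (h x)),
      measurable_fun D (fun x => imC (h x)) &
      (\int[mu2]_(x in D) (csq (h x))%:E < +oo)%E].

Definition Bball (r : R) : set (R * R) := [set x | norm2 x <= r].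

Definition Ssq (delta : R) : set (R * R) :=
  [set x | `|x.1| <= delta /\ `|x.2| <= delta].

Definition trunc_FT (f : R * R -> R[i]) (n : nat) (xi : R * R) : R[i] :=
  ((2 * pi)^-1 : R)%:C%C * cint (Bball n%:R) (fun x => f x * expi (- dot2 xi x)).

(* g is the (L^2-)Fourier transform of f : the L^2-limit of the truncated
   Fourier transforms (Plancherel's extension of the Fourier transform). *)
Definition is_FT_L2 (f g : R * R -> R[i]) : Prop :=
  L2_on setT g /\
  ((fun n : nat => (\int[mu2]_xi (csq (trunc_FT f n xi - g xi))%:E)%E)
     @ \oo --> 0%E).

(* Paley-Wiener space PW_S (elements identified with their continuous
   representative). *)
Definition PW (S : set (R * R)) (f : R * R -> R[i]) : Prop :=
  [/\ continuous (fun x => reC (f x)),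
      continuous (fun x => imC (f x)),
      L2_on setT f &
      exists g, is_FT_L2 f g /\ {ae mu2, forall xi, ~ S xi -> g xi = 0}].

Definition riesz_basis (S : set (R * R)) (e : nat -> R * R -> R[i]) : Prop :=
  [/\ (forall j, L2_on S (e j)),
      (exists A B : R, [/\ 0 < A, 0 < B &
         forall (n : nat) (c : nat -> R[i]),
           A * (\sum_(j < n) csq (c j))
             <= Rintegral mu2 S (fun xi => csq (\sum_(j < n) c j * e j xi))
           /\ Rintegral mu2 S (fun xi => csq (\sum_(j < n) c j * e j xi))
             <= B * (\sum_(j < n) csq (c j))]) &
      (forall h, L2_on S h -> forall eps : R, 0 < eps ->
         exists (n : nat) (c : nat -> R[i]),
           Rintegral mu2 S (fun xi => csq (h xi - \sum_(j < n) c j * e j xi))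
             < eps)].

Definition complete_interpolating (S : set (R * R)) (xs : nat -> R * R) : Prop :=
  riesz_basis S (fun j xi => expi (dot2 xi (xs j))).

Definition poisson (alpha : R) (x : R * R) : R :=
  (2 * pi)^-1 * alpha * powR (alpha ^+ 2 + norm2 x ^+ 2) (- (3 / 2)).

Definition ell2 (a : nat -> R[i]) : Prop :=
  exists M : R, forall n, \sum_(j < n) csq (a j) <= M.

Definition series_to (u : nat -> R[i]) (v : R[i]) : Prop :=
  (fun n : nat => reC (\sum_(j < n) u j)) @ \oo --> reC v /\
  (fun n : nat => imC (\sum_(j < n) u j)) @ \oo --> imC v.

Definition poisson_terms (alpha : R) (xs : nat -> R * R) (a : nat -> R[i])
  (x : R * R) : nat -> R[i] :=
  fun j => a j * (poisson alpha (sub2 x (xs j)))%:C%C.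

Definition poisson_coeffs (alpha : R) (xs : nat -> R * R) (f : R * R -> R[i])
  (a : nat -> R[i]) : Prop :=
  ell2 a /\ forall k, series_to (poisson_terms alpha xs a (xs k)) (f (xs k)).

End Defs.

(* Main.v *)
(* Put e_x(xi) = exp(-al |xi| / 2) exp(i <xi, x>).  The Fourier transform of
   exp(-al |xi|) is a multiple of the Poisson kernel, so that in L^2(R^2)
   <e_x, e_y> = (2 pi)^2 g_al(x - y), and Fourier inversion reads
   f(x) = <e_x, Phi> with Phi supported in B_beta and |Phi|^2 <= C exp(al beta).
   Since the e_(x_j) form a Riesz sequence, interpolating f amounts to
   projecting Phi orthogonally onto their closed span, and the error at x is at
   most |Phi| dist(e_x, span).  Approximate exp(i <., x>) on S_delta by
   exponential sums; outside S_delta these sums are square integrable on every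
   translate of the square and the weight exp(-al |xi|) is small.  This gives
   dist^2 <= C exp(-al delta / 2) uniformly in x, while
   beta < (3 - sqrt 8) delta < delta / 2. *)
From HB Require Import structures.
Require Import Defs.
From mathcomp Require Import all_boot all_order all_algebra.
From mathcomp Require Import complex ring lra.
From mathcomp Require Import all_classical all_reals all_analysis measurable_realfun.
Import numFieldNormedType.Exports.
Import Order.TTheory GRing.Theory Num.Theory.
Local Open Scope classical_set_scope.
Local Open Scope ring_scope.
Set Implicit Arguments.
Unset Strict Implicit.
Unset Printing Implicit Defensive.

(** * Complex numbers *)

(** The lower Riesz bound of the weighted exponentials is only [A exp(-2 al delta)]: inverting the
    interpolation map through it would cost a factor exp(2 al delta), against a gain of exp(-al
    delta / 2). It therefore serves only to produce coefficients. The error estimate rests on the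
    asymptotic orthogonality of the residual to every e_(x_j) and on an upper bound uniform in
    [al >= 1], so it holds for every square-summable solution of the interpolation equations. The
    projection itself is never formed: only finite combinations, their coefficients and scalar
    limits of inner products occur. The sums approximating exp(i <., x>) have coefficients
    controlled by the lower bound on the unweighted square, where [al] does not enter. The exponent
    delta / 2 comes from bounding exponential sums outside S_delta by an average over translations
    in a square of half side delta / 10. The transform of f is only an L^2 limit of truncated
    transforms, so pointwise inversion is regularised by exp(-ep |xi|); the Poisson kernel then
    returns as an approximate identity. *)

Section ComplexConvergence.
Context {R : realType}.
Implicit Types (z u v : R[i]) (a b : nat -> R[i]).

Lemma reCD z u : reC (z + u) = reC z + reC u. Proof. by case: z; case: u. Qed.
Lemma imCD z u : imC (z + u) = imC z + imC u. Proof. by case: z; case: u. Qed.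
Lemma reCN z : reC (- z) = - reC z. Proof. by case: z. Qed.
Lemma imCN z : imC (- z) = - imC z. Proof. by case: z. Qed.
Lemma reCB z u : reC (z - u) = reC z - reC u. Proof. by rewrite reCD reCN. Qed.
Lemma imCB z u : imC (z - u) = imC z - imC u. Proof. by rewrite imCD imCN. Qed.
Lemma reCM z u : reC (z * u) = reC z * reC u - imC z * imC u.
Proof. by case: z; case: u. Qed.
Lemma imCM z u : imC (z * u) = reC z * imC u + imC z * reC u.
Proof. by case: z; case: u. Qed.
Lemma reCJ z : reC (conjc z) = reC z. Proof. by case: z. Qed.
Lemma imCJ z : imC (conjc z) = - imC z. Proof. by case: z. Qed.
Lemma reCr (x : R) : reC x%:C%C = x. Proof. by []. Qed.
Lemma imCr (x : R) : imC x%:C%C = 0. Proof. by []. Qed.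
Lemma reC0 : reC (0 : R[i]) = 0. Proof. by []. Qed.
Lemma imC0 : imC (0 : R[i]) = 0. Proof. by []. Qed.
Definition cE := (reCD, imCD, reCN, imCN, reCM, imCM, reCJ, imCJ, reCr, imCr, reC0, imC0).

Lemma complex_ext z u : reC z = reC u -> imC z = imC u -> z = u.
Proof. by case: z => a b; case: u => c d /= -> ->. Qed.

Lemma csq_ge0 z : 0 <= csq z. Proof. by rewrite addr_ge0 ?sqr_ge0. Qed.
Lemma csq0 : csq (0 : R[i]) = 0. Proof. by rewrite /csq !cE expr0n addr0. Qed.
Lemma csqN z : csq (- z) = csq z. Proof. by rewrite /csq !cE !sqrrN. Qed.
Lemma csqJ z : csq (conjc z) = csq z. Proof. by rewrite /csq !cE !sqrrN. Qed.
Lemma csqM z u : csq (z * u) = csq z * csq u.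
Proof. by rewrite /csq !cE; ring. Qed.
Lemma csq_eq0 z : csq z = 0 -> z = 0.
Proof.
move=> /eqP; rewrite paddr_eq0 ?sqr_ge0// !sqrf_eq0 => /andP[/eqP h /eqP k].
exact: complex_ext.
Qed.
Lemma csqD z u : csq (z + u) <= 2 * csq z + 2 * csq u.
Proof.
rewrite /csq !cE -subr_ge0 [leRHS](_ : _ =
  (reC z - reC u) ^+ 2 + (imC z - imC u) ^+ 2); last by ring.
by rewrite addr_ge0 ?sqr_ge0.
Qed.
Lemma csqB z u : csq (z - u) <= 2 * csq z + 2 * csq u.
Proof. by rewrite -(csqN u) csqD. Qed.
Lemma reC_sqr_le z : reC z ^+ 2 <= csq z. Proof. by rewrite lerDl sqr_ge0. Qed.
Lemma imC_sqr_le z : imC z ^+ 2 <= csq z.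
Proof. by rewrite lerDr sqr_ge0. Qed.
Lemma mulCJ z : z * conjc z = (csq z)%:C%C.
Proof. by apply: complex_ext; rewrite !cE /csq; ring. Qed.
Lemma conjCD z u : conjc (z + u) = conjc z + conjc u.
Proof. by apply: complex_ext; rewrite !cE //; ring. Qed.
Lemma conjCM z u : conjc (z * u) = conjc z * conjc u.
Proof. by apply: complex_ext; rewrite !cE //; ring. Qed.
Lemma conjC0 : conjc (0 : R[i]) = 0.
Proof. by apply: complex_ext; rewrite !cE // oppr0. Qed.

Lemma reC_sum n (a : 'I_n -> R[i]) : reC (\sum_(j < n) a j) = \sum_(j < n) reC (a j).
Proof. by elim/big_ind2: _ => // ? ? ? ? <- <-; rewrite reCD. Qed.
Lemma imC_sum n (a : 'I_n -> R[i]) : imC (\sum_(j < n) a j) = \sum_(j < n) imC (a j).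
Proof. by elim/big_ind2: _ => // ? ? ? ? <- <-; rewrite imCD. Qed.
Lemma conjC_sum n (a : 'I_n -> R[i]) : conjc (\sum_(j < n) a j) = \sum_(j < n) conjc (a j).
Proof. by elim/big_ind2: _ => [|? ? ? ? <- <-|//]; rewrite ?conjCD ?conjC0. Qed.

(** Convertible to [series_to] when [a] is a sequence of partial sums. *)
Definition ccvg a z := (fun n => reC (a n)) @ \oo --> reC z /\
  (fun n => imC (a n)) @ \oo --> imC z.

Lemma ccvg_cst z : ccvg (fun=> z) z.
Proof. by split; exact: cvg_cst. Qed.

Lemma ccvgD a b z u : ccvg a z -> ccvg b u -> ccvg (fun n => a n + b n) (z + u).
Proof.
move=> [a1 a2] [b1 b2]; split; rewrite cE.
  by under eq_fun do rewrite reCD; exact: cvgD.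
by under eq_fun do rewrite imCD; exact: cvgD.
Qed.

Lemma ccvgM a b z u : ccvg a z -> ccvg b u -> ccvg (fun n => a n * b n) (z * u).
Proof.
move=> [a1 a2] [b1 b2]; split; rewrite cE.
  by under eq_fun do rewrite reCM; apply: cvgB; exact: cvgM.
by under eq_fun do rewrite imCM; apply: cvgD; exact: cvgM.
Qed.

Lemma ccvgJ a z : ccvg a z -> ccvg (fun n => conjc (a n)) (conjc z).
Proof.
move=> [a1 a2]; split; rewrite cE.
  by under eq_fun do rewrite reCJ; exact: a1.
by under eq_fun do rewrite imCJ; exact: cvgN.
Qed.

Lemma ccvgZ k a z : ccvg a z -> ccvg (fun n => k * a n) (k * z).
Proof. by move=> h; apply: ccvgM => //; exact: ccvg_cst. Qed.

Lemma ccvgB a b z u : ccvg a z -> ccvg b u -> ccvg (fun n => a n - b n) (z - u).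
Proof.
move=> ha hb; apply: ccvgD => //; rewrite -mulN1r.
by under eq_fun do rewrite -mulN1r; exact: ccvgZ.
Qed.

Lemma ccvg_sum m (F : nat -> nat -> R[i]) (l : nat -> R[i]) :
  (forall k, (k < m)%N -> ccvg (fun n => F n k) (l k)) ->
  ccvg (fun n => \sum_(k < m) F n k) (\sum_(k < m) l k).
Proof.
elim: m => [|m IH] h.
  by under eq_fun do rewrite big_ord0; rewrite big_ord0; exact: ccvg_cst.
under eq_fun do rewrite big_ord_recr.
rewrite big_ord_recr/=; apply: ccvgD; last exact: h.
by apply: IH => k km; apply: h; rewrite ltnS ltnW.
Qed.

Lemma ccvg_csq a z : ccvg a z -> (fun n => csq (a n)) @ \oo --> csq z.
Proof.
move=> [h k]; rewrite /csq; apply: cvgD.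
  by rewrite expr2; under eq_fun do rewrite expr2; exact: cvgM.
by rewrite expr2; under eq_fun do rewrite expr2; exact: cvgM.
Qed.

(** Converts componentwise convergence into smallness of a squared modulus, the quantity that
    Cauchy-Schwarz estimates deliver without square roots. *)
Lemma cvg_csqB a z : (fun n => csq (a n - z)) @ \oo --> 0 <-> ccvg a z.
Proof.
split => [h|h]; last first.
  rewrite -csq0 -(subrr z); apply: ccvg_csq.
  by apply: ccvgB => //; exact: ccvg_cst.
have sqr_to0 (v : nat -> R) (w : R) : (forall n, (v n - w) ^+ 2 <= csq (a n - z)) ->
    v @ \oo --> w.
  move=> vw; apply/cvgrPdist_lt => e e0.
  move/cvgrPdist_lt : h => /(_ (e ^+ 2)); rewrite exprn_gt0// => /(_ isT).
  apply: filterS => n; rewrite sub0r normrN ger0_norm ?csq_ge0// => hn.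
  rewrite -(@ltr_pXn2r _ 2)// ?nnegrE ?(ltW e0)// distrC real_normK ?num_real//.
  exact: le_lt_trans (vw n) hn.
split; apply: sqr_to0 => n.
  by rewrite -reCB reC_sqr_le.
by rewrite -imCB imC_sqr_le.
Qed.

Lemma csq_lim_le a z (M : R) : ccvg a z -> (\forall n \near \oo, csq (a n) <= M) ->
  csq z <= M.
Proof.
move=> /ccvg_csq h hM; rewrite -(cvg_lim _ h)//; apply: limr_le => //.
by apply/cvg_ex; exists (csq z).
Qed.

(** Completeness with a rate: each component is Cauchy because its square is at most [csq], and the
    bound [r n] passes to the limit in [m]. *)
Lemma ccvg_cauchy a (r : nat -> R) : r @ \oo --> 0 ->
  (forall n m, (n <= m)%N -> csq (a m - a n) <= r n) ->
  exists2 z, ccvg a z & forall n, csq (z - a n) <= r n.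
Proof.
move=> r0 har.
have sqr_cauchy (v : nat -> R) :
    (forall n m, (v m - v n) ^+ 2 <= csq (a m - a n)) -> cvgn v.
  move=> hv; apply/cauchy_cvgP/cauchy_exP => e e0.
  move/cvgrPdist_lt : r0 => /(_ (e ^+ 2)); rewrite exprn_gt0// => /(_ isT)[n _ hn].
  exists (v n); exists n => // m /= nm; rewrite /ball/= distrC.
  rewrite -(@ltr_pXn2r _ 2)// ?nnegrE ?(ltW e0)// real_normK ?num_real//.
  apply: le_lt_trans (hv n m) _; apply: le_lt_trans (har n m nm) _.
  apply: le_lt_trans (ler_norm _) _.
  by have := hn n (leqnn n); rewrite /= sub0r normrN.
have /cvg_ex[x hx] : cvgn (fun n => reC (a n)).
  by apply: sqr_cauchy => n m; rewrite -reCB reC_sqr_le.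
have /cvg_ex[y hy] : cvgn (fun n => imC (a n)).
  by apply: sqr_cauchy => n m; rewrite -imCB imC_sqr_le.
have hz : ccvg a (Complex x y) by [].
exists (Complex x y) => // n.
apply: (@csq_lim_le (fun m => a m - a n)).
  by apply: ccvgB => //; exact: ccvg_cst.
by exists n => // m /= nm; exact: har.
Qed.

End ComplexConvergence.

(** * Interpolation in a pre-Hilbert space *)

Section PreHilbert.
Context {R : realType} {V : lmodType R[i]}.
(** The laws are required on the domain [L] only, and the form is merely semidefinite: the instance
    is square-integrable functions taken pointwise, not modulo null sets. *)
Variables (L : V -> Prop) (ip : V -> V -> R[i]).
Hypothesis L0 : L 0.
Hypothesis LD : forall u v, L u -> L v -> L (u + v).
Hypothesis LZ : forall k u, L u -> L (k *: u).
Hypothesis ipDl : forall u v w, L u -> L v -> L w -> ip (u + v) w = ip u w + ip v w.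
Hypothesis ipZl : forall k u w, L u -> L w -> ip (k *: u) w = k * ip u w.
Hypothesis ipC : forall u v, L u -> L v -> ip v u = conjc (ip u v).
Hypothesis ip_ge0 : forall u, L u -> 0 <= reC (ip u u).

Let LN u : L u -> L (- u).
Proof. by move=> Lu; rewrite -scaleN1r; exact: LZ. Qed.

Let LB u v : L u -> L v -> L (u - v).
Proof. by move=> Lu Lv; apply: LD => //; exact: LN. Qed.

Let ip0l w : L w -> ip 0 w = 0.
Proof. by move=> Lw; rewrite -(scale0r 0) ipZl// mul0r. Qed.

Let ipNl u w : L u -> L w -> ip (- u) w = - ip u w.
Proof. by move=> Lu Lw; rewrite -scaleN1r ipZl// mulN1r. Qed.

Let ipBl u v w : L u -> L v -> L w -> ip (u - v) w = ip u w - ip v w.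
Proof. by move=> Lu Lv Lw; rewrite ipDl ?ipNl//; exact: LN. Qed.

Let ipDr u v w : L u -> L v -> L w -> ip w (u + v) = ip w u + ip w v.
Proof. by move=> Lu Lv Lw; rewrite (ipC (LD Lu Lv) Lw) ipDl// conjCD -!ipC. Qed.

Let ipZr k u w : L u -> L w -> ip w (k *: u) = conjc k * ip w u.
Proof. by move=> Lu Lw; rewrite (ipC (LZ k Lu) Lw) ipZl// conjCM -ipC. Qed.

Let ipNr u w : L u -> L w -> ip w (- u) = - ip w u.
Proof.
move=> Lu Lw; rewrite -scaleN1r ipZr//.
by rewrite (_ : conjc (-1) = -1) ?mulN1r//; apply: complex_ext; rewrite !cE /= ?oppr0.
Qed.

Let ipBr u v w : L u -> L v -> L w -> ip w (u - v) = ip w u - ip w v.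
Proof. by move=> Lu Lv Lw; rewrite ipDr ?ipNr//; exact: LN. Qed.

Let nsq u := reC (ip u u).

Let nsqD u v : L u -> L v -> nsq (u + v) = nsq u + nsq v + 2 * reC (ip u v).
Proof.
move=> Lu Lv; have Luv := LD Lu Lv.
rewrite /nsq ipDl// !ipDr// (ipC Lu Lv) !cE; ring.
Qed.

Let nsqZ k u : L u -> nsq (k *: u) = csq k * nsq u.
Proof.
by move=> Lu; rewrite /nsq ipZl ?ipZr//; [rewrite mulrA mulCJ cE imCr mul0r subr0|exact: LZ].
Qed.

Let nsqN u : L u -> nsq (- u) = nsq u.
Proof. by move=> Lu; rewrite -scaleN1r nsqZ// csqN /csq/= expr1n expr0n addr0 mul1r. Qed.

(** Expands the squared norm of [u - t z v] with [t] real and [z = ip u v]. Since the form may be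
    degenerate, [v] of norm zero is a separate case. *)
Lemma cauchy_schwarz u v : L u -> L v -> csq (ip u v) <= nsq u * nsq v.
Proof.
move=> Lu Lv; set z := ip u v.
have key (t : R) : 0 <= nsq u - 2 * t * csq z + t ^+ 2 * csq z * nsq v.
  have LZv : L (((t%:C)%C * z) *: v) by exact: LZ.
  have := ip_ge0 (LB Lu LZv); rewrite -/(nsq _) nsqD ?nsqN ?nsqZ//; last exact: LN.
  rewrite ipNr// ipZr// -/z.
  rewrite csqM {1}/csq !cE; congr (0 <= _); rewrite /csq; ring.
have := csq_ge0 z; rewrite le_eqVlt => /orP[/eqP <-|z0].
  by rewrite mulr_ge0// ip_ge0.
have := ip_ge0 Lv; rewrite le_eqVlt => /orP[/eqP|] v0.
  (* With [nsq v = 0] the expression is affine in [t]; this [t] makes it equal to -1, a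
     contradiction. *)
  have := key ((nsq u + 1) / (2 * csq z)); rewrite /nsq -v0 mulr0 addr0 -/(nsq u).
  have -> : 2 * ((nsq u + 1) / (2 * csq z)) * csq z = nsq u + 1.
    by field; rewrite gt_eqF.
  by move=> ?; lra.
have := key (nsq v)^-1.
have -> : nsq u - 2 * (nsq v)^-1 * csq z + (nsq v)^-1 ^+ 2 * csq z * nsq v
  = nsq u - csq z / nsq v by field; rewrite gt_eqF.
by rewrite subr_ge0 ler_pdivrMr.
Qed.

Variable e : nat -> V.
Hypothesis Le : forall j, L (e j).

Let lc (n : nat) (c : nat -> R[i]) := \sum_(j < n) c j *: e j.

Let L_sum n (F : 'I_n -> V) : (forall j, L (F j)) -> L (\sum_(j < n) F j).
Proof. by move=> h; elim/big_ind: _. Qed.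

Let Llc n c : L (lc n c).
Proof. by apply: L_sum => j; exact: LZ. Qed.

Let ip_lc n c w : L w -> ip (lc n c) w = \sum_(j < n) c j * ip (e j) w.
Proof.
move=> Lw; rewrite /lc; elim: n => [|n IH]; first by rewrite !big_ord0 ip0l.
rewrite !big_ord_recr/= ipDl// ?ipZl// ?IH//; last exact: LZ.
by apply: L_sum => j; exact: LZ.
Qed.

Let ip_lcr n c w : L w -> ip w (lc n c) = \sum_(j < n) conjc (c j) * ip w (e j).
Proof.
move=> Lw; rewrite (ipC (Llc n c) Lw) ip_lc// conjC_sum; apply: eq_bigr => j _.
by rewrite conjCM -ipC.
Qed.

Let lcB n c d : lc n c - lc n d = lc n (fun j => c j - d j).
Proof. by rewrite /lc -sumrB; apply: eq_bigr => j _; rewrite scalerBl. Qed.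

Let big_ord_pad (U : nmodType) (F : nat -> U) n N : (n <= N)%N ->
  (forall j, (n <= j)%N -> F j = 0) -> \sum_(j < N) F j = \sum_(j < n) F j.
Proof.
move=> nN F0; rewrite -!(big_mkord xpredT F) (big_cat_nat (n := n))//=.
by rewrite [X in _ + X]big_nat_cond [X in _ + X]big1 ?addr0// => j /andP[/andP[nj _] _]; exact: F0.
Qed.

Let lc_pad n N (c : nat -> R[i]) : (n <= N)%N ->
  lc n c = lc N (fun j => if (j < n)%N then c j else 0).
Proof.
move=> nN; rewrite /lc [RHS](big_ord_pad (F := fun j => (if (j < n)%N then c j else 0) *: e j) nN).
  by apply: eq_bigr => j _; rewrite ltn_ord.
by move=> j nj; rewrite ltnNge nj scale0r.
Qed.

Variables A B : R.
Hypotheses (A0 : 0 < A) (B0 : 0 < B).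
Hypothesis lower : forall n (c : nat -> R[i]), A * \sum_(j < n) csq (c j) <= nsq (lc n c).
Hypothesis upper : forall n (c : nat -> R[i]), nsq (lc n c) <= B * \sum_(j < n) csq (c j).

(** The coefficients solve a linear system whose Gram matrix is invertible: a kernel vector would
    give a combination of norm zero, which [lower] excludes. *)
Lemma galerkin N Phi : L Phi -> exists c : nat -> R[i], forall k, (k < N)%N ->
  ip (Phi - lc N c) (e k) = 0.
Proof.
move=> LPhi.
pose M : 'M[R[i]]_N := \matrix_(j, k) ip (e j) (e k).
have coef (v : 'rV[R[i]]_N) : exists c : nat -> R[i], forall j : 'I_N, c j = v 0 j.
  exists (fun j => if insub j is Some i then v 0 i else 0) => j.
  by rewrite valK.
have ipM (v : 'rV[R[i]]_N) (c : nat -> R[i]) k : (forall j : 'I_N, c j = v 0 j) ->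
    (v *m M) 0 k = ip (lc N c) (e k).
  by move=> cv; rewrite ip_lc// mxE; apply: eq_bigr => j _; rewrite mxE cv.
have Mu : M \in unitmx.
  rewrite -row_free_unit; apply: inj_row_free => v vM0.
  have [c cv] := coef v.
  (* [v *m M = 0] makes the combination orthogonal to each [e j], hence to itself. *)
  have n0 : nsq (lc N c) = 0.
    rewrite /nsq ip_lcr// big1// => j _.
    by rewrite -(ipM v)// vM0 mxE mulr0.
  have := lower N c; rewrite n0 pmulr_rle0// => h.
  have {}h : \sum_(j < N) csq (c j) = 0.
    by apply/eqP; rewrite eq_le h sumr_ge0// => j _; exact: csq_ge0.
  apply/rowP => j; rewrite mxE -cv; apply: csq_eq0; apply/eqP.
  by move/eqP: h; rewrite psumr_eq0 => [/allP/(_ j)|? _]; rewrite ?csq_ge0// mem_index_enum => /(_ isT).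
pose b : 'rV[R[i]]_N := \row_k ip Phi (e k).
have [c cv] := coef (b *m invmx M).
exists c => k kN.
rewrite ipBl//; apply/eqP; rewrite subr_eq0 eq_sym; apply/eqP.
by rewrite -(ipM _ _ (Ordinal kN) cv) -mulmxA mulVmx// mulmx1 mxE.
Qed.

Let tail_upper (c : nat -> R[i]) n m : (n <= m)%N ->
  nsq (lc m c - lc n c) <= B * (\sum_(j < m) csq (c j) - \sum_(j < n) csq (c j)).
Proof.
move=> nm; rewrite (lc_pad c nm) lcB.
apply: le_trans (upper _ _) _; rewrite ler_pM2l//.
have -> : \sum_(j < n) csq (c j) = \sum_(j < m) (if (j < n)%N then csq (c j) else 0).
  rewrite [RHS](big_ord_pad (F := fun j => if (j < n)%N then csq (c j) else 0) nm).
    by apply: eq_bigr => j _; rewrite ltn_ord.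
  by move=> j nj; rewrite ltnNge nj.
rewrite -sumrB; apply: ler_sum => j _; case: ifPn => _; first by rewrite !subrr csq0.
by rewrite !subr0.
Qed.

(** The Galerkin projections obey Pythagoras, so their squared norms [s N] increase and stay below
    [nsq Phi]. Through [lower] the convergence of [s] makes the coefficients Cauchy in l^2 with rate
    [r], and [upper] carries the equations over to the limit coefficients. *)
Lemma interp_exists Phi : L Phi -> exists c : nat -> R[i],
  (exists M : R, forall n, \sum_(j < n) csq (c j) <= M) /\
  forall k, ccvg (fun n => ip (lc n c) (e k)) (ip Phi (e k)).
Proof.
move=> LPhi.
have /choice[c0 c0P] : forall N, exists c : nat -> R[i], forall k, (k < N)%N ->
  ip (Phi - lc N c) (e k) = 0 by move=> N; exact: galerkin.
(* Zeroing the entries from [N] on lets projections of different sizes be compared as combinations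
   of one length, and makes [c 0] identically zero. *)
pose c N j := if (j < N)%N then c0 N j else 0.
have cN N : lc N (c0 N) = lc N (c N) by rewrite (lc_pad _ (leqnn N)).
have cP N k : (k < N)%N -> ip (Phi - lc N (c N)) (e k) = 0.
  by move=> kN; rewrite -cN c0P.
have lcc N M : (N <= M)%N -> lc N (c N) = lc M (c N).
  by move=> NM; rewrite (lc_pad _ NM) /lc; apply: eq_bigr => j _; rewrite /c; case: (j < N)%N.
pose s N := nsq (lc N (c N)).
have orth N M d : (N <= M)%N -> ip (Phi - lc M (c M)) (lc N d) = 0.
  move=> NM; rewrite ip_lcr; last exact: LB.
  by rewrite big1// => j _; rewrite cP ?mulr0// (leq_trans (ltn_ord j)).
have pyth N M : (N <= M)%N ->
    nsq (lc M (c M) - lc N (c N)) = s M - s N.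
  move=> NM; have LM := Llc M (c M); have LN' := Llc N (c N).
  have h : ip (lc M (c M) - lc N (c N)) (lc N (c N)) = 0.
    have -> : lc M (c M) - lc N (c N) = (Phi - lc N (c N)) - (Phi - lc M (c M)).
      by rewrite opprB [RHS]addrC addrA subrK.
    by rewrite ipBl ?orth ?subrr//; exact: LB.
  have := nsqD (LB LM LN') LN'; rewrite subrK h mulr0 addr0 -/(s M) -/(s N).
  by move=> ->; rewrite addrK.
have sPhi N : s N <= nsq Phi.
  have LN' := Llc N (c N).
  have := nsqD (LB LPhi LN') LN'; rewrite subrK orth// mulr0 addr0 => ->.
  by rewrite lerDr ip_ge0//; exact: LB.
have s_nd : nondecreasing_seq s.
  by move=> n m nm; rewrite -subr_ge0 -pyth// ip_ge0//; exact: LB.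
have s_cv : cvgn s by apply: nondecreasing_is_cvgn => //; exists (nsq Phi) => _ [n _ <-].
pose r n := A^-1 * (limn s - s n).
have r0 : r @ \oo --> 0.
  rewrite -(mulr0 A^-1) -(subrr (limn s)); apply: cvgM; first exact: cvg_cst.
  by apply: cvgB => //; exact: cvg_cst.
(* The bound does not depend on [n], so it survives the limit in [M] as an l^2 estimate. *)
have c_cauchy N M n : (N <= M)%N -> \sum_(j < n) csq (c M j - c N j) <= r N.
  move=> NM; rewrite /r mulrC ler_pdivlMr// mulrC.
  pose K := maxn n M.
  have nK : (n <= K)%N by rewrite leq_maxl.
  have MK : (M <= K)%N by rewrite leq_maxr.
  apply: (@le_trans _ _ (A * \sum_(j < K) csq (c M j - c N j))).
    rewrite ler_pM2l// -!(big_mkord xpredT (fun j => csq (c M j - c N j))).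
    by rewrite [leRHS](big_cat_nat (n := n))//= lerDl sumr_ge0// => *; exact: csq_ge0.
  apply: le_trans (lower K (fun j => c M j - c N j)) _; rewrite -lcB -lcc// -lcc ?(leq_trans NM)// pyth//.
  by rewrite lerD2r nondecreasing_cvgn_le.
have /choice[a aP] : forall j, exists z, ccvg (fun N => c N j) z.
  move=> j; have [N M NM|z hz _] := @ccvg_cauchy R (fun N => c N j) r r0; last by exists z.
  apply: le_trans (c_cauchy N M j.+1 NM).
  by rewrite big_ord_recr/= lerDr sumr_ge0// => *; exact: csq_ge0.
have a_close N n : \sum_(j < n) csq (a j - c N j) <= r N.
  have h : (fun M => \sum_(j < n) csq (c M j - c N j)) @ \oo --> \sum_(j < n) csq (a j - c N j).
    elim: n => [|n IH].
      by under eq_fun do rewrite big_ord0; rewrite big_ord0; exact: cvg_cst.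
    under eq_fun do rewrite big_ord_recr; rewrite big_ord_recr/=; apply: cvgD => //.
    by apply: ccvg_csq; apply: ccvgB => //; exact: ccvg_cst.
  rewrite -(cvg_lim _ h)//; apply: limr_le; first by apply/cvg_ex; eexists; exact: h.
  by exists N => // M /= NM; exact: c_cauchy.
exists a; split.
  (* As [c 0] vanishes, [a_close 0] already bounds the partial sums of [csq (a j)] by [r 0]; the
     factor 2 is slack. *)
  exists (2 * r 0%N) => n; apply: le_trans (_ : _ <= \sum_(j < n) 2 * csq (a j - c 0%N j)) _.
    apply: ler_sum => j _; rewrite (_ : c 0%N j = 0)// subr0.
    by rewrite ler_peMl ?csq_ge0// ler1n.
  by rewrite -mulr_sumr ler_pM2l.
move=> k; apply/cvg_csqB/cvgrPdist_lt => eps eps0.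
(* The summand 1 keeps the divisor positive even when [e k] has norm zero. *)
pose K := B * nsq (e k) + 1.
have K0 : 0 < K by rewrite ltr_wpDl// mulr_ge0//; [exact: ltW|exact: ip_ge0].
move/cvgrPdist_lt : r0 => /(_ (eps / K)); rewrite divr_gt0// => /(_ isT)[N _ hN].
exists (maxn N k.+1) => // n /=; rewrite geq_max => /andP[Nn kn].
rewrite sub0r normrN ger0_norm ?csq_ge0//.
have -> : ip (lc n a) (e k) - ip Phi (e k) = ip (lc n (fun j => a j - c n j)) (e k).
  rewrite -lcB ipBl//.
  have /eqP := cP n k kn; rewrite ipBl// subr_eq0 => /eqP ->; ring.
apply: le_lt_trans (cauchy_schwarz (Llc _ _) (Le k)) _.
have := hN n Nn; rewrite /= sub0r normrN => /(le_lt_trans (ler_norm _)).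
rewrite ltr_pdivlMr//; apply: le_lt_trans.
rewrite /K mulrDr mulr1 -[leLHS]addr0 lerD//; last first.
  rewrite /r mulr_ge0 ?invr_ge0 ?(ltW A0)// subr_ge0.
  exact: nondecreasing_cvgn_le.
rewrite mulrA; apply: ler_wpM2r; first exact: ip_ge0.
apply: le_trans (upper _ _) _; rewrite mulrC ler_pM2r//.
Qed.

(** The residual [Phi - p n] becomes orthogonal to each fixed combination and, since [p] is Cauchy,
    to [p n] itself; its squared norm is thus asymptotically at most [nsq Phi]. Subtracting [lc m d]
    from [w] changes nothing in the limit, and Cauchy-Schwarz concludes. The resulting bound carries
    no Riesz constant, which matters because the lower one decays with [al]. *)
Lemma interp_error Phi (c : nat -> R[i]) : L Phi ->
  (exists M : R, forall n, \sum_(j < n) csq (c j) <= M) ->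
  (forall k, ccvg (fun n => ip (lc n c) (e k)) (ip Phi (e k))) ->
  forall w, L w -> exists2 v, ccvg (fun n => ip (lc n c) w) v &
    forall m (d : nat -> R[i]), csq (ip Phi w - v) <= nsq Phi * nsq (w - lc m d).
Proof.
move=> LPhi [M0 cM0] ce w Lw.
pose p n := lc n c; have Lp n : L (p n) by exact: Llc.
pose S n := \sum_(j < n) csq (c j).
have S_nd : nondecreasing_seq S.
  by apply/nondecreasing_seqP => n; rewrite /S big_ord_recr/= lerDl csq_ge0.
have S_cv : cvgn S by apply: nondecreasing_is_cvgn => //; exists M0 => _ [n _ <-]; exact: cM0.
pose t n := limn S - S n.
have t0 : t @ \oo --> 0.
  by rewrite -(subrr (limn S)); apply: cvgB => //; exact: cvg_cst.
have t_ge0 n : 0 <= t n by rewrite subr_ge0 nondecreasing_cvgn_le.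
have p_tail n m : (n <= m)%N -> nsq (p m - p n) <= B * t n.
  move=> nm; apply: le_trans (tail_upper _ nm) _.
  by rewrite ler_pM2l// lerD2r nondecreasing_cvgn_le.
have tK (K : R) : (fun n => K * t n) @ \oo --> 0.
  by rewrite -(mulr0 K); apply: cvgM => //; exact: cvg_cst.
have [v pv _] : exists2 v, ccvg (fun n => ip (p n) w) v &
    forall n, csq (v - ip (p n) w) <= B * nsq w * t n.
  apply: ccvg_cauchy => // n m nm; rewrite -ipBl//.
  apply: le_trans (cauchy_schwarz (LB (Lp m) (Lp n)) Lw) _.
  by rewrite -/(nsq w) mulrAC ler_wpM2r ?p_tail// ip_ge0.
exists v => // m d.
pose D := 2 * nsq Phi + 2 * (B * t 0%N).
have nsqB_le u u' : L u -> L u' -> nsq (u - u') <= 2 * nsq u + 2 * nsq u'.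
  move=> Lu Lu'; have := ip_ge0 (LD Lu Lu').
  rewrite -/(nsq _) !nsqD ?nsqN//; last exact: LN.
  by rewrite ipNr// !cE; lra.
have pD n : nsq (Phi - p n) <= D.
  apply: le_trans (nsqB_le _ _ LPhi (Lp n)) _; rewrite lerD2l ler_pM2l//.
  have := p_tail 0%N n (leq0n n).
  by rewrite [p 0%N]big_ord0 subr0.
have D0 : 0 <= D by apply: le_trans (pD 0%N); apply: ip_ge0; exact: LB.
have err_lc m' d' : ccvg (fun n => ip (Phi - p n) (lc m' d')) 0.
  under eq_fun => n do rewrite (ip_lcr _ _ (LB LPhi (Lp n))).
  have h0 : \sum_(j < m') (conjc (d' j) * (ip Phi (e j) - ip Phi (e j))) = 0.
    by rewrite big1// => j _; rewrite subrr mulr0.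
  rewrite -[X in ccvg _ X]h0.
  apply: (@ccvg_sum _ m' (fun n j => conjc (d' j) * ip (Phi - p n) (e j))
    (fun j => conjc (d' j) * (ip Phi (e j) - ip Phi (e j)))) => j _.
  apply: ccvgZ; under eq_fun do rewrite ipBl//.
  by apply: ccvgB; [exact: ccvg_cst|exact: ce].
(* Here [p n] moves with [n], so it is split as [p n - p N] plus [p N]: the first part is small
   uniformly in [n >= N], the second is a fixed combination covered by [err_lc]. *)
have z0 : ccvg (fun n => ip (Phi - p n) (p n)) 0.
  apply/cvg_csqB/cvgrPdist_lt => eps eps0.
  have eps2 : 0 < eps / 2 by rewrite divr_gt0.
  move/cvgrPdist_lt : (tK (2 * D * B)) => /(_ _ eps2)[N _ hN].
  have /cvg_csqB/cvgrPdist_lt/(_ (eps / 4)) := err_lc N c.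
  rewrite divr_gt0// => /(_ isT)[K _ hK].
  exists (maxn N K) => // n /=; rewrite geq_max => /andP[Nn Kn].
  rewrite sub0r normrN ger0_norm ?csq_ge0// subr0.
  have := hN N (leqnn N); have := hK n Kn; rewrite /= !sub0r !normrN subr0.
  move=> /(le_lt_trans (ler_norm _)) h1 /(le_lt_trans (ler_norm _)) h2.
  have -> : ip (Phi - p n) (p n) = ip (Phi - p n) (p n - p N) + ip (Phi - p n) (p N).
    by rewrite -ipDr ?subrK//; exact: LB.
  apply: le_lt_trans (csqD _ _) _.
  have h3 : csq (ip (Phi - p n) (p n - p N)) <= D * (B * t N).
    apply: le_trans (cauchy_schwarz (LB LPhi (Lp n)) (LB (Lp n) (Lp N))) _.
    apply: ler_pM => //; last exact: p_tail.
    - exact: ip_ge0 (LB LPhi (Lp n)).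
    - exact: ip_ge0 (LB (Lp n) (Lp N)).
  by move: h1 h2 h3; rewrite /p; lra.
have pPhi n : nsq (Phi - p n) <= nsq Phi - 2 * reC (ip (Phi - p n) (p n)).
  have := nsqD (LB LPhi (Lp n)) (Lp n); rewrite subrK => ->.
  by have := ip_ge0 (Lp n); rewrite -/(nsq _); lra.
have lim1 : ccvg (fun n => ip (Phi - p n) w - ip (Phi - p n) (lc m d)) (ip Phi w - v).
  rewrite -[X in ccvg _ X]subr0; apply: ccvgB => //.
  by under eq_fun do rewrite ipBl//; apply: ccvgB => //; exact: ccvg_cst.
have lim2 : (fun n => (nsq Phi - 2 * reC (ip (Phi - p n) (p n))) * nsq (w - lc m d))
    @ \oo --> nsq Phi * nsq (w - lc m d).
  rewrite -[X in X * nsq _]subr0 -(mulr0 2).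
  apply: cvgM; last exact: cvg_cst.
  apply: cvgB; first exact: cvg_cst.
  by apply: cvgM; [exact: cvg_cst|case: z0].
have lim3 := ccvg_csq lim1.
rewrite -(cvg_lim _ lim2)// -(cvg_lim _ lim3)//.
apply: ler_lim; [by apply/cvg_ex; eexists; exact: lim3|by apply/cvg_ex; eexists; exact: lim2|].
apply: nearW => n; rewrite -ipBr//; last exact: LB.
apply: le_trans (cauchy_schwarz (LB LPhi (Lp n)) (LB Lw (Llc m d))) _.
by rewrite ler_wpM2r// ip_ge0//; exact: LB.
Qed.

End PreHilbert.

(** * Changes of variables in the plane *)

Section ChangeOfVariables.
Context {R : realType}.
Local Notation leb := (@lebesgue_measure R).
Local Open Scope ereal_scope.

Let push (f : R -> R) (mf : measurable_fun [set: measurableTypeR R] (f : measurableTypeR R -> measurableTypeR R)) :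
    {measure set (measurableTypeR R) -> \bar R} :=
  measure_function_pushforward__canonical__measure_function_Measure leb mf.

Let mk_mscale (a : {nonneg R}) (m : {measure set (measurableTypeR R) -> \bar R}) :
  {measure set (measurableTypeR R) -> \bar R} := mscale a m.

Let affine_meas (a b : R) : measurable_fun [set: measurableTypeR R]
  ((fun x => a * x + b)%R : measurableTypeR R -> measurableTypeR R).
Proof. by apply: measurable_funD; [exact: mulrl_measurable|exact: measurable_cst]. Qed.

(** By uniqueness of Lebesgue measure it suffices to compare both sides on half-open intervals. *)
Lemma lebesgue_measure_affine (a b : R) (a0 : (0 < a)%R) (A : set R) : measurable A ->
  leb A = mk_mscale (NngNum (ltW a0)) (push (affine_meas a b)) A.
Proof.
move=> mA; apply: lebesgue_measure_unique => //= _ [[c d] _ <-].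
rewrite /mscale/= /pushforward/=.
have -> : (fun x : R => (a * x + b)%R) @^-1` `](c, d).1, (c, d).2]%classic
    = `]((c - b) / a)%R, ((d - b) / a)%R]%classic.
  by apply/seteqP; split => x /=; rewrite !in_itv/= ltr_pdivrMr// ler_pdivlMr// ltrBlDr lerBrDr mulrC.
rewrite !lebesgue_measure_itv/= !lte_fin ltr_pM2r ?invr_gt0// ltrD2r.
case: ifPn => _; last by rewrite mule0.
by rewrite -!EFinD -EFinM; congr EFin; field; rewrite gt_eqF.
Qed.

Lemma ge0_integral_affine (a b : R) (f : R -> \bar R) : (0 < a)%R ->
  measurable_fun [set: R] f -> (forall x, 0 <= f x) ->
  \int[leb]_x f x = a%:E * \int[leb]_x f (a * x + b)%R.
Proof.
move=> a0 mf f0.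
rewrite (eq_measure_integral (mk_mscale (NngNum (ltW a0)) (push (affine_meas a b)))).
  rewrite ge0_integral_mscale//=; congr (_ * _).
  by rewrite (ge0_integral_pushforward (affine_meas a b)).
by move=> A mA _; exact: lebesgue_measure_affine.
Qed.

Lemma ge0_integral_opp (f : R -> \bar R) :
  measurable_fun [set: R] f -> (forall x, 0 <= f x) ->
  \int[leb]_x f (- x)%R = \int[leb]_x f x.
Proof.
move=> mf f0; rewrite [RHS](eq_measure_integral (push (@oppr_measurable R setT))).
  by rewrite ge0_integral_pushforward.
by move=> A mA _; exact/esym/lebesgue_measureN.
Qed.

Let comp_scale (a : R) (f : R -> \bar R) : measurable_fun [set: R] f ->
  measurable_fun [set: R] (fun x => f (a * x)%R).
Proof. by move=> mf; apply: (measurableT_comp mf); exact: mulrl_measurable. Qed.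

Lemma ge0_integral_scale (a : R) (f : R -> \bar R) : (a != 0)%R ->
  measurable_fun [set: R] f -> (forall x, 0 <= f x) ->
  \int[leb]_x f x = `|a|%:E * \int[leb]_x f (a * x)%R.
Proof.
move=> a0 mf f0; have [a_lt0|a_ge0] := ltP a 0%R.
  rewrite ltr0_norm// (@ge0_integral_affine (- a) 0%R) ?oppr_gt0//; congr (_ * _).
  rewrite -(ge0_integral_opp (comp_scale a mf))//.
  by apply: eq_integral => x _; rewrite addr0 mulNr mulrN.
rewrite ger0_norm// (@ge0_integral_affine a 0%R)//; last by rewrite lt_neqAle eq_sym a0.
by congr (_ * _); apply: eq_integral => x _; rewrite addr0.
Qed.

(** Positive and negative parts are scaled separately, so the identity holds for every measurable
    [f], integrable or not. *)
Lemma integral_scale (a : R) (f : R -> \bar R) : (a != 0)%R ->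
  measurable_fun [set: R] f ->
  \int[leb]_x f x = \int[leb]_x (`|a|%:E * f (a * x)%R).
Proof.
move=> a0 mf.
have a1 : (0 <= `|a|)%R by [].
have pE : (fun x : R => `|a|%:E * f (a * x)%R)^\+ = (fun x => `|a|%:E * f^\+ (a * x)%R).
  rewrite (ge0_funeposM (f \o ( *%R a)) a1); apply/funext => x.
  by rewrite funepos_comp.
have nE : (fun x : R => `|a|%:E * f (a * x)%R)^\- = (fun x => `|a|%:E * f^\- (a * x)%R).
  rewrite (ge0_funenegM (f \o ( *%R a)) a1); apply/funext => x.
  by rewrite funeneg_comp.
have mp := measurable_funepos mf; have mn := measurable_funeneg mf.
rewrite integralE [RHS]integralE pE nE.
have Z (g : R -> \bar R) : measurable_fun [set: R] g -> (forall x, 0 <= g x) ->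
    \int[leb]_x (`|a|%:E * g (a * x)%R) = \int[leb]_x g x.
  move=> mg g0; rewrite (ge0_integral_scale a0 mg g0).
  by apply: ge0_integralZl => //; exact: comp_scale.
by rewrite (Z _ mp)// (Z _ mn).
Qed.

Lemma ge0_integral_mu2 (f : R * R -> \bar R) : measurable_fun [set: R * R] f ->
  (forall x, 0 <= f x) -> \int[@mu2 R]_z f z = \int[leb]_x \int[leb]_y f (x, y).
Proof. by move=> mf f0; exact: (@fubini_tonelli1 _ _ _ _ _ leb leb f mf f0). Qed.

Lemma measurable_shift2 (b : R * R) (d : measure_display) (U : measurableType d) (f : R * R -> U) :
  measurable_fun [set: R * R] f ->
  measurable_fun [set: R * R] (fun z => f (z.1 + b.1, z.2 + b.2)%R).
Proof.
move=> mf; apply: (measurableT_comp mf); apply: measurable_fun_pair.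
  by apply: measurable_funD; [exact: measurable_fst|exact: measurable_cst].
by apply: measurable_funD; [exact: measurable_snd|exact: measurable_cst].
Qed.

(** Tonelli reduces the claim to [ge0_integral_affine] with factor 1 in each coordinate. *)
Lemma ge0_integral_shift2 (b : R * R) (f : R * R -> \bar R) :
  measurable_fun [set: R * R] f -> (forall x, 0 <= f x) ->
  \int[@mu2 R]_z f (z.1 + b.1, z.2 + b.2)%R = \int[@mu2 R]_z f z.
Proof.
move=> mf f0; rewrite (ge0_integral_mu2 mf f0).
rewrite (ge0_integral_mu2 (measurable_shift2 b mf) (fun z => f0 _))/=.
have mF : measurable_fun [set: R] (fun x => \int[leb]_y f (x, y)).
  exact: (@measurable_fun_fubini_tonelli_F _ _ _ _ _ leb f mf f0).
have F0 x : 0 <= \int[leb]_y f (x, y) by apply: integral_ge0 => y _.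
rewrite [RHS](@ge0_integral_affine 1%R b.1 _ ltr01 mF F0) mul1e.
apply: eq_integral => x _; rewrite mul1r.
rewrite [RHS](@ge0_integral_affine 1%R b.2 _ ltr01 (measurable_fun_pair2 _ mf)) ?mul1e//.
by apply: eq_integral => y _; rewrite mul1r.
Qed.

End ChangeOfVariables.

(** * Square-integrable functions on the plane *)

Section L2.
Context {R : realType}.
Local Notation mu2 := (@mu2 R).
Local Notation V := (R * R -> R[i]).
Implicit Types (u v w : V) (f g : R * R -> R).

Lemma integrable_dom f g : measurable_fun [set: R * R] f ->
  (forall x, `|f x| <= g x) -> mu2.-integrable setT (EFin \o g) ->
  mu2.-integrable setT (EFin \o f).
Proof.
move=> mf fg ig; apply: (le_integrable measurableT _ _ ig).
  exact/measurable_EFinP.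
by move=> x _; rewrite /= lee_fin (le_trans (fg x))// ler_norm.
Qed.

Lemma measurable_csq (D : set (R * R)) u : measurable_fun D (fun x => reC (u x)) ->
  measurable_fun D (fun x => imC (u x)) -> measurable_fun D (fun x => csq (u x)).
Proof. by move=> m1 m2; apply: measurable_funD; apply: measurable_funX. Qed.

Definition L2 u := L2_on setT u.

Lemma L2_integrable u : L2 u -> mu2.-integrable setT (fun x => (csq (u x))%:E).
Proof.
move=> [m1 m2 h]; apply/integrableP; split.
  by apply/measurable_EFinP; exact: measurable_csq.
by under eq_integral do rewrite gee0_abs ?lee_fin ?csq_ge0//.
Qed.

Lemma L2_dom u g : measurable_fun [set: R * R] (fun x => reC (u x)) ->
  measurable_fun [set: R * R] (fun x => imC (u x)) ->
  (forall x, csq (u x) <= g x) -> mu2.-integrable setT (EFin \o g) -> L2 u.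
Proof.
move=> m1 m2 ug ig; split=> //.
have : mu2.-integrable setT (EFin \o (fun x => csq (u x))).
  apply: integrable_dom ig; first exact: measurable_csq.
  by move=> x; rewrite ger0_norm ?csq_ge0.
move=> /integrableP[_]; under eq_integral do rewrite /= ger0_norm ?csq_ge0//.
by [].
Qed.

Let prod_bound (a b : R[i]) : `|reC (a * b)| <= csq a + csq b /\ `|imC (a * b)| <= csq a + csq b.
Proof.
have h (x y z t : R) : `|x * y + z * t| <= x ^+ 2 + z ^+ 2 + (y ^+ 2 + t ^+ 2).
  have := (sqr_ge0 (x - y), sqr_ge0 (x + y), sqr_ge0 (z - t), sqr_ge0 (z + t),
    sqr_ge0 x, sqr_ge0 y, sqr_ge0 z, sqr_ge0 t) => -[[[[[[[]]]]]]].
  by rewrite ler_norml => *; apply/andP; split; nra.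
split; rewrite !cE /csq.
  by have := h (reC a) (reC b) (- imC a) (imC b); rewrite mulNr sqrrN.
by have := h (reC a) (imC b) (imC a) (reC b); rewrite [imC b ^+ 2 + _]addrC.
Qed.

Lemma L2_mul_integrable u v : L2 u -> L2 v ->
  mu2.-integrable setT (EFin \o (fun x => reC (u x * v x))) /\
  mu2.-integrable setT (EFin \o (fun x => imC (u x * v x))).
Proof.
move=> Lu Lv; have [mu1 mu2' _] := Lu; have [mv1 mv2 _] := Lv.
have i : mu2.-integrable setT (EFin \o (fun x => csq (u x) + csq (v x))).
  exact: (integrableD measurableT (L2_integrable Lu) (L2_integrable Lv)).
split; apply: (integrable_dom _ _ i).
- by under eq_fun do rewrite reCM; apply: measurable_funB; apply: measurable_funM.
- by move=> x; case: (prod_bound (u x) (v x)).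
- by under eq_fun do rewrite imCM; apply: measurable_funD; apply: measurable_funM.
- by move=> x; case: (prod_bound (u x) (v x)).
Qed.

Lemma L2_conj u : L2 u -> L2 (fun x => conjc (u x)).
Proof.
move=> [m1 m2 h]; split.
- by under eq_fun do rewrite reCJ.
- by under eq_fun do rewrite imCJ; exact: measurable_funN.
- by under eq_integral do rewrite csqJ.
Qed.

Lemma L2_0 : L2 (fun=> 0).
Proof.
split; [exact: measurable_cst|exact: measurable_cst|].
rewrite (eq_integral (cst 0%E)); first by rewrite integral0.
by move=> x _; rewrite csq0.
Qed.

Lemma L2_D u v : L2 u -> L2 v -> L2 (fun x => u x + v x).
Proof.
move=> Lu Lv; have [mu1 mu2' _] := Lu; have [mv1 mv2 _] := Lv.
apply: (@L2_dom _ (fun x => 2 * csq (u x) + 2 * csq (v x))).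
- by under eq_fun do rewrite reCD; apply: measurable_funD.
- by under eq_fun do rewrite imCD; apply: measurable_funD.
- by move=> x; exact: csqD.
have := integrableD measurableT (integrableZl measurableT 2 (L2_integrable Lu))
  (integrableZl measurableT 2 (L2_integrable Lv)).
exact.
Qed.

Lemma L2_Z (k : R[i]) u : L2 u -> L2 (fun x => k * u x).
Proof.
move=> Lu; have [mu1 mu2' _] := Lu.
apply: (@L2_dom _ (fun x => csq k * csq (u x))).
- under eq_fun do rewrite reCM.
  by apply: measurable_funB; apply: measurable_funM => //; exact: measurable_cst.
- under eq_fun do rewrite imCM.
  by apply: measurable_funD; apply: measurable_funM => //; exact: measurable_cst.
- by move=> x; rewrite -csqM.
exact: (integrableZl measurableT (csq k) (L2_integrable Lu)).
Qed.

Definition ip2 u v : R[i] := cint setT (fun x => u x * conjc (v x)).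

Lemma cint_ext (D : set (R * R)) (h k : R * R -> R[i]) :
  (forall x, D x -> h x = k x) -> cint D h = cint D k.
Proof.
by move=> hk; rewrite /cint; congr Complex; apply: eq_Rintegral => x /set_mem /hk ->.
Qed.

Definition cintegrable (h : R * R -> R[i]) :=
  mu2.-integrable setT (EFin \o (fun x => reC (h x))) /\
  mu2.-integrable setT (EFin \o (fun x => imC (h x))).

Lemma cintD (h k : R * R -> R[i]) : cintegrable h -> cintegrable k ->
  cint setT (fun x => h x + k x) = cint setT h + cint setT k.
Proof.
move=> [h1 h2] [k1 k2]; apply: complex_ext; rewrite cE.
  by rewrite -RintegralD//; apply: eq_Rintegral => x _; rewrite reCD.
by rewrite -RintegralD//; apply: eq_Rintegral => x _; rewrite imCD.
Qed.

Lemma cintZ (c : R[i]) (h : R * R -> R[i]) : cintegrable h ->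
  cint setT (fun x => c * h x) = c * cint setT h.
Proof.
move=> [h1 h2]; apply: complex_ext; rewrite cE /=.
  rewrite -!RintegralZl// -RintegralB//; last 2 first.
  - exact: (integrableZl measurableT (reC c) h1).
  - exact: (integrableZl measurableT (imC c) h2).
  by apply: eq_Rintegral => x _; rewrite -reCM.
rewrite -!RintegralZl// -RintegralD//; last 2 first.
- exact: (integrableZl measurableT (reC c) h2).
- exact: (integrableZl measurableT (imC c) h1).
by apply: eq_Rintegral => x _; rewrite -imCM.
Qed.

Lemma cintJ (h : R * R -> R[i]) : cintegrable h ->
  cint setT (fun x => conjc (h x)) = conjc (cint setT h).
Proof.
move=> [h1 h2]; apply: complex_ext; rewrite cE /=.
  by apply: eq_Rintegral => x _; rewrite reCJ.
rewrite -mulN1r -RintegralZl//.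
by apply: eq_Rintegral => x _; rewrite imCJ mulN1r.
Qed.

Lemma ip2_integrable u v : L2 u -> L2 v -> cintegrable (fun x => u x * conjc (v x)).
Proof. by move=> Lu Lv; apply: L2_mul_integrable => //; exact: L2_conj. Qed.

Lemma ip2Dl u v w : L2 u -> L2 v -> L2 w -> ip2 (fun x => u x + v x) w = ip2 u w + ip2 v w.
Proof.
move=> Lu Lv Lw; rewrite -cintD; [|exact: ip2_integrable..].
by apply: cint_ext => x _; rewrite mulrDl.
Qed.

Lemma ip2Zl k u w : L2 u -> L2 w -> ip2 (fun x => k * u x) w = k * ip2 u w.
Proof.
move=> Lu Lw; rewrite -cintZ; last exact: ip2_integrable.
apply: cint_ext => x _.
by rewrite mulrA.
Qed.

Lemma ip2C u v : L2 u -> L2 v -> ip2 v u = conjc (ip2 u v).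
Proof.
move=> Lu Lv; rewrite -cintJ; last exact: ip2_integrable.
apply: cint_ext => x _; apply: complex_ext; rewrite !cE; ring.
Qed.

Lemma ip2_nsq u : reC (ip2 u u) = Rintegral mu2 setT (fun x => csq (u x)).
Proof.
rewrite /ip2 /cint [LHS]/=.
by apply: eq_Rintegral => x _; rewrite mulCJ.
Qed.

Lemma ip2_ge0 u : L2 u -> 0 <= reC (ip2 u u).
Proof. by move=> _; rewrite ip2_nsq; apply: Rintegral_ge0 => x _; exact: csq_ge0. Qed.

End L2.

(** * The Fourier transform of [exp (- al |xi|)] *)

Section HalfLine.
Context {R : realType}.
Local Notation leb := (@lebesgue_measure R).
Implicit Types (f F : R -> R).

Lemma is_derive1_continuous F (f : R -> R) : (forall x : R, is_derive x (1 : R) F (f x)) -> continuous F.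
Proof.
move=> dF x; apply: differentiable_continuous; apply/derivable1_diffP.
by have := dF x => -[].
Qed.

Lemma ge0_FTC_half f F (l : R) : (forall x, 0 <= x -> 0 <= f x) -> continuous f ->
  (forall x : R, is_derive x (1 : R) F (f x)) -> F x @[x --> +oo] --> l ->
  (\int[leb]_(x in `[0%R, +oo[) (f x)%:E = (l - F 0)%:E)%E.
Proof.
move=> f0 cf dF Fl; rewrite EFinB; apply: ge0_continuous_FTC2y => //.
- exact: continuous_subspaceT.
- apply: cvg_at_right_filter; exact: (is_derive1_continuous dF).
- by move=> x _; rewrite derive1E; apply: derive_val; have := dF x.
Qed.

(** The line is cut at 0; on the negative half the reflected integrand [f (- x)] has the
    antiderivative [- F (- x)], so the half-line statement applies twice. *)
Lemma ge0_FTC_line f F (l1 l2 : R) : (forall x, 0 <= f x) -> continuous f ->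
  (forall x : R, is_derive x (1 : R) F (f x)) -> F x @[x --> +oo] --> l2 ->
  F x @[x --> -oo] --> l1 ->
  (\int[leb]_x (f x)%:E = (l2 - l1)%:E)%E.
Proof.
move=> f0 cf dF F2 F1.
have mf : measurable_fun [set: R] (EFin \o f).
  by apply/measurable_EFinP; exact: continuous_measurable_fun.
have cN : continuous (-%R : R -> R) by move=> x; exact: opp_continuous.
have cfN : continuous (fun x => f (- x)).
  by move=> x; apply: (@continuous_comp _ _ _ (-%R : R -> R) f); [exact: cN|exact: cf].
have mfN : measurable_fun [set: R] (EFin \o (fun x => f (- x))).
  by apply/measurable_EFinP; exact: continuous_measurable_fun.
have -> : [set: R] = `]-oo, (0 : R)]%classic `|` `]0, +oo[%classic.
  apply/seteqP; split => x //= _; rewrite !in_itv/= andbT.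
  by case: (leP x 0) => _; [left|right].
rewrite ge0_integral_setU//=; last 3 first.
- exact: measurable_funTS.
- by move=> x _; rewrite lee_fin.
- apply/disj_setPS => x [/=]; rewrite !in_itv/= andbT => /le_lt_trans h /h.
  by rewrite ltxx.
have -> : (\int[leb]_(x in `]-oo, 0%R]) (f x)%:E = \int[leb]_(x in `[0%R, +oo[) (f (- x))%:E)%E.
  rewrite [RHS](ge0_integration_by_substitution0 mfN); last by move=> r; rewrite lee_fin.
  by apply: eq_integral => x _; rewrite /= opprK.
have -> : (\int[leb]_(x in `]0%R, +oo[) (f x)%:E = \int[leb]_(x in `[0%R, +oo[) (f x)%:E)%E.
  by rewrite integral_itv_obnd_cbnd//; exact: measurable_funTS.
rewrite (ge0_FTC_half _ cf dF F2)//.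
have dFN (x : R) : is_derive x (1 : R) (fun x => - F (- x)) (f (- x)).
  have dN : is_derive x (1 : R) (F \o -%R) (f (- x) * -1) by exact: is_derive1_comp.
  by apply: is_derive_eq; rewrite mulrN1 opprK.
rewrite (@ge0_FTC_half (fun x => f (- x)) (fun x => - F (- x)) (- l1))//.
  rewrite oppr0 opprK -EFinD; congr EFin; ring.
by apply: cvgN; move/cvgNy_compNP : F1.
Qed.

Let cvg_inv_sqr : (fun x : R => (1 + x ^+ 2)^-1) x @[x --> +oo] --> (0 : R).
Proof.
apply/cvgrPdist_lt => e e0; near=> x.
have x1 : 1 < x by near: x; apply: nbhs_pinfty_gt; rewrite num_real.
have xe : e^-1 < x by near: x; apply: nbhs_pinfty_gt; rewrite num_real.
have h : 0 < 1 + x ^+ 2 by rewrite ltr_pwDl// sqr_ge0.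
rewrite sub0r normrN ger0_norm ?invr_ge0 ?(ltW h)// invf_plt ?posrE//.
by apply: (lt_trans xe); nra.
Unshelve. all: end_near. Qed.

Let cvg_id_inv_sqr : (fun x : R => x * (1 + x ^+ 2)^-1) x @[x --> +oo] --> (0 : R).
Proof.
apply/cvgrPdist_lt => e e0; near=> x.
have x1 : 1 < x by near: x; apply: nbhs_pinfty_gt; rewrite num_real.
have xe : e^-1 < x by near: x; apply: nbhs_pinfty_gt; rewrite num_real.
have h : 0 < 1 + x ^+ 2 by rewrite ltr_pwDl// sqr_ge0.
have x0 : 0 < x by apply: lt_trans x1.
rewrite sub0r normrN ger0_norm; last by rewrite divr_ge0 ?(ltW h) ?(ltW x0).
rewrite ltr_pdivrMr//.
have : 1 < e * x by move: xe; rewrite -ltr_pdivrMl ?divr1 ?mulr1 ?invrK//.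
by nra.
Unshelve. all: end_near. Qed.

(** This is the shape of the antiderivatives met in the slope variable: the rational part dies at
    both ends and only the arctangent contributes. *)
Lemma cvg_atan_rat (k m1 m0 : R) :
  (fun y : R => k * atan y + (m1 * y + m0) / (1 + y ^+ 2)) y @[y --> +oo] --> k * (pi / 2) /\
  (fun y : R => k * atan y + (m1 * y + m0) / (1 + y ^+ 2)) y @[y --> -oo] --> k * (- (pi / 2)).
Proof.
have E c1 : (fun y : R => k * atan y + (c1 * y + m0) / (1 + y ^+ 2)) =
    (fun y => k * atan y + (c1 * (y * (1 + y ^+ 2)^-1) + m0 * (1 + y ^+ 2)^-1)).
  by apply/funext => y; rewrite mulrDl mulrA.
have h c1 c2 : (fun y : R => c2 * atan y + (c1 * (y * (1 + y ^+ 2)^-1) + m0 * (1 + y ^+ 2)^-1)) y @[y --> +oo]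
    --> c2 * (pi / 2).
  rewrite -[X in _ --> X]addr0 -[in X in _ --> X](addr0 0) -[in X in _ --> _ + (X + _)](mulr0 c1) -[in X in _ --> _ + (_ + X)](mulr0 m0).
  apply: cvgD; first by apply: cvgM; [exact: cvg_cst|exact: cvgy_atan].
  by apply: cvgD; (apply: cvgM; first exact: cvg_cst); [exact: cvg_id_inv_sqr|exact: cvg_inv_sqr].
split; first by rewrite E; exact: h.
apply/cvgNy_compNP; rewrite E mulrN -mulNr.
have -> : (fun y => k * atan y + (m1 * (y * (1 + y ^+ 2)^-1) + m0 * (1 + y ^+ 2)^-1)) \o -%R =
   (fun y => (- k) * atan y + ((- m1) * (y * (1 + y ^+ 2)^-1) + m0 * (1 + y ^+ 2)^-1)).
  by apply/funext => y /=; rewrite atanN sqrrN; ring.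
exact: h.
Qed.

End HalfLine.

(** * One-variable integrals: a Laplace transform in the abscissa, rational functions in the
    slope *)

Section OneDim.
Context {R : realType}.
Local Notation leb := (@lebesgue_measure R).

Lemma ge0_integrable d (T : measurableType d) (mu : {measure set T -> \bar R}) (f : T -> R) (c : R) :
  measurable_fun [set: T] f -> (forall x, 0 <= f x) -> (\int[mu]_x (f x)%:E = c%:E)%E ->
  mu.-integrable setT (EFin \o f).
Proof.
move=> mf f0 fc; apply/integrableP; split; first exact/measurable_EFinP.
by under eq_integral do rewrite /= ger0_norm//; rewrite fc ltry.
Qed.

(** Rests on [expR (p * u) >= (p * u) ^+ 2 / 4], obtained by squaring [expR y >= y] at half the
    argument. *)
Lemma cvg_expRN_linear (p A B : R) (g : R -> R) : 0 < p ->
  (forall u, 0 <= u -> `|g u| <= A * u + B) ->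
  (fun u => expR (- (p * u)) * g u) u @[u --> +oo] --> (0 : R).
Proof.
move=> p0 gAB; apply/cvgrPdist_lt => e e0; near=> u.
have u1 : 1 < u by near: u; apply: nbhs_pinfty_gt; rewrite num_real.
have u0 : 0 < u by exact: lt_trans u1.
have AB0 : 0 <= A * u + B by apply: le_trans (gAB u (ltW u0)).
(* For [u > K] the quadratic [e * (p * u) ^+ 2 / 4] exceeds [(|A| + |B|) * u]. *)
pose K := 4 * (`|A| + `|B|) / p ^+ 2 / e.
have uK : K < u by near: u; apply: nbhs_pinfty_gt; rewrite num_real.
have h1 : A * u + B <= (`|A| + `|B|) * u.
  have := ler_norm A; have := ler_norm B; have := normr_ge0 B; nra.
have h2 : (p * u) ^+ 2 / 4 <= expR (p * u).
  pose y := p * u / 2; have y0 : 0 <= y by rewrite divr_ge0 ?mulr_ge0 ?(ltW p0) ?(ltW u0).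
  have -> : p * u = y + y by rewrite /y; field.
  rewrite expRD -expr2 (_ : (y + y) ^+ 2 / 4 = y ^+ 2); last by field.
  rewrite ler_pXn2r ?nnegrE ?expR_ge0//.
  by apply: le_trans (expR_ge1Dx _); rewrite lerDr.
rewrite sub0r normrN normrM ger0_norm ?expR_ge0// expRN mulrC ltr_pdivrMr ?expR_gt0//.
apply: le_lt_trans (gAB u (ltW u0)) _; apply: le_lt_trans h1 _.
apply: (@lt_le_trans _ _ (e * ((p * u) ^+ 2 / 4))); last by rewrite ler_pM2l.
have p20 : 0 < p ^+ 2 by rewrite exprn_gt0.
move: uK; rewrite /K !ltr_pdivrMr// => h3.
rewrite exprMn; nra.
Unshelve. all: end_near. Qed.

Section Laplace.
Variables (p q : R).
Hypothesis p0 : 0 < p.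
Let n := p ^+ 2 + q ^+ 2.
Let n0 : n != 0.
Proof. by rewrite gt_eqF// ltr_pwDl ?exprn_gt0// sqr_ge0. Qed.
Let pn0 : p != 0. Proof. by rewrite gt_eqF. Qed.

(** [expR (- (p * u)) * G u] is the real part of [- exp(- z u) (u / z + 1 / z^2)], an antiderivative
    of [u exp(- z u)], summed over [z = p] and [z = p - i q]; [n] is the squared modulus of the
    latter. *)
Let G (u : R) := - (u / p + 1 / p ^+ 2) + (u * ((- p * cos (q * u) + q * sin (q * u)) / n)
   - ((p ^+ 2 - q ^+ 2) * cos (q * u) - 2 * p * q * sin (q * u)) / n ^+ 2).

Let F (u : R) := expR (- (p * u)) * G u.

Let dF (u : R) : is_derive u (1 : R) F (u * expR (- (p * u)) * (1 + cos (q * u))).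
Proof.
rewrite /F /G; apply: is_derive_eq.
rewrite -[q%:A]/(q * 1) -[p%:A]/(p * 1) /GRing.scale/=.
by move: n0 pn0; rewrite /n => ? ?; field; apply/andP.
Qed.

Let F0 : F 0 = - (1 / p ^+ 2 + (p ^+ 2 - q ^+ 2) / n ^+ 2).
Proof. by rewrite /F /G !mulr0 oppr0 expR0 cos0 sin0; ring. Qed.

Let cvgF : F u @[u --> +oo] --> (0 : R).
Proof.
apply: (@cvg_expRN_linear p (p^-1 + (p + `|q|) / n)
  ((p ^+ 2)^-1 + (p ^+ 2 + q ^+ 2 + 2 * p * `|q|) / n ^+ 2)) => // u u0.
have n_gt0 : 0 < n by rewrite ltr_pwDl ?exprn_gt0// sqr_ge0.
have cb : `|cos (q * u)| <= 1 by rewrite ler_norml cos_geN1 cos_le1.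
have sb : `|sin (q * u)| <= 1 by rewrite ler_norml sin_geN1 sin_le1.
rewrite /G; apply: le_trans (ler_normD _ _) _; rewrite normrN.
have h1 : `|u / p + 1 / p ^+ 2| = p^-1 * u + (p ^+ 2)^-1.
  rewrite ger0_norm; first by field.
  by rewrite addr_ge0// divr_ge0// ?exprn_ge0// ltW.
rewrite h1; set c := cos _; set s := sin _.
have h2 : `|u * ((- p * c + q * s) / n)| <= (p + `|q|) / n * u.
  have b1 : `|- p * c + q * s| <= p + `|q|.
    apply: le_trans (ler_normD _ _) _; rewrite !normrM normrN (ger0_norm (ltW p0)).
    by apply: lerD; rewrite ler_piMr// ltW.
  have ninv : `|n^-1| = n^-1 by rewrite ger0_norm// invr_ge0 ltW.
  rewrite 2!normrM ninv (ger0_norm u0) mulrC ler_wpM2r// ler_wpM2r// invr_ge0 ltW//.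
have h3 : `|((p ^+ 2 - q ^+ 2) * c - 2 * p * q * s) / n ^+ 2| <= (p ^+ 2 + q ^+ 2 + 2 * p * `|q|) / n ^+ 2.
  rewrite normrM (ger0_norm (_ : 0 <= (n ^+ 2)^-1)) ?invr_ge0 ?exprn_ge0 ?(ltW n_gt0)//.
  rewrite ler_wpM2r ?invr_ge0 ?exprn_ge0 ?(ltW n_gt0)//; apply: le_trans (ler_normB _ _) _.
  rewrite !normrM (ger0_norm (ltW p0)) (@ger0_norm _ 2)//; apply: lerD; last first.
    by rewrite ler_piMr// mulr_ge0// mulr_ge0// ltW.
  apply: (@le_trans _ _ `|p ^+ 2 - q ^+ 2|); first by rewrite ler_piMr.
  by apply: le_trans (ler_normB _ _) _; rewrite !ger0_norm ?sqr_ge0.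
have := ler_normB (u * ((- p * c + q * s) / n)) (((p ^+ 2 - q ^+ 2) * c - 2 * p * q * s) / n ^+ 2).
lra.
Qed.

(* The summand [1] keeps the integrand nonnegative. *)
Lemma integral_norm_expR_cos1 :
  (\int[leb]_u (`|u| * expR (- (p * `|u|)) * (1 + cos (q * u)))%:E
   = (2 * (1 / p ^+ 2 + (p ^+ 2 - q ^+ 2) / n ^+ 2))%:E)%E.
Proof.
have cos1 u : 0 <= 1 + cos (q * u) by have := cos_geN1 (q * u); lra.
have cf (g : R -> R) : continuous g -> continuous (fun u => g u * expR (- (p * g u)) * (1 + cos (q * u))).
  move=> cg u.
  apply: (@cvgM _ _ (nbhs u) _ (fun u => g u * expR (- (p * g u))) (fun u => 1 + cos (q * u))).
    apply: cvgM; first exact: cg.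
    apply: continuous_comp; last exact: continuous_expR.
    by apply: cvgN; apply: cvgM; [exact: cvg_cst|exact: cg].
  apply: cvgD; first exact: cvg_cst.
  apply: (@continuous_comp _ _ _ (fun u => q * u) cos); last exact: continuous_cos.
  by apply: cvgM; [exact: cvg_cst|exact: cvg_id].
rewrite (@ge0_symfun_integralT R (fun u => `|u| * expR (- (p * `|u|)) * (1 + cos (q * u)))).
- rewrite EFinM; congr (_ * _)%E.
  rewrite (_ : [set x | 0 <= x] = `[0, +oo[%classic); last first.
    by apply/seteqP; split => x /=; rewrite in_itv/= andbT.
  transitivity (\int[leb]_(u in `[0%R, +oo[) (u * expR (- (p * u)) * (1 + cos (q * u)))%:E)%E.
    by apply: eq_integral => u; rewrite inE/= in_itv/= andbT => u0; rewrite ger0_norm.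
  have nn (u : R) : 0 <= u -> 0 <= u * expR (- (p * u)) * (1 + cos (q * u)).
    by move=> u0; rewrite !mulr_ge0 ?expR_ge0.
  rewrite (ge0_FTC_half nn (cf id (fun u => cvg_id)) dF cvgF).
  by rewrite F0 sub0r opprK.
- by move=> u; rewrite !mulr_ge0 ?expR_ge0.
- by apply: cf => u; exact: norm_continuous.
- by move=> u /=; rewrite normrN mulrN cosN.
Qed.

End Laplace.

Section Laplace2.
Variables (p : R).
Hypothesis p0 : 0 < p.
Let mA (q : R) : measurable_fun [set: R] (fun u : R => `|u| * expR (- (p * `|u|)) * (1 + cos (q * u))).
Proof.
apply: measurable_funM.
  apply: measurable_funM; first exact: normr_measurable.
  apply: (measurableT_comp (@measurable_expR R)); apply: measurable_funN.
  by apply: measurable_funM; [exact: measurable_cst|exact: normr_measurable].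
apply: measurable_funD; first exact: measurable_cst.
apply: (measurableT_comp (continuous_measurable_fun (@continuous_cos R))).
exact: mulrl_measurable.
Qed.

Lemma integral_norm_expR : (\int[leb]_u (`|u| * expR (- (p * `|u|)))%:E = (2 / p ^+ 2)%:E)%E.
Proof.
have h := integral_norm_expR_cos1 0 p0.
have m : measurable_fun [set: R] (fun u : R => `|u| * expR (- (p * `|u|)))
  by apply: measurable_funM; [exact: normr_measurable|apply: (measurableT_comp (@measurable_expR R));
   apply: measurable_funN; apply: measurable_funM; [exact: measurable_cst|exact: normr_measurable]].
move: h; under eq_integral do rewrite mul0r cos0 mulrC EFinM.
have mE : measurable_fun [set: R] (EFin \o (fun u : R => `|u| * expR (- (p * `|u|)))) by exact/measurable_EFinP.
have -> : (\int[leb]_u ((1 + 1)%:E * (`|u| * expR (- (p * `|u|)))%:E)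
    = (1 + 1)%:E * \int[leb]_u (`|u| * expR (- (p * `|u|)))%:E)%E.
  by apply: ge0_integralZl => // u _; rewrite lee_fin mulr_ge0 ?expR_ge0.
move=> /(congr1 (fun z => (2^-1)%:E * z)%E); rewrite muleA -!EFinM.
rewrite (_ : 2^-1 * (1 + 1) = 1) ?mul1e; last by field.
by move=> ->; congr EFin; field; rewrite gt_eqF.
Qed.

Lemma integrable_norm_expR : leb.-integrable setT (EFin \o (fun u => `|u| * expR (- (p * `|u|)))).
Proof.
apply: (ge0_integrable _ _ integral_norm_expR).
  by apply: measurable_funM; [exact: normr_measurable|apply: (measurableT_comp (@measurable_expR R));
   apply: measurable_funN; apply: measurable_funM; [exact: measurable_cst|exact: normr_measurable]].
by move=> u; rewrite mulr_ge0 ?expR_ge0.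
Qed.

Lemma integral_norm_expR_cos (q : R) :
  (\int[leb]_u (`|u| * expR (- (p * `|u|)) * cos (q * u))%:E
   = (2 * (p ^+ 2 - q ^+ 2) / (p ^+ 2 + q ^+ 2) ^+ 2)%:E)%E.
Proof.
have h := integral_norm_expR_cos1 q p0.
have i1 : leb.-integrable setT (EFin \o (fun u : R => `|u| * expR (- (p * `|u|)) * (1 + cos (q * u)))).
  apply: (ge0_integrable _ _ h); first exact: mA.
  by move=> u; have := cos_geN1 (q * u) => ?; rewrite !mulr_ge0 ?expR_ge0//; lra.
transitivity (\int[leb]_u (`|u| * expR (- (p * `|u|)) * (1 + cos (q * u)) - `|u| * expR (- (p * `|u|)))%:E)%E.
  by apply: eq_integral => u _; congr EFin; ring.
rewrite (integralB_EFin measurableT i1 integrable_norm_expR) h integral_norm_expR.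
rewrite -EFinB; congr EFin.
have nn : p ^+ 2 + q ^+ 2 != 0 by rewrite gt_eqF// ltr_pwDl ?exprn_gt0// sqr_ge0.
by field; rewrite nn gt_eqF.
Qed.

(** The integrand is odd: reflection shows that the integral, which is finite, equals its
    opposite. *)
Lemma integral_norm_expR_sin (q : R) :
  (\int[leb]_u (`|u| * expR (- (p * `|u|)) * sin (q * u))%:E = 0)%E.
Proof.
pose f (u : R) := `|u| * expR (- (p * `|u|)) * sin (q * u).
have mf : measurable_fun [set: R] f.
  apply: measurable_funM.
    by apply: measurable_funM; [exact: normr_measurable|apply: (measurableT_comp (@measurable_expR R));
      apply: measurable_funN; apply: measurable_funM; [exact: measurable_cst|exact: normr_measurable]].
  apply: (measurableT_comp (continuous_measurable_fun (@continuous_sin R))).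
  exact: mulrl_measurable.
have fi : leb.-integrable setT (EFin \o f).
  apply: (le_integrable measurableT _ _ integrable_norm_expR); first exact/measurable_EFinP.
  move=> u _; rewrite /= lee_fin /f normrM ler_piMr// ler_norml.
  by rewrite sin_geN1 sin_le1.
have e1 : (\int[leb]_u (f u)%:E = \int[leb]_u (- (f u)%:E))%E.
  rewrite (@integral_scale _ (-1) (EFin \o f)) ?oppr_eq0 ?oner_eq0//; last exact/measurable_EFinP.
  apply: eq_integral => u _; rewrite /= normrN1 mul1e; congr EFin.
  by rewrite /f !mulN1r normrN mulrN sinN mulrN.
have ff := integrable_fin_num measurableT fi.
move: e1; rewrite integralN; last exact: integrable_add_def.
rewrite -(fineK ff) -EFinN => -[] /eqP; rewrite -addr_eq0 -mulr2n mulrn_eq0/= => /eqP.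
by move=> h0; transitivity ((fine (\int[leb]_u (f u)%:E))%:E)%E; [rewrite (fineK ff)|rewrite h0].
Qed.

End Laplace2.

Section Slope.
Variables (al x1 x2 : R).
Hypothesis al0 : 0 < al.
Let a := al ^+ 2 + x2 ^+ 2.
Let b := x1 * x2.
Let r2 := al ^+ 2 + x1 ^+ 2 + x2 ^+ 2.
(** Completes the square: [a * D t = (a * t + b) ^+ 2 + sg ^+ 2]. *)
Let sg := al * Num.sqrt r2.
(** With [p ^+ 2 = al ^+ 2 * (1 + t ^+ 2)] and [q = x1 + x2 * t], the parameters of the Laplace
    integral along slope [t], these are [p ^+ 2 + q ^+ 2] and, for [N], [p ^+ 2 - q ^+ 2]. *)
Let D t := al ^+ 2 * (1 + t ^+ 2) + (x1 + x2 * t) ^+ 2.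
Let N t := al ^+ 2 * (1 + t ^+ 2) - (x1 + x2 * t) ^+ 2.
Let r2_gt0 : 0 < r2.
Proof. by rewrite /r2 -addrA ltr_pwDl ?exprn_gt0// addr_ge0 ?sqr_ge0. Qed.
Let sg2 : sg ^+ 2 = al ^+ 2 * r2.
Proof. by rewrite /sg exprMn sqr_sqrtr// ltW. Qed.
Let sg0 : 0 < sg. Proof. by rewrite mulr_gt0// sqrtr_gt0. Qed.
Let a0 : 0 < a. Proof. by rewrite ltr_pwDl ?exprn_gt0// sqr_ge0. Qed.
Let D0 t : 0 < D t.
Proof. by rewrite ltr_pwDl ?sqr_ge0// mulr_gt0 ?exprn_gt0// ltr_pwDl ?sqr_ge0. Qed.
Let num_ge0 t : 0 <= 4 * (al ^+ 2 * (1 + t ^+ 2)).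
Proof. by rewrite mulr_ge0// mulr_ge0 ?sqr_ge0// addr_ge0// sqr_ge0. Qed.
(** [ka * pi] is the value aimed at; [m1] and [m0] are the partial-fraction coefficients, in the
    variable [tau t], of the rational part of the antiderivative used in [integral_slope_num]. *)
Let ka := 2 * al ^+ 4 / sg ^+ 3.
Let m1 := 2 * al ^+ 2 * (a ^+ 2 + b ^+ 2 - al ^+ 2 * x1 ^+ 2) / (a * sg ^+ 3) - ka.
Let m0 := 4 * al ^+ 2 * b / (a * sg ^+ 2).

(* [tau] is the affine substitution turning [D t] into a multiple of [1 + tau t ^+ 2]. *)
Let H k c1 c0 (y : R) := k * atan y + (c1 * y + c0) / (1 + y ^+ 2).
Let tau (t : R) := (a * t + b) / sg.

Let dH k c1 c0 (y : R) : is_derive y (1 : R) (H k c1 c0)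
  ((k * (1 + y ^+ 2) + c1 * (1 - y ^+ 2) - 2 * c0 * y) / (1 + y ^+ 2) ^+ 2).
Proof.
have y0 : 1 + y ^+ 2 != 0 by rewrite gt_eqF// ltr_pwDl// sqr_ge0.
rewrite /H; apply: is_derive_eq; rewrite /GRing.scale/=.
by field.
Qed.

Let dtau (t : R) : is_derive t (1 : R) tau (a / sg).
Proof. by rewrite /tau; apply: is_derive_eq; rewrite /GRing.scale/=; ring. Qed.

Let tau_y : tau t @[t --> +oo] --> +oo.
Proof.
apply/cvgryPge => A; near=> t.
have h : (A * sg - b) / a < t by near: t; apply: nbhs_pinfty_gt; rewrite num_real.
rewrite /tau ler_pdivlMr// -lerBlDr (mulrC a) -ler_pdivrMr//.
Unshelve. all: end_near. Qed.

Let tau_Ny : tau t @[t --> -oo] --> -oo.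
Proof.
apply/cvgrNyPle => A; near=> t.
have h : t < (A * sg - b) / a by near: t; apply: nbhs_ninfty_lt; rewrite num_real.
rewrite /tau ler_pdivrMr// -lerBrDr (mulrC a) -ler_pdivlMr//.
Unshelve. all: end_near. Qed.

(** The chain rule makes [H k c1 c0 \o tau] an antiderivative of [f], so each slope integral reduces
    to a polynomial identity and only [k] reaches the result. *)
Let intH (f : R -> R) k c1 c0 : (forall t, 0 <= f t) -> continuous f ->
  (forall t, (k * (1 + tau t ^+ 2) + c1 * (1 - tau t ^+ 2) - 2 * c0 * tau t)
     / (1 + tau t ^+ 2) ^+ 2 * (a / sg) = f t) ->
  (\int[leb]_t (f t)%:E = (k * pi)%:E)%E.
Proof.
move=> f0 cf fE.
have [h1 h2] := cvg_atan_rat k c1 c0.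
have dHt (t : R) : is_derive t (1 : R) (H k c1 c0 \o tau) (f t).
  by rewrite -fE; exact: is_derive1_comp.
rewrite (@ge0_FTC_line _ f (H k c1 c0 \o tau) (k * - (pi / 2)) (k * (pi / 2)))//.
- by congr EFin; field.
- by apply: cvg_comp tau_y _; exact: h1.
- by apply: cvg_comp tau_Ny _; exact: h2.
Qed.

Let cDr (g : R -> R) n : continuous g -> continuous (fun t => g t / D t ^+ n).
Proof.
have cD : continuous D.
  move=> t; rewrite /D; apply: cvgD.
    apply: cvgM; first exact: cvg_cst.
    by apply: cvgD; [exact: cvg_cst|exact: exprn_continuous].
  apply: (@continuous_comp _ _ _ (fun t => x1 + x2 * t) (fun y => y ^+ 2)); last exact: exprn_continuous.
  by apply: cvgD; [exact: cvg_cst|apply: cvgM; [exact: cvg_cst|exact: cvg_id]].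
move=> cg t; apply: cvgM; first exact: cg.
apply: cvgV; first by rewrite expf_neq0// gt_eqF.
by apply: (@continuous_comp _ _ _ D (fun y => y ^+ n)); [exact: cD|exact: exprn_continuous].
Qed.

Lemma integral_slope_den : (\int[leb]_t (2 / D t ^+ 1)%:E = (2 / sg * pi)%:E)%E.
Proof.
apply: (@intH _ _ 0 0).
- by move=> t; rewrite divr_ge0// exprn_ge0// ltW.
- by apply: (cDr (g := fun=> 2)) => t; exact: cvg_cst.
move=> t; have := D0 t; rewrite /tau /D /a /b => D0t.
have sn0 : sg != 0 by rewrite gt_eqF.
have an0 : al ^+ 2 + x2 ^+ 2 != 0 by have := a0; rewrite /a => /gt_eqF ->.
have E : 1 + (((al ^+ 2 + x2 ^+ 2) * t + x1 * x2) / sg) ^+ 2 =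
  (al ^+ 2 + x2 ^+ 2) * (al ^+ 2 * (1 + t ^+ 2) + (x1 + x2 * t) ^+ 2) / sg ^+ 2.
  by have := sg2; rewrite /r2 => s2; field: s2.
rewrite E; field.
by rewrite sn0 an0 gt_eqF.
Qed.

(** The integrand wanted, [2 * N t / D t ^+ 2], changes sign. It is the difference of this one and
    [2 / D t], both nonnegative and thus within reach of the fundamental theorem used here. *)
Lemma integral_slope_num : (\int[leb]_t (4 * (al ^+ 2 * (1 + t ^+ 2)) / D t ^+ 2)%:E
  = ((ka + 2 / sg) * pi)%:E)%E.
Proof.
apply: (@intH _ _ m1 m0).
- by move=> t; rewrite divr_ge0 ?exprn_ge0 ?(ltW (D0 t))// num_ge0.
- apply: (cDr (g := fun t => 4 * (al ^+ 2 * (1 + t ^+ 2)))) => t.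
  apply: cvgM; first exact: cvg_cst.
  apply: cvgM; first exact: cvg_cst.
  by apply: cvgD; [exact: cvg_cst|exact: exprn_continuous].
move=> t; have := D0 t; rewrite /tau /D /m1 /m0 /ka /a /b => D0t.
have sn0 : sg != 0 by rewrite gt_eqF.
have an0 : al ^+ 2 + x2 ^+ 2 != 0 by have := a0; rewrite /a => /gt_eqF ->.
have E : 1 + (((al ^+ 2 + x2 ^+ 2) * t + x1 * x2) / sg) ^+ 2 =
  (al ^+ 2 + x2 ^+ 2) * (al ^+ 2 * (1 + t ^+ 2) + (x1 + x2 * t) ^+ 2) / sg ^+ 2.
  by have := sg2; rewrite /r2 => s2; field: s2.
rewrite E.
have := sg2; rewrite /r2 => s2; field: s2.
by rewrite sn0 an0 gt_eqF.
Qed.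

Lemma integral_slope : (\int[leb]_t (2 * N t / D t ^+ 2)%:E = (ka * pi)%:E)%E.
Proof.
have md n (g : R -> R) : continuous g -> measurable_fun [set: R] (fun t => g t / D t ^+ n).
  by move=> cg; apply: continuous_measurable_fun; exact: cDr.
have i1 : leb.-integrable setT (EFin \o (fun t => 2 / D t ^+ 1)).
  apply: (ge0_integrable _ _ integral_slope_den); first by apply: (md 1%N (fun=> 2)) => t; exact: cvg_cst.
  by move=> t; rewrite divr_ge0// exprn_ge0// ltW.
have i2 : leb.-integrable setT (EFin \o (fun t => 4 * (al ^+ 2 * (1 + t ^+ 2)) / D t ^+ 2)).
  apply: (ge0_integrable _ _ integral_slope_num).
    apply: (md 2%N (fun t => 4 * (al ^+ 2 * (1 + t ^+ 2)))) => t.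
    apply: cvgM; first exact: cvg_cst.
    apply: cvgM; first exact: cvg_cst.
    by apply: cvgD; [exact: cvg_cst|exact: exprn_continuous].
  by move=> t; rewrite divr_ge0 ?exprn_ge0 ?(ltW (D0 t))// num_ge0.
transitivity (\int[leb]_t (4 * (al ^+ 2 * (1 + t ^+ 2)) / D t ^+ 2 - 2 / D t ^+ 1)%:E)%E.
  apply: eq_integral => t _; congr EFin; have := D0 t; rewrite /N /D => Dt.
  by field; rewrite gt_eqF.
rewrite (integralB_EFin measurableT i2 i1) integral_slope_num integral_slope_den -EFinB.
by congr EFin; ring.
Qed.

End Slope.
End OneDim.

(** * Plane integrals in the coordinates abscissa and slope *)

Section SlopeCoordinates.
Context {R : realType}.
Local Notation leb := (@lebesgue_measure R).
Local Notation mu2 := (@mu2 R).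
Local Open Scope ereal_scope.

Let jac (H : R * R -> \bar R) (z : R * R) : \bar R := `|z.1|%:E * H (z.1, z.1 * z.2)%R.

Let measurable_jac (H : R * R -> \bar R) : measurable_fun [set: R * R] H ->
  measurable_fun [set: R * R] (jac H).
Proof.
move=> mH; apply: emeasurable_funM.
  apply/measurable_EFinP; apply: (measurableT_comp (@normr_measurable R setT)).
  exact: measurable_fst.
apply: (measurableT_comp mH); apply: measurable_fun_pair; first exact: measurable_fst.
by apply: measurable_funM; [exact: measurable_fst|exact: measurable_snd].
Qed.

Let ae_eq_neq0 (f g : R -> \bar R) : (forall u, u != 0%R -> f u = g u) -> ae_eq leb setT f g.
Proof.
move=> fg; exists [set 0%R]; split => //; first exact: lebesgue_measure_set1.
move=> u /= h; apply: contrapT => /eqP u0; apply: h => _; exact: fg.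
Qed.

(** For fixed [u != 0] the inner integral is rescaled by [u]; the exceptional line [u = 0] is
    null. *)
Let ge0_jac (H : R * R -> \bar R) : measurable_fun [set: R * R] H -> (forall z, 0 <= H z) ->
  \int[leb]_u \int[leb]_t jac H (u, t) = \int[mu2]_z H z.
Proof.
move=> mH H0; rewrite (ge0_integral_mu2 mH H0).
have j0 z : 0 <= jac H z by rewrite mule_ge0 ?lee_fin.
have mF (K : R * R -> \bar R) : measurable_fun [set: R * R] K -> (forall z, 0 <= K z) ->
    measurable_fun [set: R] (fun u => \int[leb]_t K (u, t)).
  by move=> mK K0; exact: (@measurable_fun_fubini_tonelli_F _ _ _ _ _ leb K mK K0).
apply: ge0_ae_eq_integral.
- exact: measurableT.
- exact: (mF _ (measurable_jac mH) j0).
- exact: (mF _ mH H0).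
- by move=> u _; apply: integral_ge0.
- by move=> u _; apply: integral_ge0.
apply: ae_eq_neq0 => u u0.
rewrite [RHS](ge0_integral_scale u0 (measurable_fun_pair2 u mH))//.
transitivity (\int[leb]_t (`|u|%:E * H (u, u * t)%R)); first by [].
apply: ge0_integralZl => //.
by apply: (measurableT_comp (measurable_fun_pair2 u mH)); exact: mulrl_measurable.
Qed.

(* The coordinates are the abscissa [u] and the slope [t = z.2 / z.1]: they replace polar coordinates. *)
Lemma ge0_integral_slope_coord (H : R * R -> \bar R) : measurable_fun [set: R * R] H ->
  (forall z, 0 <= H z) ->
  \int[mu2]_z H z = \int[leb]_t \int[leb]_u (`|u|%:E * H (u, u * t)%R).
Proof.
move=> mH H0; rewrite -(ge0_jac mH H0).
apply: (@fubini_tonelli _ _ _ _ _ leb leb (jac H) (measurable_jac mH)).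
by move=> z; rewrite mule_ge0 ?lee_fin.
Qed.

(** The nonnegative case applied to the absolute value of [H] gives integrability of [jac H]; Fubini
    then exchanges the order for the signed integrand. *)
Lemma integral_slope_coord (H : R * R -> \bar R) : mu2.-integrable setT H ->
  \int[mu2]_z H z = \int[leb]_t \int[leb]_u (`|u|%:E * H (u, u * t)%R).
Proof.
move=> iH.
have mH : measurable_fun [set: R * R] H by exact: measurable_int iH.
have iJ : (leb \x leb).-integrable setT (jac H).
  apply/(@integrable12ltyP _ _ _ _ _ leb leb (jac H) (measurable_jac mH)).
  have mA : measurable_fun [set: R * R] (abse \o H) by exact: measurableT_comp.
  have -> : \int[leb]_u \int[leb]_t `|jac H (u, t)| = \int[leb]_u \int[leb]_t jac (abse \o H) (u, t).
    apply: eq_integral => u _; apply: eq_integral => t _.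
    by rewrite /jac abseM /= normr_id.
  by rewrite (ge0_jac mA (fun z => abse_ge0 _)); case/integrableP : iH.
transitivity (\int[leb]_u \int[leb]_t H (u, t)).
  by rewrite -(@integral12_prod_meas1 _ _ _ _ _ leb leb H iH).
transitivity (\int[leb]_u \int[leb]_t jac H (u, t)); last exact: (@Fubini _ _ _ _ _ leb leb (jac H) iJ).
apply: ae_eq_integral.
- exact: measurableT.
- exact: (@measurable_fubini_F _ _ _ _ _ leb leb H iH).
- exact: (@measurable_fubini_F _ _ _ _ _ leb leb (jac H) iJ).
apply: ae_eq_neq0 => u u0.
exact: (integral_scale u0 (measurable_fun_pair2 u mH)).
Qed.

End SlopeCoordinates.

(** * The Poisson kernel as Fourier transform of the exponential weight *)

Section PoissonFourier.
Context {R : realType}.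
Local Notation leb := (@lebesgue_measure R).
Local Notation mu2 := (@mu2 R).

Definition ew (al : R) (xi : R * R) : R := expR (- (al * norm2 xi)).

Lemma measurable_norm2 : measurable_fun [set: R * R] (@norm2 R).
Proof.
apply: (measurableT_comp (continuous_measurable_fun (@sqrt_continuous R))).
by apply: measurable_funD; apply: measurable_funX; [exact: measurable_fst|exact: measurable_snd].
Qed.

Lemma measurable_ew al : measurable_fun [set: R * R] (ew al).
Proof.
apply: (measurableT_comp (@measurable_expR R)); apply: measurable_funN.
by apply: measurable_funM; [exact: measurable_cst|exact: measurable_norm2].
Qed.

Lemma measurable_dot2 (x : R * R) : measurable_fun [set: R * R] (fun xi => dot2 xi x).
Proof.
by apply: measurable_funD; apply: measurable_funM; [exact: measurable_fst|exact: measurable_cst|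
  exact: measurable_snd|exact: measurable_cst].
Qed.

Lemma measurable_cos_dot2 (x : R * R) : measurable_fun [set: R * R] (fun xi => cos (dot2 xi x)).
Proof.
by apply: (measurableT_comp (continuous_measurable_fun (@continuous_cos R))); exact: measurable_dot2.
Qed.

Lemma measurable_sin_dot2 (x : R * R) : measurable_fun [set: R * R] (fun xi => sin (dot2 xi x)).
Proof.
by apply: (measurableT_comp (continuous_measurable_fun (@continuous_sin R))); exact: measurable_dot2.
Qed.

Lemma norm2_ge0 (x : R * R) : 0 <= norm2 x. Proof. exact: sqrtr_ge0. Qed.

Lemma sqr_norm2 (x : R * R) : norm2 x ^+ 2 = x.1 ^+ 2 + x.2 ^+ 2.
Proof. by rewrite sqr_sqrtr// addr_ge0 ?sqr_ge0. Qed.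

Lemma ew_ge0 al xi : 0 <= ew al xi. Proof. exact: expR_ge0. Qed.
Lemma ew_le1 al xi : 0 <= al -> ew al xi <= 1.
Proof. by move=> al0; rewrite -expR0 ler_expR oppr_le0 mulr_ge0// norm2_ge0. Qed.

Let ew_slope al (u t : R) : ew al (u, u * t) = expR (- (al * Num.sqrt (1 + t ^+ 2) * `|u|)).
Proof.
rewrite /ew /norm2/=; congr (expR (- _)); rewrite -mulrA; congr (_ * _).
by rewrite -sqrtr_sqr -sqrtrM ?addr_ge0 ?sqr_ge0//; congr (Num.sqrt _); ring.
Qed.

Let p_gt0 (al t : R) : 0 < al -> 0 < al * Num.sqrt (1 + t ^+ 2).
Proof. by move=> al0; rewrite mulr_gt0// sqrtr_gt0 ltr_pwDl// sqr_ge0. Qed.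

Let p_sqr (al t : R) : (al * Num.sqrt (1 + t ^+ 2)) ^+ 2 = al ^+ 2 * (1 + t ^+ 2).
Proof. by rewrite exprMn sqr_sqrtr// addr_ge0// sqr_ge0. Qed.

Lemma integrable_ew al : 0 < al -> mu2.-integrable setT (EFin \o ew al).
Proof.
move=> al0.
(* The value [2 * pi / al ^+ 2], left in the form that [integral_slope_den] takes at
   [x1 = x2 = 0]. *)
apply: (@ge0_integrable _ _ _ mu2 _ (2 / (al * Num.sqrt (al ^+ 2 + 0 ^+ 2 + 0 ^+ 2)) * pi)).
- exact: measurable_ew.
- exact: ew_ge0.
rewrite ge0_integral_slope_coord; last 2 first.
- by apply/measurable_EFinP; exact: measurable_ew.
- by move=> z; rewrite lee_fin ew_ge0.
rewrite -(integral_slope_den 0 0 al0); apply: eq_integral => t _.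
under eq_integral do rewrite -EFinM ew_slope.
rewrite (integral_norm_expR (p_gt0 t al0)) p_sqr; congr EFin.
by rewrite mul0r addr0 expr0n addr0 expr1.
Qed.

Lemma integrable_ew_bounded al (g : R * R -> R) : 0 < al -> measurable_fun [set: R * R] g ->
  (forall xi, `|g xi| <= 1) -> mu2.-integrable setT (EFin \o (fun xi => ew al xi * g xi)).
Proof.
move=> al0 mg g1; apply: (integrable_dom _ _ (integrable_ew al0)).
  by apply: measurable_funM => //; exact: measurable_ew.
by move=> xi; rewrite normrM ger0_norm ?ew_ge0// ler_piMr// ew_ge0.
Qed.

Lemma norm_cos_le1 (x : R) : `|cos x| <= 1. Proof. by rewrite ler_norml cos_geN1 cos_le1. Qed.
Lemma norm_sin_le1 (x : R) : `|sin x| <= 1. Proof. by rewrite ler_norml sin_geN1 sin_le1. Qed.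

Lemma poissonE al (x : R * R) : 0 < al ->
  poisson al x = (2 * pi)^-1 * al / Num.sqrt (al ^+ 2 + norm2 x ^+ 2) ^+ 3.
Proof.
move=> al0; rewrite /poisson; congr (_ * _).
have y0 : 0 < al ^+ 2 + norm2 x ^+ 2 by rewrite ltr_pwDl ?exprn_gt0// sqr_ge0.
rewrite powRN; congr (_^-1).
rewrite -powR12_sqrt ?(ltW y0)// -(powR_mulrn 3 (powR_ge0 _ _)) -powRrM; congr (powR _ _).
by rewrite mulrC.
Qed.

(** On the line of slope [t] the weight is [expR (- (p * |u|))] with [p = al * sqrt (1 + t ^+ 2)],
    and the phase is [(x.1 + x.2 * t) * u]. The integral in [u] is thus the Laplace integral, and
    the one in [t] is [integral_slope]. *)
Lemma integral_ew_cos al x : 0 < al ->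
  Rintegral mu2 setT (fun xi => ew al xi * cos (dot2 xi x)) = (2 * pi) ^+ 2 * poisson al x.
Proof.
move=> al0; have ic := integrable_ew_bounded al0 (measurable_cos_dot2 x) (fun xi => norm_cos_le1 _).
rewrite /Rintegral (integral_slope_coord ic) poissonE//.
transitivity (fine ((2 * al ^+ 4 / (al * Num.sqrt (al ^+ 2 + x.1 ^+ 2 + x.2 ^+ 2)) ^+ 3 * pi)%:E)).
  congr fine; rewrite -integral_slope//; apply: eq_integral => t _.
  rewrite (_ : 2 * _ / _ ^+ 2 = 2 * ((al * Num.sqrt (1 + t ^+ 2)) ^+ 2 - (x.1 + x.2 * t) ^+ 2) /
     ((al * Num.sqrt (1 + t ^+ 2)) ^+ 2 + (x.1 + x.2 * t) ^+ 2) ^+ 2); last by rewrite p_sqr.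
  rewrite -integral_norm_expR_cos ?p_gt0//; apply: eq_integral => u _.
  rewrite -EFinM; congr EFin; rewrite /= ew_slope mulrA; congr (_ * cos _).
  by rewrite /dot2/=; ring.
rewrite /= sqr_norm2 addrA.
have s0 : Num.sqrt (al ^+ 2 + x.1 ^+ 2 + x.2 ^+ 2) != 0.
  by rewrite gt_eqF// sqrtr_gt0 -addrA ltr_pwDl ?exprn_gt0// addr_ge0 ?sqr_ge0.
have pi0 : pi != 0 :> R by rewrite gt_eqF// pi_gt0.
have al1 : al != 0 by rewrite gt_eqF.
move: s0 pi0 al1; move: (Num.sqrt _) (pi : R) => s P s0 P0 al1.
field; by rewrite ?al1 ?s0 ?P0.
Qed.

Lemma integral_ew_sin al x : 0 < al ->
  Rintegral mu2 setT (fun xi => ew al xi * sin (dot2 xi x)) = 0.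
Proof.
move=> al0; have ic := integrable_ew_bounded al0 (measurable_sin_dot2 x) (fun xi => norm_sin_le1 _).
rewrite /Rintegral (integral_slope_coord ic).
rewrite (eq_integral (cst 0%E)); first by rewrite integral0.
move=> t _; rewrite -(integral_norm_expR_sin (p_gt0 t al0) (x.1 + x.2 * t)).
apply: eq_integral => u _.
rewrite -EFinM; congr EFin; rewrite /= ew_slope mulrA; congr (_ * sin _).
by rewrite /dot2/=; ring.
Qed.

End PoissonFourier.

(** * The Poisson kernel as an approximate identity *)

Section PoissonKernel.
Context {R : realType}.
Local Notation leb := (@lebesgue_measure R).
Local Notation mu2 := (@mu2 R).

Lemma poisson_ge0 (ep : R) z : 0 < ep -> 0 <= poisson ep z.
Proof.
move=> e0; rewrite poissonE// divr_ge0 ?exprn_ge0 ?sqrtr_ge0// mulr_ge0 ?(ltW e0)//.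
by rewrite invr_ge0 mulr_ge0// pi_ge0.
Qed.

Lemma measurable_poisson (ep : R) : 0 < ep -> measurable_fun [set: R * R] (poisson ep).
Proof.
move=> e0; apply: measurable_funM; first exact: measurable_cst.
apply: (measurableT_comp (measurable_powR (- (3 / 2)))).
apply: measurable_funD; first exact: measurable_cst.
by apply: measurable_funX; exact: measurable_norm2.
Qed.

Section RadialIntegral.
Variables (ep c : R).
Hypotheses (ep0 : 0 < ep) (c0 : 0 < c).
Let s (u : R) := Num.sqrt (ep ^+ 2 + c * u ^+ 2).
Let in_gt0 u : 0 < ep ^+ 2 + c * u ^+ 2.
Proof. by rewrite ltr_pwDl ?exprn_gt0// mulr_ge0 ?(ltW c0)// sqr_ge0. Qed.
Let s_gt0 u : 0 < s u. Proof. by rewrite sqrtr_gt0. Qed.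

Let ds (u : R) : is_derive u (1 : R) s (c * u / s u).
Proof.
have h1 := is_derive1_sqrt (in_gt0 u).
have h2 : is_derive u (1 : R) (fun u : R => ep ^+ 2 + c * u ^+ 2) (2 * c * u).
  by apply: is_derive_eq; rewrite /GRing.scale/=; ring.
have h := @is_derive1_comp _ _ (fun u : R => ep ^+ 2 + c * u ^+ 2) u _ _ h1 h2.
rewrite (_ : c * u / s u = (2 * Num.sqrt (ep ^+ 2 + c * u ^+ 2))^-1 * (2 * c * u)) ; first exact: h.
by rewrite /s; field; rewrite gt_eqF// sqrtr_gt0.
Qed.

Let dF (u : R) : is_derive u (1 : R) (fun u => - (c * s u)^-1) (u / s u ^+ 3).
Proof.
have sn : s u != 0 by rewrite gt_eqF.
have cn : c != 0 by rewrite gt_eqF.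
have csn : c * s u != 0 by rewrite mulf_neq0.
have h1 : is_derive u (1 : R) (fun u => c * s u) (c * (c * u / s u)).
  exact: (is_deriveZ c (ds u)).
have h2 := @is_deriveV R (fun u => c * s u) u _ _ csn h1.
have h3 := is_deriveN h2.
rewrite (_ : u / s u ^+ 3 = - (- (c * s u) ^- 2 *: (c * (c * u / s u)))); first exact: h3.
by rewrite /GRing.scale/=; field; rewrite sn cn.
Qed.

Let cvF : (fun u => - (c * s u)^-1) u @[u --> +oo] --> (0 : R).
Proof.
rewrite -oppr0; apply: cvgN; apply/cvgrPdist_lt => e e0; near=> u.
have u1 : 1 < u by near: u; apply: nbhs_pinfty_gt; rewrite num_real.
have ue : (e * c * Num.sqrt c)^-1 < u by near: u; apply: nbhs_pinfty_gt; rewrite num_real.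
have u0 : 0 < u by exact: lt_trans u1.
have sc0 : 0 < Num.sqrt c by rewrite sqrtr_gt0.
have su : Num.sqrt c * u <= s u.
  rewrite -[X in _ * X](gtr0_norm u0) -sqrtr_sqr -sqrtrM ?(ltW c0)//.
  by rewrite /s ler_sqrt ?(ltW (in_gt0 u))// lerDr sqr_ge0.
rewrite sub0r normrN ger0_norm ?invr_ge0 ?mulr_ge0 ?(ltW c0) ?(ltW (s_gt0 u))//.
rewrite invf_plt ?posrE ?mulr_gt0//.
move: ue; rewrite -[(e * c * _)^-1]mul1r ltr_pdivrMr ?mulr_gt0// => ue.
rewrite -[e^-1]mul1r ltr_pdivrMr//; apply: lt_le_trans ue _.
by have := ler_wpM2l (ltW (mulr_gt0 e0 c0)) su; lra.
Unshelve. all: end_near. Qed.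

Lemma continuous_radial : continuous (fun u : R => `|u| / s u ^+ 3).
Proof.
have cs : continuous s by exact: (is_derive1_continuous ds).
move=> u; apply: cvgM; first exact: norm_continuous.
apply: cvgV; first by rewrite expf_neq0// gt_eqF.
by apply: (@continuous_comp _ _ _ s (fun y => y ^+ 3)); [exact: cs|exact: exprn_continuous].
Qed.

Lemma integral_radial : (\int[leb]_u (`|u| / s u ^+ 3)%:E = (2 / (c * ep))%:E)%E.
Proof.
have cs : continuous s by exact: (is_derive1_continuous ds).
have cq (g : R -> R) : continuous g -> continuous (fun u => g u / s u ^+ 3).
  move=> cg u; apply: cvgM; first exact: cg.
  apply: cvgV; first by rewrite expf_neq0// gt_eqF.
  by apply: (@continuous_comp _ _ _ s (fun y => y ^+ 3)); [exact: cs|exact: exprn_continuous].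
rewrite (@ge0_symfun_integralT R (fun u => `|u| / s u ^+ 3)).
- rewrite (_ : [set x | 0 <= x] = `[0, +oo[%classic); last first.
    by apply/seteqP; split => x /=; rewrite in_itv/= andbT.
  have nn (u : R) : 0 <= u -> 0 <= u / s u ^+ 3.
    by move=> u0; rewrite divr_ge0// exprn_ge0// ltW.
  have := ge0_FTC_half nn (cq id (fun u => cvg_id)) dF cvF.
  have -> : (\int[leb]_(x in `[0%R, +oo[) (`|x| / s x ^+ 3)%:E = \int[leb]_(x in `[0%R, +oo[) (x / s x ^+ 3)%:E)%E.
    by apply: eq_integral => u; rewrite inE/= in_itv/= andbT => u0; rewrite ger0_norm.
  move=> ->; rewrite -EFinM; congr EFin.
  rewrite /s expr0n mulr0 addr0 sqrtr_sqr (gtr0_norm ep0).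
  by field; rewrite !gt_eqF.
- by move=> u; rewrite divr_ge0// exprn_ge0// ltW.
- exact: continuous_radial.
- by move=> u /=; rewrite normrN /s sqrrN.
Qed.
End RadialIntegral.

(** In slope coordinates the integral in [u] has an elementary antiderivative and leaves a multiple
    of [1 / (1 + t ^+ 2)], independent of [ep]. *)
Lemma integral_poisson (ep : R) : 0 < ep -> (\int[mu2]_z (poisson ep z)%:E = 1)%E.
Proof.
move=> e0.
have mp := measurable_poisson e0.
rewrite ge0_integral_slope_coord; last 2 first.
- exact/measurable_EFinP.
- by move=> z; rewrite lee_fin poisson_ge0.
have pi0 : 0 < pi :> R by exact: pi_gt0.
(* The right-hand side keeps the shape of the integrand of [integral_slope_den] at [al = 1],
   [x1 = x2 = 0]. *)
have inner t : (\int[leb]_u (`|u|%:E * (poisson ep (u, u * t))%:E)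
    = (pi^-1 * (2^-1 * (2 / (1 ^+ 2 * (1 + t ^+ 2) + (0 + 0 * t) ^+ 2) ^+ 1)))%:E)%E.
  have c0 : 0 < 1 + t ^+ 2 by rewrite ltr_pwDl// sqr_ge0.
  transitivity (\int[leb]_u (((2 * pi)^-1 * ep)%:E * (`|u| / Num.sqrt (ep ^+ 2 + (1 + t ^+ 2) * u ^+ 2) ^+ 3)%:E))%E.
    apply: eq_integral => u _; rewrite -!EFinM; congr EFin; rewrite poissonE// sqr_norm2/=.
    rewrite (_ : ep ^+ 2 + (u ^+ 2 + (u * t) ^+ 2) = ep ^+ 2 + (1 + t ^+ 2) * u ^+ 2); last by ring.
    by rewrite mulrCA !mulrA.
  rewrite ge0_integralZl//.
  - rewrite integral_radial// -EFinM; congr EFin.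
    rewrite mul0r addr0 expr0n addr0 expr1 expr1n mul1r.
    move: (1 + t ^+ 2) (pi : R) c0 pi0 => c P c0 P0.
    by field; rewrite !gt_eqF.
  - apply/measurable_EFinP; apply: continuous_measurable_fun.
    exact: (continuous_radial e0 c0).
  - by rewrite lee_fin mulr_ge0 ?invr_ge0 ?mulr_ge0 ?(ltW e0) ?(ltW pi0).
under eq_integral do rewrite inner.
have h := integral_slope_den 0 0 (ltr01 : (0 : R) < 1).
have D0 t : 0 < 1 ^+ 2 * (1 + t ^+ 2) + (0 + 0 * t) ^+ 2 :> R.
  by rewrite mul0r addr0 expr0n addr0 expr1n mul1r ltr_pwDl// sqr_ge0.
transitivity (\int[leb]_t ((pi^-1 * 2^-1)%:E * (2 / (1 ^+ 2 * (1 + t ^+ 2) + (0 + 0 * t) ^+ 2) ^+ 1)%:E))%E.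
  by apply: eq_integral => t _; rewrite -EFinM mulrA.
rewrite ge0_integralZl//.
- rewrite h -EFinM; congr EFin.
  rewrite !expr0n !addr0 expr1n sqrtr1 mul1r.
  by move: (pi : R) pi0 => P P0; field; rewrite gt_eqF.
- apply/measurable_EFinP; apply: continuous_measurable_fun => t.
  apply: cvgM; first exact: cvg_cst.
  apply: cvgV; first by rewrite expr1 gt_eqF.
  rewrite expr1; under eq_fun do rewrite expr1 mul0r addr0 expr0n addr0 expr1n mul1r.
  rewrite mul0r addr0 expr0n addr0 expr1n mul1r.
  by apply: cvgD; [exact: cvg_cst|exact: exprn_continuous].
- by move=> t _; rewrite lee_fin divr_ge0// exprn_ge0// ltW.
- by rewrite lee_fin mulr_ge0 ?invr_ge0 ?(ltW pi0).
Qed.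

Lemma poissonN (ep : R) (x y : R * R) : 0 < ep -> poisson ep (sub2 x y) = poisson ep (sub2 y x).
Proof.
move=> e0; rewrite !poissonE// !sqr_norm2 /sub2/=.
by rewrite -[(x.1 - y.1) ^+ 2]sqrrN -[(x.2 - y.2) ^+ 2]sqrrN !opprB.
Qed.

Let poisson_shift (ep : R) x : 0 < ep ->
  (fun y => poisson ep (sub2 x y)) = (fun y : R * R => poisson ep (y.1 + - x.1, y.2 + - x.2)).
Proof. by move=> e0; apply/funext => y; rewrite poissonN. Qed.

Lemma measurable_poisson_sub2 (ep : R) x : 0 < ep ->
  measurable_fun [set: R * R] (fun y => poisson ep (sub2 x y)).
Proof.
by move=> e0; rewrite poisson_shift//; exact: (measurable_shift2 (- x.1, - x.2) (measurable_poisson e0)).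
Qed.

Lemma integral_poisson_sub2 (ep : R) x : 0 < ep ->
  (\int[mu2]_y (poisson ep (sub2 x y))%:E = 1)%E.
Proof.
move=> e0; rewrite -(integral_poisson e0).
have mE : measurable_fun [set: R * R] (EFin \o poisson ep) by apply/measurable_EFinP; exact: measurable_poisson.
rewrite -(ge0_integral_shift2 (- x.1, - x.2) mE) => [|z]; last by rewrite lee_fin poisson_ge0.
by apply: eq_integral => y _; rewrite poissonN.
Qed.

Lemma integrable_poisson_sub2 (ep : R) x : 0 < ep ->
  mu2.-integrable setT (EFin \o (fun y => poisson ep (sub2 x y))).
Proof.
move=> e0; apply: (@ge0_integrable _ _ _ mu2 _ 1); last exact: integral_poisson_sub2.
- exact: measurable_poisson_sub2.
- by move=> z; exact: poisson_ge0.
Qed.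

Lemma poisson1_le1 (z : R * R) : poisson 1 z <= 1.
Proof.
rewrite poissonE// mulr1.
have h1 : 1 <= Num.sqrt (1 ^+ 2 + norm2 z ^+ 2).
  by rewrite -[leLHS]sqrtr1 ler_sqrt ?addr_ge0 ?sqr_ge0// expr1n lerDl sqr_ge0.
have h2 : (Num.sqrt (1 ^+ 2 + norm2 z ^+ 2) ^+ 3)^-1 <= 1.
  by rewrite invf_le1 ?exprn_gt0 ?(lt_le_trans _ h1)// exprn_ege1.
have h3 : (2 * pi)^-1 <= 1 :> R.
  have := pi_ge2 R => pi2; rewrite invf_le1; lra.
by rewrite mulr_ile1// invr_ge0 ?exprn_ge0 ?mulr_ge0 ?pi_ge0 ?sqrtr_ge0.
Qed.

(** Away from the origin [1 + |z|^2 <= (1 + r^-2) (ep^2 + |z|^2)], so all kernels lie below one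
    fixed integrable kernel, with a factor [ep] that makes the far contribution vanish. *)
Lemma poisson_far (r ep : R) (z : R * R) : 0 < r -> 0 < ep -> ep <= 1 -> r <= norm2 z ->
  poisson ep z <= ep * (Num.sqrt (1 + r ^- 2)) ^+ 3 * poisson 1 z.
Proof.
move=> r0 e0 e1 rz; rewrite !poissonE// mulr1.
have nz : 0 < norm2 z by exact: lt_le_trans rz.
set A := Num.sqrt (ep ^+ 2 + _); set B := Num.sqrt (1 ^+ 2 + _); set K := Num.sqrt (1 + _).
have A0 : 0 < A by rewrite sqrtr_gt0 ltr_pwDl ?exprn_gt0// sqr_ge0.
have B0 : 0 < B by rewrite sqrtr_gt0 ltr_pwDl ?exprn_gt0// sqr_ge0.
have K0 : 0 < K by rewrite sqrtr_gt0 ltr_pwDl// invr_ge0 sqr_ge0.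
have BKA : B <= K * A.
  rewrite -sqrtrM ?addr_ge0 ?invr_ge0 ?sqr_ge0// ler_sqrt; last first.
    by rewrite mulr_ge0 ?addr_ge0 ?invr_ge0 ?sqr_ge0.
  rewrite expr1n mulrDl mul1r.
  have : 1 <= r ^- 2 * (ep ^+ 2 + norm2 z ^+ 2).
    rewrite mulrC ler_pdivlMr ?exprn_gt0// mul1r.
    apply: (@le_trans _ _ (norm2 z ^+ 2)); last by rewrite lerDr sqr_ge0.
    by rewrite ler_pXn2r// nnegrE ltW.
  by have := sqr_ge0 ep; lra.
have pi0 : 0 < pi :> R by exact: pi_gt0.
rewrite [leRHS](_ : _ = (2 * pi)^-1 * ep * (K ^+ 3 / B ^+ 3)); last by ring.
rewrite ler_wpM2l ?mulr_ge0 ?invr_ge0 ?(ltW e0) ?mulr_ge0 ?(ltW pi0)//.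
rewrite ler_pdivlMr ?exprn_gt0// mulrC ler_pdivrMr ?exprn_gt0// -exprMn.
by rewrite ler_pXn2r ?nnegrE ?mulr_ge0 ?(ltW B0) ?(ltW K0) ?(ltW A0).
Qed.

End PoissonKernel.

(** * Poisson averages of truncated functions near a point of continuity *)

Section ApproximateIdentity.
Context {R : realType}.
Local Notation mu2 := (@mu2 R).

Lemma measurable_Bball (r : R) : measurable (Bball r : set (R * R)).
Proof.
have -> : Bball r = (@norm2 R) @^-1` `]-oo, r] :> set (R * R).
  by apply/seteqP; split => x; rewrite /= in_itv.
rewrite -[X in measurable X]setTI; exact: measurable_norm2.
Qed.

Lemma norm2_ge (x : R * R) : `|x.1| <= norm2 x /\ `|x.2| <= norm2 x.
Proof.
by split; rewrite -sqrtr_sqr ler_sqrt ?addr_ge0 ?sqr_ge0// ?lerDl ?lerDr sqr_ge0.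
Qed.

Lemma norm2_le (x : R * R) : norm2 x <= `|x.1| + `|x.2|.
Proof.
have h : 0 <= `|x.1| + `|x.2| by rewrite addr_ge0.
rewrite -[leRHS](ger0_norm h) -sqrtr_sqr ler_sqrt ?sqr_ge0// sqrrD !real_normK ?num_real//.
by rewrite lerD2r lerDl mulrn_wge0// mulr_ge0.
Qed.

(** [K] and [N] depend on neither [ep] nor [n], which lets the inversion proof choose [ep] first and
    the truncation radius afterwards. Near [x] continuity gives [eta]; far from [x] the bound
    [poisson_far] gives [ep * K]. *)
Lemma poisson_approx_identity (phi : R * R -> R) (x : R * R) (eta : R) :
  measurable_fun [set: R * R] phi -> mu2.-integrable setT (fun y => (phi y ^+ 2)%:E) ->
  continuous phi -> 0 < eta ->
  exists (K : R) (N : nat), 0 <= K /\ forall (ep : R) (n : nat), 0 < ep -> ep <= 1 -> (N <= n)%N ->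
    mu2.-integrable setT (EFin \o (fun y => (phi \_ (Bball n%:R)) y * poisson ep (sub2 x y))) /\
    `|Rintegral mu2 setT (fun y => (phi \_ (Bball n%:R)) y * poisson ep (sub2 x y)) - phi x|
      <= eta + ep * K.
Proof.
move=> mphi iphi cphi eta0.
have /cvgrPdist_lt/(_ _ eta0)/nbhs_ballP[r /= r0 hr] := cphi x.
pose C := Num.sqrt (1 + r ^- 2) ^+ 3.
have C0 : 0 <= C by rewrite exprn_ge0// sqrtr_ge0.
pose H y := (`|phi y| + `|phi x|) * poisson 1 (sub2 x y).
have H0 y : 0 <= H y by rewrite mulr_ge0 ?addr_ge0// poisson_ge0.
have ip1 := integrable_poisson_sub2 x (ltr01 : (0 : R) < 1).
have iH : mu2.-integrable setT (EFin \o H).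
  (* Since the kernel [g] at [ep = 1] takes values in [0, 1], [|phi| * g <= phi ^+ 2 + g]; square
     integrability of [phi] is then enough. *)
  have i2 : mu2.-integrable setT (EFin \o (fun y => phi y ^+ 2 + (1 + `|phi x|) * poisson 1 (sub2 x y))).
    exact: (integrableD measurableT iphi (integrableZl measurableT (1 + `|phi x|) ip1)).
  apply: (integrable_dom _ _ i2).
    apply: measurable_funM; last exact: measurable_poisson_sub2.
    apply: measurable_funD; last exact: measurable_cst.
    exact: (measurableT_comp (@normr_measurable R setT) mphi).
  move=> y; rewrite ger0_norm// /H.
  have p0 : 0 <= poisson 1 (sub2 x y) by exact: poisson_ge0.
  have p1 := poisson1_le1 (sub2 x y).
  rewrite -(real_normK (num_real (phi y))).
  set a := `|phi y|; set b := `|phi x|; set g := poisson 1 _ in p0 p1 *.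
  have : 0 <= (a - g) ^+ 2 by exact: sqr_ge0.
  have : 0 <= a by exact: normr_ge0.
  nra.
pose K := C * Rintegral mu2 setT H.
(* Points within [r] of [x] have coordinates of total size at most [|x.1| + |x.2| + 2 * r], so the
   ball of radius [N.+1] contains them and truncation is invisible there. *)
pose N := Num.truncn (`|x.1| + `|x.2| + 2 * r).
exists K, N.+1; split; first by apply: mulr_ge0 => //; apply: Rintegral_ge0 => y _; exact: H0.
move=> ep n ep0 ep1 Nn.
have ige := integrable_poisson_sub2 x ep0.
set g := fun y => poisson ep (sub2 x y).
have g0 y : 0 <= g y by exact: poisson_ge0.
set f := phi \_ (Bball n%:R).
have mf : measurable_fun [set: R * R] f.
  apply/(measurable_restrictT phi (measurable_Bball n%:R)).
  exact: measurable_funTS.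
have pw y : `|f y - phi x| * g y <= eta * g y + ep * C * H y.
  have [far|near] := leP r (norm2 (sub2 x y)).
    have gH : g y <= ep * C * poisson 1 (sub2 x y) by exact: poisson_far.
    have fy : `|f y - phi x| <= `|phi y| + `|phi x|.
      apply: le_trans (ler_normB _ _) _; rewrite lerD2r /f patchE.
      by case: ifP => // _; rewrite normr0.
    apply: (@le_trans _ _ (ep * C * H y)); last by rewrite lerDr mulr_ge0// ltW.
    rewrite /H [leRHS]mulrCA.
    by apply: ler_pM; [exact: normr_ge0|exact: g0|exact: fy|exact: gH].
  have [n1 n2] := norm2_ge (sub2 x y); rewrite /sub2/= in n1 n2.
  have y1 := le_lt_trans n1 near; have y2 := le_lt_trans n2 near.
  have yB : y \in Bball n%:R.
    rewrite inE /Bball/=; apply: le_trans (norm2_le y) _.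
    have t1 : `|y.1| <= `|x.1| + r.
      have := ler_normB x.1 (x.1 - y.1); rewrite opprB addrC subrK; lra.
    have t2 : `|y.2| <= `|x.2| + r.
      have := ler_normB x.2 (x.2 - y.2); rewrite opprB addrC subrK; lra.
    have t3 : `|x.1| + `|x.2| + 2 * r < N.+1%:R by exact: truncnS_gt.
    have t4 : N.+1%:R <= n%:R :> R by rewrite ler_nat.
    lra.
  have -> : f y = phi y by rewrite /f patchE yB.
  have hxy : `|phi y - phi x| <= eta.
    rewrite distrC ltW//; apply: hr; split => /=; rewrite /ball/=; [exact: y1|exact: y2].
  apply: (@le_trans _ _ (eta * g y)); first by rewrite ler_wpM2r.
  by rewrite lerDl mulr_ge0// mulr_ge0// ltW.
have imaj : mu2.-integrable setT (EFin \o (fun y => eta * g y + ep * C * H y)).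
  exact: (integrableD measurableT (integrableZl measurableT eta ige) (integrableZl measurableT (ep * C) iH)).
have mg : measurable_fun [set: R * R] g by exact: measurable_poisson_sub2.
have idiff : mu2.-integrable setT (EFin \o (fun y => (f y - phi x) * g y)).
  apply: (integrable_dom _ _ imaj).
    by apply: measurable_funM => //; apply: measurable_funB => //; exact: measurable_cst.
  by move=> y; rewrite normrM (ger0_norm (g0 y)).
have ixg : mu2.-integrable setT (EFin \o (fun y => phi x * g y)).
  exact: (integrableZl measurableT (phi x) ige).
have ifg : mu2.-integrable setT (EFin \o (fun y => f y * g y)).
  have := integrableD measurableT idiff ixg; apply: eq_integrable => // y _.
  by rewrite /= -EFinD; congr EFin; ring.
split => //.
have g1 : Rintegral mu2 setT g = 1 by rewrite /Rintegral integral_poisson_sub2.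
have -> : Rintegral mu2 setT (fun y => f y * g y) - phi x = Rintegral mu2 setT (fun y => (f y - phi x) * g y).
  rewrite -[X in _ - X]mulr1 -g1 -RintegralZl// -RintegralB//.
  by apply: eq_Rintegral => y _; rewrite mulrBl.
apply: le_trans (le_normr_Rintegral measurableT idiff) _.
apply: (@le_trans _ _ (Rintegral mu2 setT (fun y => eta * g y + ep * C * H y))).
  apply: le_Rintegral => //; last first.
    by move=> y _; rewrite normrM (ger0_norm (g0 y)).
  apply: (integrable_dom _ _ imaj).
    apply: (measurableT_comp (@normr_measurable R setT)).
    by apply: measurable_funM => //; apply: measurable_funB => //; exact: measurable_cst.
  by move=> y; rewrite normr_id normrM (ger0_norm (g0 y)).
rewrite RintegralD//; last 2 first.
- exact: (integrableZl measurableT eta ige).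
- exact: (integrableZl measurableT (ep * C) iH).
rewrite (RintegralZl eta measurableT ige) (RintegralZl (ep * C) measurableT iH) g1 mulr1 /K.
lra.
Qed.

End ApproximateIdentity.

(** * Fourier inversion for band-limited functions *)

Section FubiniReal.
Context d1 d2 (T1 : measurableType d1) (T2 : measurableType d2) (R : realType).
Variables (m1 : {sigma_finite_measure set T1 -> \bar R}) (m2 : {sigma_finite_measure set T2 -> \bar R}).
Variables (k : T1 * T2 -> R) (W : T1 -> R) (A : T2 -> R).
Hypotheses (mk : measurable_fun [set: T1 * T2] k).
Hypotheses (kWA : forall z, `|k z| <= W z.1 * A z.2) (W0 : forall x, 0 <= W x) (A0 : forall y, 0 <= A y).
Hypotheses (iW : m1.-integrable setT (EFin \o W)) (iA : m2.-integrable setT (EFin \o A)).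

Let ik : (m1 \x m2)%E.-integrable setT (EFin \o k).
Proof.
have mkE : measurable_fun [set: T1 * T2] (EFin \o k) by exact/measurable_EFinP.
apply/(@integrable12ltyP _ _ _ _ _ m1 m2 _ mkE).
have fA : (\int[m2]_y (A y)%:E \is a fin_num)%E by exact: integrable_fin_num iA.
apply: (@le_lt_trans _ _ (\int[m1]_x ((W x)%:E * \int[m2]_y (A y)%:E))%E).
  apply: ge0_le_integral => //.
  - by move=> x _; apply: integral_ge0.
  - have mA : measurable_fun [set: T1 * T2] (abse \o (EFin \o k)) by exact: measurableT_comp.
    exact: (@measurable_fun_fubini_tonelli_F _ _ _ _ _ m2 _ mA (fun z => abse_ge0 _)).
  - by apply: emeasurable_funM; [exact: (measurable_int _ iW)|exact: measurable_cst].
  - move=> x _; rewrite -ge0_integralZl//.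
    + apply: ge0_le_integral => //.
      * apply: measurableT_comp => //; exact: (measurable_fun_pair2 x mkE).
      * by apply: emeasurable_funM; [exact: measurable_cst|exact: (measurable_int _ iA)].
      * by move=> y _; rewrite /= -EFinM lee_fin kWA.
    + exact: (measurable_int _ iA).
    + by move=> y _; rewrite lee_fin.
    + by rewrite lee_fin.
rewrite -(fineK fA) ge0_integralZr//; last 3 first.
- exact: (measurable_int _ iW).
- by move=> x _; rewrite lee_fin.
- by rewrite lee_fin fine_ge0//; apply: integral_ge0 => y _; rewrite lee_fin.
have fW : (\int[m1]_x (W x)%:E \is a fin_num)%E by exact: integrable_fin_num iW.
by rewrite -(fineK fW) -EFinM ltry.
Qed.

Let ik1 x : m2.-integrable setT (EFin \o (fun y => k (x, y))).
Proof.
have i := integrableZl measurableT (W x) iA.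
apply: (le_integrable measurableT _ _ i).
  by apply/measurable_EFinP; exact: (measurable_fun_pair2 x mk).
by move=> y _; rewrite /= lee_fin (le_trans (kWA (x, y)))// ler_norm.
Qed.

Let ik2 y : m1.-integrable setT (EFin \o (fun x => k (x, y))).
Proof.
have i := integrableZl measurableT (A y) iW.
apply: (le_integrable measurableT _ _ i).
  by apply/measurable_EFinP; exact: (measurable_fun_pair1 y mk).
by move=> x _; rewrite /= lee_fin (le_trans (kWA (x, y)))// mulrC ler_norm.
Qed.

Lemma integrable_Rintegral1 :
  m1.-integrable setT (EFin \o (fun x => Rintegral m2 setT (fun y => k (x, y)))).
Proof.
have := @integrable_fubini_F _ _ _ _ _ m1 m2 _ ik.
apply: eq_integrable => // x _.
by rewrite /fubini_F /= /Rintegral fineK//; exact: integrable_fin_num (ik1 x).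
Qed.

(** The product majorant makes [k] jointly integrable, and every section integrable rather than
    almost every one, so all inner integrals are genuine real numbers. *)
Lemma Rintegral_swap :
  Rintegral m1 setT (fun x => Rintegral m2 setT (fun y => k (x, y))) =
  Rintegral m2 setT (fun y => Rintegral m1 setT (fun x => k (x, y))).
Proof.
rewrite {1}/Rintegral [RHS]/Rintegral; congr fine.
transitivity (\int[m1]_x \int[m2]_y (k (x, y))%:E)%E.
  apply: eq_integral => x _; rewrite /Rintegral fineK//; exact: integrable_fin_num (ik1 x).
rewrite (@Fubini _ _ _ _ _ m1 m2 _ ik).
by apply: eq_integral => y _; rewrite /Rintegral fineK//; exact: integrable_fin_num (ik2 y).
Qed.

End FubiniReal.

(** * Complex-valued integrals, restrictions and characters *)

Section ComplexIntegral.
Context {R : realType}.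
Local Notation leb := (@lebesgue_measure R).
Local Notation mu2 := (@mu2 R).
Local Notation V := (R * R -> R[i]).
Implicit Types (u v h : V) (D : set (R * R)).

Lemma ip2_cauchy_schwarz u v : L2 u -> L2 v ->
  csq (ip2 u v) <= Rintegral mu2 setT (fun x => csq (u x)) * Rintegral mu2 setT (fun x => csq (v x)).
Proof.
move=> Lu Lv; rewrite -!ip2_nsq.
(* Writing the codomain as [R[i]^o] gives the function space its scalar action by complex
   numbers. *)
exact: (@cauchy_schwarz R (R * R -> R[i]^o) (@L2 R) (@ip2 R) L2_D L2_Z ip2Dl ip2Zl ip2C ip2_ge0 u v Lu Lv).
Qed.

Lemma cintB u v : cintegrable u -> cintegrable v ->
  cint setT (fun x => u x - v x) = cint setT u - cint setT v.
Proof.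
move=> [h1 h2] [k1 k2]; apply: complex_ext; rewrite !cE.
  by rewrite -RintegralB//; apply: eq_Rintegral => x _; rewrite reCB.
by rewrite -RintegralB//; apply: eq_Rintegral => x _; rewrite imCB.
Qed.

Definition crestrict D u : V := fun x => if x \in D then u x else 0.

Lemma reC_crestrict D u : (fun x => reC (crestrict D u x)) = ((fun x => reC (u x)) \_ D).
Proof. by apply/funext => x; rewrite patchE /crestrict; case: ifP. Qed.

Lemma imC_crestrict D u : (fun x => imC (crestrict D u x)) = ((fun x => imC (u x)) \_ D).
Proof. by apply/funext => x; rewrite patchE /crestrict; case: ifP. Qed.

Lemma cint_crestrict D h : cint D h = cint setT (crestrict D h).
Proof.
rewrite /cint reC_crestrict imC_crestrict; congr Complex; exact: Rintegral_mkcond.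
Qed.

Lemma L2_crestrict D u : measurable D -> L2_on D u -> L2 (crestrict D u).
Proof.
move=> mD [m1 m2 h]; split.
- by rewrite reC_crestrict; exact/(measurable_restrictT _ mD).
- by rewrite imC_crestrict; exact/(measurable_restrictT _ mD).
rewrite (_ : \int[_]_(_ in _) _ = \int[mu2]_(x in D) (csq (u x))%:E)%E//.
rewrite [RHS]integral_mkcond; apply: eq_integral => x _.
by rewrite patchE /crestrict; case: ifP => //; rewrite csq0.
Qed.

Lemma L2_onS D u : measurable D -> L2 u -> L2_on D u.
Proof.
move=> mD [m1 m2 h]; split; [exact: measurable_funTS|exact: measurable_funTS|].
apply: le_lt_trans h; apply: ge0_subset_integral => //.
- by apply/measurable_EFinP; exact: measurable_csq.
- by move=> x _; rewrite lee_fin csq_ge0.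
Qed.

Lemma reC_expi (t : R) : reC (expi t) = cos t. Proof. by []. Qed.
Lemma imC_expi (t : R) : imC (expi t) = sin t. Proof. by []. Qed.
Lemma csq_expi (t : R) : csq (expi t) = 1. Proof. by rewrite /csq reC_expi imC_expi cos2Dsin2. Qed.
Lemma expiD (s t : R) : expi (s + t) = expi s * expi t.
Proof. by apply: complex_ext; rewrite !cE !(reC_expi, imC_expi) ?cosD ?sinD//; ring. Qed.
Lemma conjC_expi (t : R) : conjc (expi t) = expi (- t).
Proof. by apply: complex_ext; rewrite !cE !(reC_expi, imC_expi) ?cosN ?sinN. Qed.
Lemma expi0 : expi 0 = 1 :> R[i].
Proof. by rewrite /expi cos0 sin0. Qed.

Lemma cint_ew_expi (al : R) z : 0 < al ->
  cint setT (fun xi => (ew al xi)%:C%C * expi (dot2 xi z)) = ((2 * pi) ^+ 2 * poisson al z)%:C%C.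
Proof.
move=> al0; apply: complex_ext; rewrite /= ?(reCr, imCr).
  rewrite -integral_ew_cos//; apply: eq_Rintegral => xi _.
  by rewrite /= mul0r subr0.
transitivity (Rintegral mu2 setT (fun xi => ew al xi * sin (dot2 xi z))); last exact: integral_ew_sin.
apply: eq_Rintegral => xi _.
by rewrite /= mul0r addr0.
Qed.

Lemma dot2_sub2 (xi x y : R * R) : dot2 xi (sub2 x y) = dot2 xi x - dot2 xi y.
Proof. rewrite /dot2 /sub2/=; ring. Qed.

Lemma le_of_small (X c : R) : (forall e, 0 < e -> e <= 1 -> X <= c * e) -> X <= 0.
Proof.
move=> h; rewrite leNgt; apply/negP => X0.
have [c0|c0] := leP c 0; first by have := h 1 ltr01 (lexx _); lra.
(* This choice satisfies [e <= 1] and [c * e < X / 2], contradicting the bound at [e]. *)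
pose e := X / (2 * c + X).
have d0 : 0 < 2 * c + X by lra.
have e1 : e <= 1 by rewrite /e ler_pdivrMr// mul1r; lra.
have := h e (divr_gt0 X0 d0) e1.
by rewrite /e mulrA ler_pdivlMr//; nra.
Qed.

End ComplexIntegral.

Section SigmaFinite.
Context {R : realType}.
Local Notation leb := (@lebesgue_measure R).

Lemma mu2_sigma_finite : sigma_finite setT (@mu2 R).
Proof.
pose I n : set R := `[- n%:R, n%:R]%classic.
have mI n : measurable (I n) by exact: measurable_itv.
have fI n : (leb (I n) < +oo)%E.
  by rewrite /I lebesgue_measure_itv/=; case: ifP => _; rewrite ?ltry// -EFinB ltry.
exists (fun n => I n `*` I n).
  apply/esym/seteqP; split => // -[x y] _.
  pose n := maxn (Num.truncn `|x|).+1 (Num.truncn `|y|).+1.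
  have hn (z : R) : ((Num.truncn `|z|).+1 <= n)%N -> I n z.
    move=> zn; rewrite /I/= in_itv/= -ler_norml.
    by apply: (le_trans (ltW (truncnS_gt _))); rewrite ler_nat.
  by exists n => //; split; apply: hn; rewrite ?leq_maxl ?leq_maxr.
move=> n; split; first by apply: measurableX; exact: measurable_itv.
have -> : @mu2 R (I n `*` I n) = (leb (I n) * leb (I n))%E.
  by rewrite /mu2 product_measure1E//; exact: measurable_itv.
by rewrite lte_mul_pinfty// ge0_fin_numE.
Qed.

(* The product of two sigma-finite measures, with its sigma-finiteness made available to Fubini on [mu2 \x mu2]. *)
Definition mu2_sf : {sigma_finite_measure set _ -> \bar R} :=
  HB.pack (product_measure1 leb leb)
   (Measure_isSigmaFinite.Build _ _ _ (product_measure1 leb leb) mu2_sigma_finite).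
End SigmaFinite.

(** * Pointwise inversion for a continuous band-limited function *)

Section Inversion.
Context {R : realType}.
Local Notation leb := (@lebesgue_measure R).
Local Notation mu2 := (@mu2 R).
Variables (f g : R * R -> R[i]) (beta : R).
Hypotheses (cre : continuous (fun x => reC (f x))) (cim : continuous (fun x => imC (f x))).
Hypotheses (Lf : L2 f) (fg : is_FT_L2 f g) (beta0 : 0 < beta).
Hypothesis gB : {ae mu2, forall xi, ~ Bball beta xi -> g xi = 0}.

Let mref : measurable_fun [set: R * R] (fun x => reC (f x)). Proof. by case: Lf. Qed.
Let mimf : measurable_fun [set: R * R] (fun x => imC (f x)). Proof. by case: Lf. Qed.

Let fB n := crestrict (Bball n%:R) f.
Let A n y := `|reC (fB n y)| + `|imC (fB n y)|.

Let m_fB n : measurable_fun [set: R * R] (fun x => reC (fB n x)) /\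
  measurable_fun [set: R * R] (fun x => imC (fB n x)).
Proof.
rewrite /fB reC_crestrict imC_crestrict.
by split; apply/(measurable_restrictT _ (measurable_Bball n%:R)); exact: measurable_funTS.
Qed.

(** On the ball [1 <= expR n * ew 1 y], hence [csq (f y)] plus a multiple of [ew 1] dominates [A n]:
    square integrability gives integrability on bounded sets. *)
Let iA n : mu2.-integrable setT (EFin \o A n).
Proof.
have [m1 m2] := m_fB n.
have i2 : mu2.-integrable setT (EFin \o (fun y => csq (f y) + 2 * expR n%:R * ew 1 y)).
  exact: (integrableD measurableT (L2_integrable Lf)
    (integrableZl measurableT (2 * expR n%:R) (integrable_ew ltr01))).
apply: (integrable_dom _ _ i2).
  by apply: measurable_funD; apply: (measurableT_comp (@normr_measurable R setT)).
move=> y; rewrite ger0_norm ?addr_ge0// /A /fB /crestrict; case: ifP => [|_]; last first.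
  rewrite reC0 imC0 normr0 addr0 addr_ge0 ?csq_ge0// mulr_ge0 ?ew_ge0// mulr_ge0// expR_ge0.
rewrite inE /Bball/= => yn.
have h : 1 <= expR n%:R * ew 1 y.
  by rewrite /ew -expRD -[leLHS]expR0 ler_expR mul1r subr_ge0.
have := sqr_ge0 (`|reC (f y)| - 1); have := sqr_ge0 (`|imC (f y)| - 1).
rewrite /csq -[reC (f y) ^+ 2]real_normK ?num_real// -[imC (f y) ^+ 2]real_normK ?num_real//.
have := normr_ge0 (reC (f y)); have := normr_ge0 (imC (f y)); nra.
Qed.

Let A0 n y : 0 <= A n y. Proof. by rewrite addr_ge0. Qed.

Let prod2_norm (a b c d : R) : `|c| <= 1 -> `|d| <= 1 -> `|a * c - b * d| <= `|a| + `|b| /\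
  `|a * d + b * c| <= `|a| + `|b|.
Proof.
move=> c1 d1; split.
  by apply: le_trans (ler_normB _ _) _; rewrite !normrM; apply: lerD; rewrite ler_piMr.
by apply: le_trans (ler_normD _ _) _; rewrite !normrM; apply: lerD; rewrite ler_piMr.
Qed.

(** [kre] and [kim] are the components of [exp(-ep |xi|) fB(y) exp(i <xi, x - y>)]. Integration in
    [y] produces the truncated transform, integration in [xi] the Poisson kernel. *)
Let kre n ep x (z : (R * R) * (R * R)) :=
  ew ep z.1 * (reC (fB n z.2) * cos (dot2 z.1 (sub2 x z.2)) - imC (fB n z.2) * sin (dot2 z.1 (sub2 x z.2))).
Let kim n ep x (z : (R * R) * (R * R)) :=
  ew ep z.1 * (reC (fB n z.2) * sin (dot2 z.1 (sub2 x z.2)) + imC (fB n z.2) * cos (dot2 z.1 (sub2 x z.2))).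

Let m_arg x : measurable_fun [set: (R * R) * (R * R)] (fun z => dot2 z.1 (sub2 x z.2)).
Proof.
have m11 : measurable_fun [set: (R * R) * (R * R)] (fun z => z.1.1).
  by apply: (measurableT_comp (@measurable_fst _ _ R R)); exact: measurable_fst.
have m12 : measurable_fun [set: (R * R) * (R * R)] (fun z => z.1.2).
  by apply: (measurableT_comp (@measurable_snd _ _ R R)); exact: measurable_fst.
have m21 : measurable_fun [set: (R * R) * (R * R)] (fun z => z.2.1).
  by apply: (measurableT_comp (@measurable_fst _ _ R R)); exact: measurable_snd.
have m22 : measurable_fun [set: (R * R) * (R * R)] (fun z => z.2.2).
  by apply: (measurableT_comp (@measurable_snd _ _ R R)); exact: measurable_snd.
apply: measurable_funD; apply: measurable_funM => //.
  by apply: measurable_funB => //; exact: measurable_cst.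
by apply: measurable_funB => //; exact: measurable_cst.
Qed.

Let m_k n ep x : measurable_fun [set: (R * R) * (R * R)] (kre n ep x) /\
  measurable_fun [set: (R * R) * (R * R)] (kim n ep x).
Proof.
have [m1 m2] := m_fB n.
have mc : measurable_fun [set: (R * R) * (R * R)] (fun z => cos (dot2 z.1 (sub2 x z.2))).
  by apply: (measurableT_comp (continuous_measurable_fun (@continuous_cos R))).
have ms : measurable_fun [set: (R * R) * (R * R)] (fun z => sin (dot2 z.1 (sub2 x z.2))).
  by apply: (measurableT_comp (continuous_measurable_fun (@continuous_sin R))).
have me : measurable_fun [set: (R * R) * (R * R)] (fun z => ew ep z.1).
  by apply: (measurableT_comp (@measurable_ew R ep)); exact: measurable_fst.
have mr : measurable_fun [set: (R * R) * (R * R)] (fun z => reC (fB n z.2)).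
  by apply: (measurableT_comp m1); exact: measurable_snd.
have mi : measurable_fun [set: (R * R) * (R * R)] (fun z => imC (fB n z.2)).
  by apply: (measurableT_comp m2); exact: measurable_snd.
by split; apply: measurable_funM => //; [apply: measurable_funB|apply: measurable_funD];
  apply: measurable_funM.
Qed.

Let k_bound n ep x z : `|kre n ep x z| <= ew ep z.1 * A n z.2 /\ `|kim n ep x z| <= ew ep z.1 * A n z.2.
Proof.
rewrite /kre /kim !normrM (ger0_norm (ew_ge0 _ _)).
have [h1 h2] := prod2_norm (reC (fB n z.2)) (imC (fB n z.2))
  (norm_cos_le1 (dot2 z.1 (sub2 x z.2))) (norm_sin_le1 (dot2 z.1 (sub2 x z.2))).
by split; apply: ler_wpM2l => //; exact: ew_ge0.
Qed.

Local Notation m2s := (@mu2_sf R).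

Let T := trunc_FT f.

Let cint_fB n xi : cint setT (fun y => fB n y * expi (- dot2 xi y)) = (2 * pi)%:C%C * T n xi.
Proof.
rewrite /T /trunc_FT mulrA -[X in _ = X * _]/(((2 * pi)%:C * ((2 * pi)^-1)%:C)%C).
have -> : (((2 * pi)%:C * ((2 * pi)^-1)%:C)%C : R[i]) = 1.
  apply: complex_ext; rewrite !cE /= ?mulr0 ?mul0r ?addr0// subr0 divff// mulf_neq0//.
  by rewrite gt_eqF// pi_gt0.
rewrite mul1r [RHS]cint_crestrict; apply: cint_ext => y _.
by rewrite /fB /crestrict; case: ifP => // _; rewrite mul0r.
Qed.

Let cintegrable_fB n xi : cintegrable (fun y => fB n y * expi (- dot2 xi y)).
Proof.
have [m1 m2] := m_fB n.
have mc : measurable_fun [set: R * R] (fun y => cos (- dot2 xi y)).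
  apply: (measurableT_comp (continuous_measurable_fun (@continuous_cos R))).
  apply: measurable_funN.
  by apply: measurable_funD; apply: measurable_funM; [exact: measurable_cst|exact: measurable_fst|
    exact: measurable_cst|exact: measurable_snd].
have ms : measurable_fun [set: R * R] (fun y => sin (- dot2 xi y)).
  apply: (measurableT_comp (continuous_measurable_fun (@continuous_sin R))).
  apply: measurable_funN.
  by apply: measurable_funD; apply: measurable_funM; [exact: measurable_cst|exact: measurable_fst|
    exact: measurable_cst|exact: measurable_snd].
have h y := prod2_norm (reC (fB n y)) (imC (fB n y))
  (norm_cos_le1 (- dot2 xi y)) (norm_sin_le1 (- dot2 xi y)).
split; apply: (integrable_dom _ _ (iA n)).
- under eq_fun do rewrite reCM reC_expi imC_expi.
  by apply: measurable_funB; apply: measurable_funM.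
- by move=> y; rewrite reCM reC_expi imC_expi; case: (h y).
- under eq_fun do rewrite imCM reC_expi imC_expi.
  by apply: measurable_funD; apply: measurable_funM.
- by move=> y; rewrite imCM reC_expi imC_expi; case: (h y).
Qed.

Let inner_y n ep x xi :
  Complex (Rintegral m2s setT (fun y => kre n ep x (xi, y))) (Rintegral m2s setT (fun y => kim n ep x (xi, y)))
  = (ew ep xi)%:C%C * expi (dot2 xi x) * ((2 * pi)%:C%C * T n xi).
Proof.
rewrite -cint_fB -cintZ; last exact: cintegrable_fB.
congr Complex; apply: eq_Rintegral => y _.
  rewrite /kre /= dot2_sub2 !cE !(reC_expi, imC_expi) cosB sinB cosN sinN /=; ring.
rewrite /kim /= dot2_sub2 !cE !(reC_expi, imC_expi) cosB sinB cosN sinN /=; ring.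
Qed.

Let inner_xi n ep x y : 0 < ep ->
  Complex (Rintegral m2s setT (fun xi => kre n ep x (xi, y))) (Rintegral m2s setT (fun xi => kim n ep x (xi, y)))
  = fB n y * ((2 * pi) ^+ 2 * poisson ep (sub2 x y))%:C%C.
Proof.
move=> e0; rewrite -cint_ew_expi// -cintZ; last first.
  split.
    have := integrable_ew_bounded e0 (measurable_cos_dot2 (sub2 x y)) (fun xi => norm_cos_le1 _).
    by apply: eq_integrable => // xi _; rewrite /= mul0r subr0.
  have := integrable_ew_bounded e0 (measurable_sin_dot2 (sub2 x y)) (fun xi => norm_sin_le1 _).
  by apply: eq_integrable => // xi _; rewrite /= mul0r addr0.
congr Complex; apply: eq_Rintegral => xi _.
  rewrite /kre /= !cE !(reC_expi, imC_expi) /=; ring.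
rewrite /kim /= !cE !(reC_expi, imC_expi) /=; ring.
Qed.

(** Fubini on the double integral of [kre] and [kim]: the regularised inverse transform of a
    truncation of [f] is a Poisson average of that truncation. *)
Let swap n ep x : 0 < ep ->
  cint setT (fun xi => (ew ep xi)%:C%C * expi (dot2 xi x) * ((2 * pi)%:C%C * T n xi)) =
  cint setT (fun y => fB n y * ((2 * pi) ^+ 2 * poisson ep (sub2 x y))%:C%C).
Proof.
move=> e0.
have [mk1 mk2] := m_k n ep x.
have b1 z := (k_bound n ep x z).1; have b2 z := (k_bound n ep x z).2.
have s1 := @Rintegral_swap _ _ _ _ R m2s m2s _ _ _ mk1 b1 (@ew_ge0 R ep) (A0 n) (integrable_ew e0) (iA n).
have s2 := @Rintegral_swap _ _ _ _ R m2s m2s _ _ _ mk2 b2 (@ew_ge0 R ep) (A0 n) (integrable_ew e0) (iA n).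
transitivity (Complex (Rintegral m2s setT (fun xi => Rintegral m2s setT (fun y => kre n ep x (xi, y))))
   (Rintegral m2s setT (fun xi => Rintegral m2s setT (fun y => kim n ep x (xi, y))))).
  by congr Complex; apply: eq_Rintegral => xi _; rewrite -inner_y.
rewrite s1 s2.
by congr Complex; apply: eq_Rintegral => y _; rewrite -inner_xi.
Qed.

(** Measurability of the truncated transform is inherited from Fubini at [ep = 1], [x = 0]; the
    factor [ew (-1)] undoes the weight. *)
Let m_T n : measurable_fun [set: R * R] (fun xi => reC (T n xi)) /\
  measurable_fun [set: R * R] (fun xi => imC (T n xi)).
Proof.
have e0 : (0 : R) < 1 by [].
have [mk1 mk2] := m_k n 1 (0, 0).
have b1 z := (k_bound n 1 (0, 0) z).1; have b2 z := (k_bound n 1 (0, 0) z).2.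
have s1 := @integrable_Rintegral1 _ _ _ _ R m2s m2s _ _ _ mk1 b1 (@ew_ge0 R 1) (A0 n) (integrable_ew e0) (iA n).
have s2 := @integrable_Rintegral1 _ _ _ _ R m2s m2s _ _ _ mk2 b2 (@ew_ge0 R 1) (A0 n) (integrable_ew e0) (iA n).
have t1 : measurable_fun [set: R * R] (fun xi => Rintegral m2s setT (fun y => kre n 1 (0, 0) (xi, y))).
  by apply/measurable_EFinP; exact: (measurable_int _ s1).
have t2 : measurable_fun [set: R * R] (fun xi => Rintegral m2s setT (fun y => kim n 1 (0, 0) (xi, y))).
  by apply/measurable_EFinP; exact: (measurable_int _ s2).
have minv : measurable_fun [set: R * R] (fun xi => (2 * pi)^-1 * ew (-1) xi).
  by apply: measurable_funM; [exact: measurable_cst|exact: measurable_ew].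
have pi0 : pi != 0 :> R by rewrite gt_eqF// pi_gt0.
have E xi : T n xi = ((2 * pi)^-1 * ew (-1) xi)%:C%C *
   Complex (Rintegral m2s setT (fun y => kre n 1 (0, 0) (xi, y))) (Rintegral m2s setT (fun y => kim n 1 (0, 0) (xi, y))).
  rewrite inner_y.
  have -> : dot2 xi (0, 0) = 0 :> R by rewrite /dot2/= !mulr0 addr0.
  rewrite expi0 mulr1; move: (T n xi) => t; rewrite !mulrA -[LHS]mul1r; congr (_ * t); apply/esym.
  have ee : ew (-1) xi * ew 1 xi = 1 :> R by rewrite /ew -expRD mulN1r mul1r opprK subrr expR0.
  apply: complex_ext; rewrite !cE /=; last by ring.
  rewrite -[RHS]ee; move: (pi : R) pi0 => P P0; field.
  by rewrite P0.
split; under eq_fun do rewrite E.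
  under eq_fun do rewrite reCM imCr mul0r subr0.
  by apply: measurable_funM.
under eq_fun do rewrite imCM imCr mul0r addr0.
by apply: measurable_funM.
Qed.

(** The transform is known to vanish off the ball only almost everywhere. This representative
    vanishes there pointwise, so the growing weight exp(al |xi| / 2) can be applied to it. *)
Definition ftB : R * R -> R[i] := crestrict (Bball beta) g.

Let Lg : L2 g. Proof. by case: fg. Qed.

Lemma L2_ftB : L2 ftB.
Proof.
apply: L2_crestrict; first exact: measurable_Bball.
exact: (L2_onS (measurable_Bball beta) Lg).
Qed.

Let mulVC (a : R) : a != 0 -> (a^-1)%:C%C * a%:C%C = 1 :> R[i].
Proof.
move=> a0; apply: complex_ext; rewrite !cE /=; last by ring.
by field.
Qed.

(** [ftB] and [g] agree almost everywhere, so the L^2 convergence defining the transform passes to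
    [ftB]. *)
Let TF_small (e : R) : 0 < e -> exists N : nat, forall n, (N <= n)%N ->
  L2 (fun xi => T n xi - ftB xi) /\ Rintegral mu2 setT (fun xi => csq (T n xi - ftB xi)) <= e.
Proof.
move=> e0; have [_ /fine_cvgP[[N1 _ h1] /cvgrPdist_lt/(_ _ e0)[N2 _ h2]]] := fg.
exists (maxn N1 N2) => n; rewrite geq_max => /andP[n1 n2].
have {}h1 := h1 n n1; have {}h2 := h2 n n2; rewrite /= in h1 h2.
have [mt1 mt2] := m_T n; have [mg1 mg2 _] := Lg; have [mf1 mf2 _] := L2_ftB.
have mTg : measurable_fun [set: R * R] (fun xi => csq (T n xi - g xi)).
  apply: measurable_csq.
    by under eq_fun do rewrite reCB; apply: measurable_funB.
  by under eq_fun do rewrite imCB; apply: measurable_funB.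
have mTF1 : measurable_fun [set: R * R] (fun xi => reC (T n xi - ftB xi)).
  by under eq_fun do rewrite reCB; apply: measurable_funB.
have mTF2 : measurable_fun [set: R * R] (fun xi => imC (T n xi - ftB xi)).
  by under eq_fun do rewrite imCB; apply: measurable_funB.
have mTF := measurable_csq mTF1 mTF2.
have E : (\int[mu2]_xi (csq (T n xi - ftB xi))%:E = \int[mu2]_xi (csq (T n xi - g xi))%:E)%E.
  apply: ge0_ae_eq_integral => //.
  - exact/measurable_EFinP.
  - exact/measurable_EFinP.
  - by move=> xi _; rewrite lee_fin csq_ge0.
  - by move=> xi _; rewrite lee_fin csq_ge0.
  case: gB => N [mN N0 sub]; exists N; split => // xi /= hxi; apply: sub => /= hg; apply: hxi => _.
  rewrite /ftB /crestrict; case: ifPn => // /negP; rewrite inE => /hg ->.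
  by [].
split.
  split => //; rewrite E; rewrite ge0_fin_numE// in h1.
  by apply: integral_ge0 => xi _; rewrite lee_fin csq_ge0.
rewrite /Rintegral E; move: h2; rewrite sub0r normrN => h2.
by apply: ltW; apply: le_lt_trans h2; exact: ler_norm.
Qed.

Let choose_ep (e K1 K2 : R) : 0 < e -> 0 <= K1 -> 0 <= K2 ->
  exists ep, [/\ 0 < ep, ep <= e, ep * K1 <= e & ep * K2 <= e].
Proof.
move=> e0 K10 K20; have K0 : 0 < K1 + K2 + 1 by lra.
have ep0 : 0 < e / (K1 + K2 + 1) by rewrite divr_gt0.
have epK : e / (K1 + K2 + 1) * (K1 + K2 + 1) = e by rewrite divfK// gt_eqF.
exists (e / (K1 + K2 + 1)); split=> //.
- by rewrite ler_pdivrMr// ler_peMr ?(ltW e0)//; lra.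
- by rewrite -[leRHS]epK ler_pM2l//; lra.
- by rewrite -[leRHS]epK ler_pM2l//; lra.
Qed.

Let sqr_small (a k e : R) : `|a| <= e + k -> k <= e -> e <= 1 -> a ^+ 2 <= 4 * e.
Proof.
by move=> h ke e1; rewrite -(real_normK (num_real a)); move: (normr_ge0 a) h; nra.
Qed.

Let csq_sum3 z1 z2 z3 (p k e : R) : csq z1 <= 8 * p * e -> csq z2 <= e -> csq z3 <= k * e ->
  csq (z1 + (z2 + z3)) <= (16 * p + 4 + 4 * k) * e.
Proof. by move=> h1 h2 h3; have := csqD z1 (z2 + z3); have := csqD z2 z3; lra. Qed.

(** With [J] and [B] the integrals of [T n] and [ftB] against the regularised character, the
    difference splits into three parts: [2 pi f(x) - J], small by [swap] and the approximate
    identity; [J - B], by Cauchy-Schwarz and [TF_small]; [B - c0], since [ew ep] is close to 1 on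
    the ball. *)
Lemma inversion x : f x = ((2 * pi)^-1)%:C%C * cint setT (fun xi => ftB xi * expi (dot2 xi x)).
Proof.
have pi0 : 0 < pi :> R by exact: pi_gt0.
have p2 : 2 * pi != 0 :> R by rewrite mulf_neq0// gt_eqF.
set c0 := cint _ _.
suff /csq_eq0/eqP : csq ((2 * pi)%:C%C * f x - c0) = 0.
  rewrite subr_eq0 => /eqP <-; move: (2 * pi : R) p2 => a a0; rewrite mulrA.
  by rewrite mulVC// mul1r.
apply/eqP; rewrite eq_le csq_ge0 andbT.
pose M := Rintegral mu2 setT (fun xi => csq (ftB xi)).
pose I1 := Rintegral mu2 setT (fun xi => (ew 1 xi)).
have M0 : 0 <= M by apply: Rintegral_ge0 => xi _; exact: csq_ge0.
have I10 : 0 <= I1 by apply: Rintegral_ge0 => xi _; exact: ew_ge0.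
have iew1 := integrable_ew (ltr01 : (0 : R) < 1).
pose Ex xi := expi (dot2 xi x).
have mE1 : measurable_fun [set: R * R] (fun xi => reC (Ex xi)) by exact: measurable_cos_dot2.
have mE2 : measurable_fun [set: R * R] (fun xi => imC (Ex xi)) by exact: measurable_sin_dot2.
have L2_wE (w h : R * R -> R) : measurable_fun [set: R * R] w -> (forall xi, w xi ^+ 2 <= h xi) ->
    mu2.-integrable setT (EFin \o h) -> L2 (fun xi => (w xi)%:C%C * Ex xi).
  move=> mw wk ih; apply: (@L2_dom _ _ h _ _ _ ih).
  - by under eq_fun do rewrite reCM imCr mul0r subr0; apply: measurable_funM.
  - by under eq_fun do rewrite imCM imCr mul0r addr0; apply: measurable_funM.
  - by move=> xi; rewrite csqM csq_expi mulr1 /csq reCr imCr expr0n addr0.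
have csq_wE (w : R * R -> R) xi : csq ((w xi)%:C%C * Ex xi) = w xi ^+ 2.
  by rewrite csqM csq_expi mulr1 /csq reCr imCr expr0n addr0.
have CS u (w h : R * R -> R) : L2 u -> measurable_fun [set: R * R] w ->
    (forall xi, w xi ^+ 2 <= h xi) -> mu2.-integrable setT (EFin \o h) ->
    csq (cint setT (fun xi => u xi * ((w xi)%:C%C * Ex xi))) <=
      Rintegral mu2 setT (fun xi => csq (u xi)) * Rintegral mu2 setT h.
  move=> Lu mw wk ih; have Lw := L2_wE w h mw wk ih.
  have Lcw := L2_conj Lw.
  rewrite (_ : cint _ _ = ip2 u (fun xi => conjc ((w xi)%:C%C * Ex xi))); last first.
    apply: cint_ext => xi _; congr (_ * _).
    by apply: complex_ext; rewrite !cE ?opprK.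
  apply: le_trans (ip2_cauchy_schwarz Lu Lcw) _.
  apply: ler_wpM2l; first by apply: Rintegral_ge0 => xi _; exact: csq_ge0.
  apply: le_Rintegral => //; first exact: (L2_integrable Lcw).
  by move=> xi _; rewrite csqJ csq_wE.
(* The coefficient is that of [csq_sum3] with [p = (2 * pi) ^+ 2] and
   [k = M * (beta ^+ 2 * expR beta * I1)]. *)
apply: (@le_of_small _ _ (16 * (2 * pi) ^+ 2 + 4 + 4 * (M * (beta ^+ 2 * expR beta * I1)))) => e e0 e1.
have ire : mu2.-integrable setT (fun y => (reC (f y) ^+ 2)%:E).
  apply: (integrable_dom _ _ (L2_integrable Lf)); first exact: measurable_funX.
  by move=> y; rewrite ger0_norm ?sqr_ge0// reC_sqr_le.
have iim : mu2.-integrable setT (fun y => (imC (f y) ^+ 2)%:E).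
  apply: (integrable_dom _ _ (L2_integrable Lf)); first exact: measurable_funX.
  by move=> y; rewrite ger0_norm ?sqr_ge0// imC_sqr_le.
have [K1 [N1 [K10 h1]]] := poisson_approx_identity x mref ire cre e0.
have [K2 [N2 [K20 h2]]] := poisson_approx_identity x mimf iim cim e0.
have [ep [ep0 epe epK1 epK2]] := choose_ep e0 K10 K20.
have ep1 : ep <= 1 by exact: le_trans e1.
have ep20 : 0 < 2 * ep by rewrite mulr_gt0.
(* [I2] depends on [ep], so [ep] is fixed before the truncation radius [n], and the tolerance for
   [T n] is scaled by [I2 + 1]. *)
pose I2 := Rintegral mu2 setT (ew (2 * ep)).
have I20 : 0 <= I2 by apply: Rintegral_ge0 => xi _; exact: ew_ge0.
have I21 : 0 < I2 + 1 by rewrite ltr_wpDl.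
have tol0 : 0 < e / (I2 + 1) by rewrite divr_gt0.
have [N3 h3] := TF_small tol0.
pose n := maxn N1 (maxn N2 N3).
have nN1 : (N1 <= n)%N by rewrite leq_maxl.
have nN2 : (N2 <= n)%N by rewrite (leq_trans (leq_maxl N2 N3))// leq_maxr.
have nN3 : (N3 <= n)%N by rewrite (leq_trans (leq_maxr N2 N3))// leq_maxr.
have {h1}[i1 h1] := h1 ep n ep0 ep1 nN1.
have {h2}[i2 h2] := h2 ep n ep0 ep1 nN2.
have {h3}[LTF h3] := h3 n nN3.
have ew2 xi : ew ep xi ^+ 2 = ew (2 * ep) xi.
  by rewrite expr2 /ew -expRD; congr expR; ring.
have ew2le xi : ew ep xi ^+ 2 <= ew (2 * ep) xi by rewrite ew2.
have iew2 := integrable_ew ep20.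
have mew := @measurable_ew R ep.
have LwE : L2 (fun xi => (ew ep xi)%:C%C * Ex xi).
  exact: (L2_wE _ _ mew ew2le iew2).
have LT : L2 (T n).
  rewrite (_ : T n = (fun xi => (T n xi - ftB xi) + ftB xi)); last by apply/funext => xi; rewrite subrK.
  exact: (L2_D LTF L2_ftB).
pose J := cint setT (fun xi => T n xi * ((ew ep xi)%:C%C * Ex xi)).
pose B := cint setT (fun xi => ftB xi * ((ew ep xi)%:C%C * Ex xi)).
have iTE := L2_mul_integrable LT LwE.
have iFE := L2_mul_integrable L2_ftB LwE.
have iTFE := L2_mul_integrable LTF LwE.
have JB : csq (J - B) <= e.
  have -> : J - B = cint setT (fun xi => (T n xi - ftB xi) * ((ew ep xi)%:C%C * Ex xi)).
    by rewrite -cintB//; apply: cint_ext => xi _; rewrite mulrBl.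
  apply: le_trans (CS _ _ _ LTF mew ew2le iew2) _.
  apply: (@le_trans _ _ (e / (I2 + 1) * I2)); first by rewrite ler_wpM2r.
  by rewrite mulrAC ler_pdivrMr// ler_pM2l// lerDl.
pose chi := (fun xi => ew ep xi - 1) \_ (Bball beta).
have mchi : measurable_fun [set: R * R] chi.
  apply/(measurable_restrictT _ (measurable_Bball beta)); apply: measurable_funTS.
  by apply: measurable_funB => //; exact: measurable_cst.
(* On the ball [|ew ep xi - 1| <= ep * beta]; the factor [expR beta * ew 1 xi], at least 1 there,
   turns this constant into an integrable majorant on the plane. *)
have chi2 xi : chi xi ^+ 2 <= (ep * beta) ^+ 2 * expR beta * ew 1 xi.
  rewrite /chi patchE; case: ifPn => [|_]; last first.
    by rewrite expr0n mulr_ge0 ?ew_ge0// mulr_ge0 ?sqr_ge0 ?expR_ge0.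
  rewrite inE /Bball/= => xiB.
  have q1 : 1 <= expR beta * ew 1 xi by rewrite /ew -expRD -[leLHS]expR0 ler_expR mul1r subr_ge0.
  have q2 : 0 <= 1 - ew ep xi by rewrite subr_ge0 ew_le1// ltW.
  have q3 : 1 - ew ep xi <= ep * beta.
    rewrite lerBlDl -lerBlDr /ew; apply: le_trans (expR_ge1Dx _).
    by rewrite lerD2l lerN2 ler_pM2l.
  have q4 : (ew ep xi - 1) ^+ 2 <= (ep * beta) ^+ 2.
    by rewrite -sqrrN opprB ler_pXn2r ?nnegrE// mulr_ge0// ltW.
  apply: (le_trans q4); rewrite -[leLHS]mulr1 -mulrA ler_wpM2l ?sqr_ge0//.
have ichi := integrableZl measurableT ((ep * beta) ^+ 2 * expR beta) iew1.
have Bc0 : csq (B - c0) <= M * (beta ^+ 2 * expR beta * I1) * e.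
  have -> : B - c0 = cint setT (fun xi => ftB xi * ((chi xi)%:C%C * Ex xi)).
    have LchiE := L2_wE _ _ mchi chi2 ichi.
    have iFchi := L2_mul_integrable L2_ftB LchiE.
    apply/eqP; rewrite subr_eq addrC -subr_eq; apply/eqP.
    rewrite -cintB//; apply: cint_ext => xi _.
    rewrite /ftB /crestrict /chi patchE; case: ifP => _; last by rewrite !mul0r subrr.
    by apply: complex_ext; rewrite !cE /=; ring.
  apply: le_trans (CS _ _ _ L2_ftB mchi chi2 ichi) _.
  rewrite -/M -mulrA; apply: ler_wpM2l => //.
  rewrite (RintegralZl _ measurableT iew1) -/I1 exprMn.
  have epsq : ep ^+ 2 <= e.
    by rewrite expr2 -[leRHS]mulr1; apply: ler_pM => //; exact: ltW.
  have cst0 : 0 <= beta ^+ 2 * expR beta * I1.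
    by rewrite mulr_ge0// mulr_ge0 ?sqr_ge0// expR_ge0.
  rewrite (_ : _ * I1 = beta ^+ 2 * expR beta * I1 * ep ^+ 2); last by ring.
  by rewrite ler_wpM2l.
pose P := cint setT (fun y => fB n y * (poisson ep (sub2 x y))%:C%C).
have reP y : ((fun x => reC (f x)) \_ (Bball n%:R)) y * poisson ep (sub2 x y) =
    reC (fB n y * (poisson ep (sub2 x y))%:C%C).
  by rewrite -reC_crestrict reCM imCr mulr0 subr0.
have imP y : ((fun x => imC (f x)) \_ (Bball n%:R)) y * poisson ep (sub2 x y) =
    imC (fB n y * (poisson ep (sub2 x y))%:C%C).
  by rewrite -imC_crestrict imCM imCr mulr0 add0r.
have ifBp : cintegrable (fun y => fB n y * (poisson ep (sub2 x y))%:C%C).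
  split.
    by apply: eq_integrable i1 => // y _; congr EFin; exact: reP.
  by apply: eq_integrable i2 => // y _; congr EFin; exact: imP.
have JP : J = (2 * pi)%:C%C * P.
  have := swap n x ep0.
  have -> : cint setT (fun xi => (ew ep xi)%:C%C * expi (dot2 xi x) * ((2 * pi)%:C%C * T n xi)) = (2 * pi)%:C%C * J.
    by rewrite /J -cintZ//; apply: cint_ext => xi _; rewrite mulrCA; congr (_ * _); rewrite mulrC.
  have -> : cint setT (fun y => fB n y * ((2 * pi) ^+ 2 * poisson ep (sub2 x y))%:C%C) = ((2 * pi) ^+ 2)%:C%C * P.
    rewrite /P -cintZ//; apply: cint_ext => y _.
    by apply: complex_ext; rewrite !cE /=; ring.
  move: (2 * pi : R) p2 => a a0 h.
  have := congr1 (fun z => (a^-1)%:C%C * z) h; rewrite !mulrA.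
  rewrite mulVC// mul1r => ->; congr (_ * _).
  apply: complex_ext; rewrite !cE /=; last by ring.
  by field.
have fP : csq ((2 * pi)%:C%C * f x - J) <= 8 * (2 * pi) ^+ 2 * e.
  rewrite JP -mulrBr csqM {1}/csq reCr imCr expr0n addr0.
  have r1 : (reC (f x - P)) ^+ 2 <= 4 * e.
    apply: sqr_small epK1 e1.
    rewrite reCB distrC (_ : reC P = Rintegral mu2 setT (fun y => ((fun x => reC (f x)) \_ (Bball n%:R)) y * poisson ep (sub2 x y)))//.
    by apply: eq_Rintegral => y _; rewrite reP.
  have r2 : (imC (f x - P)) ^+ 2 <= 4 * e.
    apply: sqr_small epK2 e1.
    rewrite imCB distrC (_ : imC P = Rintegral mu2 setT (fun y => ((fun x => imC (f x)) \_ (Bball n%:R)) y * poisson ep (sub2 x y)))//.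
    by apply: eq_Rintegral => y _; rewrite imP.
  rewrite [leRHS](_ : _ = (2 * pi) ^+ 2 * (4 * e + 4 * e)); last by ring.
  by rewrite ler_wpM2l ?sqr_ge0//; apply: lerD.
have -> : (2 * pi)%:C%C * f x - c0 = ((2 * pi)%:C%C * f x - J) + ((J - B) + (B - c0)).
  by rewrite !addrA !subrK.
exact: csq_sum3.
Qed.

End Inversion.

(** * Exponential sums and weighted frame bounds *)

Section ExponentialSystem.
Context {R : realType}.
Local Notation leb := (@lebesgue_measure R).
Local Notation mu2 := (@mu2 R).
Variables (delta A B : R) (xs : nat -> R * R).
Hypotheses (delta0 : 0 < delta) (A0 : 0 < A) (B0 : 0 < B).

Definition expsum (n : nat) (c : nat -> R[i]) (xi : R * R) : R[i] :=
  \sum_(j < n) c j * expi (dot2 xi (xs j)).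

Lemma Ssq_itv (r : R) : Ssq r = `[- r, r]%classic `*` `[- r, r]%classic.
Proof.
apply/seteqP; split => -[x y]; rewrite /Ssq /= !in_itv/= -!ler_norml.
  by [].
by [].
Qed.

Lemma measurable_Ssq (r : R) : measurable (Ssq r : set (R * R)).
Proof. by rewrite Ssq_itv; apply: measurableX; exact: measurable_itv. Qed.

Lemma mu2_Ssq (r : R) : 0 < r -> mu2 (Ssq r) = ((2 * r) ^+ 2)%:E.
Proof.
move=> r0; rewrite Ssq_itv.
pose I : set R := `[- r, r]%classic.
have -> : mu2 (I `*` I) = (leb I * leb I)%E.
  by rewrite /mu2 product_measure1E//; exact: measurable_itv.
rewrite /I.
rewrite lebesgue_measure_itv /= lte_fin ifT ?ltrNl ?opprK; last by rewrite -subr_gt0 opprK addr_gt0.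
by rewrite -EFinD -EFinM; congr EFin; ring.
Qed.

Lemma measurable_expsum n c : measurable_fun [set: R * R] (fun xi => reC (expsum n c xi)) /\
  measurable_fun [set: R * R] (fun xi => imC (expsum n c xi)).
Proof.
split.
  rewrite (_ : (fun _ => _) = (fun xi => \sum_(j < n) (reC (c j) * cos (dot2 xi (xs j)) - imC (c j) * sin (dot2 xi (xs j))))).
    apply: measurable_sum => j; apply: measurable_funB; apply: measurable_funM;
      by [exact: measurable_cst|exact: measurable_cos_dot2|exact: measurable_sin_dot2].
  by apply/funext => xi; rewrite reC_sum; apply: eq_bigr => j _; rewrite reCM reC_expi imC_expi.
rewrite (_ : (fun _ => _) = (fun xi => \sum_(j < n) (reC (c j) * sin (dot2 xi (xs j)) + imC (c j) * cos (dot2 xi (xs j))))).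
  apply: measurable_sum => j; apply: measurable_funD; apply: measurable_funM;
    by [exact: measurable_cst|exact: measurable_cos_dot2|exact: measurable_sin_dot2].
by apply/funext => xi; rewrite imC_sum; apply: eq_bigr => j _; rewrite imCM reC_expi imC_expi.
Qed.

Lemma expsum_bounded n c : exists K, forall xi, csq (expsum n c xi) <= K.
Proof.
rewrite /expsum; elim: n => [|n [K IH]].
  by exists 0 => xi; rewrite big_ord0 csq0.
exists (2 * K + 2 * csq (c n)) => xi; rewrite big_ord_recr/=.
apply: le_trans (csqD _ _) _; by rewrite csqM csq_expi mulr1 lerD2r ler_pM2l.
Qed.

(** Translation multiplies the coefficients by unimodular numbers only. This is what transfers the
    upper Riesz bound to all translates of the square with the same constant. *)
Lemma expsum_shift n c (eta xi : R * R) :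
  expsum n c (xi.1 + eta.1, xi.2 + eta.2) = expsum n (fun j => c j * expi (dot2 eta (xs j))) xi.
Proof.
apply: eq_bigr => j _; rewrite -mulrA; congr (_ * _); rewrite -expiD; congr expi.
rewrite /dot2/=; ring.
Qed.

Lemma integrable_bounded_Ssq (g : R * R -> R) (K r : R) : measurable_fun [set: R * R] g ->
  (forall xi, `|g xi| <= K) -> mu2.-integrable setT (EFin \o (g \_ (Ssq r))).
Proof.
move=> mg gK; have K0 : 0 <= K by exact: le_trans (gK (0, 0)).
(* On the square [norm2 xi <= 2 * r], so [expR (2 * r) * ew 1 xi] is at least 1 and serves as an
   integrable substitute for the constant 1. *)
have i := integrableZl measurableT (K * expR (2 * r)) (integrable_ew (ltr01 : (0 : R) < 1)).
apply: (integrable_dom _ _ i).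
  by apply/(measurable_restrictT _ (measurable_Ssq r)); exact: measurable_funTS.
move=> xi; rewrite /= patchE; case: ifPn => [|_]; last first.
  by rewrite normr0 mulr_ge0 ?ew_ge0// mulr_ge0// expR_ge0.
rewrite inE => -[h1 h2]; apply: le_trans (gK xi) _.
rewrite -mulrA ler_peMr// /ew -expRD -[leLHS]expR0 ler_expR mul1r subr_ge0.
by apply: le_trans (norm2_le xi) _; rewrite mulr_natl mulr2n lerD.
Qed.

Lemma norm2D (x y : R * R) : norm2 (x.1 + y.1, x.2 + y.2) <= norm2 x + norm2 y.
Proof.
have h : x.1 * y.1 + x.2 * y.2 <= norm2 x * norm2 y.
  apply: le_trans (ler_norm _) _; rewrite -ler_sqr ?nnegrE ?mulr_ge0 ?norm2_ge0// real_normK ?num_real//.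
  by rewrite exprMn !sqr_norm2 -subr_ge0; have := sqr_ge0 (x.1 * y.2 - x.2 * y.1); congr (0 <= _); ring.
have h2 : norm2 (x.1 + y.1, x.2 + y.2) ^+ 2 <= (norm2 x + norm2 y) ^+ 2.
  by rewrite sqr_norm2 [leRHS]sqrrD !sqr_norm2 /= !sqrrD; move: h; lra.
by move: h2; rewrite ler_pXn2r// nnegrE ?addr_ge0 ?norm2_ge0.
Qed.

(** A shift by [xi] moves a point by at most [2 * r], and leaving the large square forces
    [norm2 eta >= 9 * r]. One unit of [al] is kept as [ew 1 eta], integrable in [eta]; the remaining
    [al - 1] supplies the decay in [al]. *)
Lemma ew_shift_le (al r : R) (xi eta : R * R) : 1 <= al -> 0 < r -> Ssq r xi ->
  ~ Ssq (10 * r) (eta.1 + xi.1, eta.2 + xi.2) ->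
  ew al (eta.1 + xi.1, eta.2 + xi.2) <= expR (10 * r) * expR (- (al * (5 * r))) * ew 1 eta.
Proof.
move=> al1 r0 [x1 x2] nS.
have xn : norm2 (- xi.1, - xi.2) <= 2 * r.
  by apply: le_trans (norm2_le _) _; rewrite /= !normrN mulr_natl mulr2n lerD.
have n1 : norm2 eta - 2 * r <= norm2 (eta.1 + xi.1, eta.2 + xi.2).
  rewrite lerBlDr; have := norm2D (eta.1 + xi.1, eta.2 + xi.2) (- xi.1, - xi.2).
  rewrite /= !addrK -surjective_pairing => h; apply: le_trans h _.
  by rewrite lerD2l.
have n2 : 9 * r <= norm2 eta.
  have [e1 e2] := norm2_ge eta; rewrite leNgt; apply/negP => nl; apply: nS; split=> /=.
    by apply: le_trans (ler_normD _ _) _; move: e1 x1 nl; lra.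
  by apply: le_trans (ler_normD _ _) _; move: e2 x2 nl; lra.
rewrite /ew -!expRD ler_expR.
have : al * (norm2 eta - 2 * r) <= al * norm2 (eta.1 + xi.1, eta.2 + xi.2) by rewrite ler_pM2l//; lra.
have : (al - 1) * (9 * r) <= (al - 1) * norm2 eta by rewrite ler_wpM2l//; lra.
have : r <= al * r by rewrite ler_peMl// ltW.
rewrite !mulrBl !mulrBr !mul1r; lra.
Qed.

Hypothesis upper : forall n (c : nat -> R[i]),
  Rintegral mu2 (Ssq delta) (fun xi => csq (expsum n c xi)) <= B * \sum_(j < n) csq (c j).

Let m_csq n c : measurable_fun [set: R * R] (fun xi => csq (expsum n c xi)).
Proof. by have [m1 m2] := measurable_expsum n c; exact: measurable_csq. Qed.

Let i_csq n c : mu2.-integrable setT (EFin \o ((fun xi => csq (expsum n c xi)) \_ (Ssq delta))).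
Proof.
have [K hK] := expsum_bounded n c.
by apply: (integrable_bounded_Ssq (K := K)) => // xi; rewrite ger0_norm ?csq_ge0.
Qed.

Let upperE n c :
  (\int[mu2]_xi (((fun xi => csq (expsum n c xi)) \_ (Ssq delta)) xi)%:E <= (B * \sum_(j < n) csq (c j))%:E)%E.
Proof.
have f := integrable_fin_num measurableT (i_csq n c).
by rewrite -(fineK f) lee_fin; have := upper n c; rewrite Rintegral_mkcond.
Qed.

(** With this half side the exponent [5 * r] of [ew_shift_le] is [delta / 2]. *)
Let r := delta / 10.
Let r0 : 0 < r. Proof. by rewrite divr_gt0. Qed.
Let r10 : 10 * r = delta. Proof. by rewrite mulrC divfK. Qed.
Let I1 := Rintegral mu2 setT (ew 1 : R * R -> R).
Let I10 : 0 <= I1. Proof. by apply: Rintegral_ge0 => xi _; exact: ew_ge0. Qed.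
Let I1E : (\int[mu2]_xi (ew 1 xi)%:E = I1%:E)%E.
Proof.
by rewrite /I1 /Rintegral fineK//; exact: integrable_fin_num (integrable_ew (ltr01 : (0 : R) < 1)).
Qed.

Definition tail_cst : R := ((2 * r) ^+ 2)^-1 * (B * expR delta * I1).

Lemma tail_cst_ge0 : 0 <= tail_cst.
Proof. by rewrite mulr_ge0 ?invr_ge0 ?sqr_ge0// mulr_ge0// mulr_ge0 ?expR_ge0// ltW. Qed.

Let G al n c := (fun xi => ew al xi * csq (expsum n c xi)) \_ (~` Ssq delta).
Let G0 al n c xi : 0 <= G al n c xi.
Proof. by rewrite /G patchE; case: ifP => _ //; rewrite mulr_ge0 ?ew_ge0 ?csq_ge0. Qed.
Let mG al n c : measurable_fun [set: R * R] (G al n c).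
Proof.
have mS : measurable (~` Ssq delta : set (R * R)) by apply: measurableC; exact: measurable_Ssq.
apply/(measurable_restrictT _ mS); apply: measurable_funTS.
by apply: measurable_funM; [exact: measurable_ew|exact: m_csq].
Qed.
Let H n c := (fun xi => csq (expsum n c xi)) \_ (Ssq delta).
Let H0 n c xi : 0 <= H n c xi.
Proof. by rewrite /H patchE; case: ifP => _ //; exact: csq_ge0. Qed.
Let D al := expR delta * expR (- (al * (delta / 2))).
Let D0 al : 0 <= D al. Proof. by rewrite mulr_ge0 ?expR_ge0. Qed.
Let F al n c (z : (R * R) * (R * R)) := \1_(Ssq r) z.1 * G al n c (z.2.1 + z.1.1, z.2.2 + z.1.2).

Let mF al n c : measurable_fun [set: (R * R) * (R * R)] (F al n c).
Proof.
have m11 : measurable_fun [set: (R * R) * (R * R)] (fun z => z.1.1).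
  by apply: (measurableT_comp (@measurable_fst _ _ R R)); exact: measurable_fst.
have m12 : measurable_fun [set: (R * R) * (R * R)] (fun z => z.1.2).
  by apply: (measurableT_comp (@measurable_snd _ _ R R)); exact: measurable_fst.
have m21 : measurable_fun [set: (R * R) * (R * R)] (fun z => z.2.1).
  by apply: (measurableT_comp (@measurable_fst _ _ R R)); exact: measurable_snd.
have m22 : measurable_fun [set: (R * R) * (R * R)] (fun z => z.2.2).
  by apply: (measurableT_comp (@measurable_snd _ _ R R)); exact: measurable_snd.
have mind : measurable_fun [set: R * R] (\1_(Ssq r) : R * R -> R).
  by apply: measurable_indic; exact: measurable_Ssq.
apply: measurable_funM; first by apply: (measurableT_comp mind); exact: measurable_fst.
by apply: (measurableT_comp (mG al n c)); apply: measurable_fun_pair; apply: measurable_funD.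
Qed.

Let F0 al n c z : 0 <= F al n c z.
Proof. by rewrite /F mulr_ge0. Qed.

(** For [xi] in the small square, the weight at [eta + xi] separates into a factor decaying in [al]
    and one integrable in [eta]; the translation by [eta] is absorbed into the coefficients. *)
Let F_le al n c xi eta : 1 <= al ->
  F al n c (xi, eta) <= D al * ew 1 eta * H n (fun j => c j * expi (dot2 eta (xs j))) xi.
Proof.
move=> al1; have k0 : 0 <= D al * ew 1 eta by rewrite mulr_ge0// ew_ge0.
rewrite /F /= indicE; case: (boolP (xi \in Ssq r)) => [|_]; last by rewrite mul0r mulr_ge0.
rewrite inE => xr; rewrite mul1r /G patchE; case: ifPn => [|_]; last by rewrite mulr_ge0.
rewrite inE => nS; have dS : Ssq delta xi.
  by case: xr => h1 h2; split; [apply: le_trans h1 _|apply: le_trans h2 _]; rewrite -r10 ler_peMl ?(ltW r0)// ler1n.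
rewrite /H patchE mem_set//.
rewrite [eta.1 + _]addrC [eta.2 + _]addrC expsum_shift; apply: ler_wpM2r; first exact: csq_ge0.
rewrite [xi.1 + _]addrC [xi.2 + _]addrC; rewrite -r10 in nS.
apply: le_trans (ew_shift_le al1 r0 xr nS) _; apply: ler_wpM2r; first exact: ew_ge0.
by rewrite /D -r10 [10 * r / 2](_ : _ = 5 * r)//; lra.
Qed.

Let inner_le al n c eta : 1 <= al ->
  (\int[mu2]_xi (F al n c (xi, eta))%:E <= (D al * ew 1 eta * (B * \sum_(j < n) csq (c j)))%:E)%E.
Proof.
move=> al1; pose c' j := c j * expi (dot2 eta (xs j)).
have sc' : \sum_(j < n) csq (c' j) = \sum_(j < n) csq (c j).
  by apply: eq_bigr => j _; rewrite csqM csq_expi mulr1.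
have mH : measurable_fun [set: R * R] (EFin \o H n c') := measurable_int _ (i_csq n c').
have g1 xi : [set: R * R] xi -> (0 <= (F al n c (xi, eta))%:E)%E by move=> _; exact: F0.
have g2 : measurable_fun [set: R * R] (fun xi => (F al n c (xi, eta))%:E).
  by apply/measurable_EFinP; exact: (measurable_fun_pair1 eta (mF al n c)).
have g3 : measurable_fun [set: R * R] (fun xi => (D al * ew 1 eta)%:E * (H n c' xi)%:E)%E.
  by apply: emeasurable_funM; [exact: measurable_cst|].
have k0E : (0 <= (D al * ew 1 eta)%:E)%E by rewrite lee_fin mulr_ge0// ew_ge0.
have HE0 xi : [set: R * R] xi -> (0 <= (EFin \o H n c') xi)%E by move=> _; exact: H0.
have le1 xi : [set: R * R] xi -> ((F al n c (xi, eta))%:E <= (D al * ew 1 eta)%:E * (H n c' xi)%:E)%E.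
  by move=> _; rewrite -EFinM lee_fin; exact: F_le.
apply: (le_trans (@ge0_le_integral _ _ R mu2 setT measurableT _ _ g1 g2 g3 le1)).
rewrite (@ge0_integralZl _ _ R mu2 setT measurableT _ mH _ HE0 k0E) [leRHS]EFinM.
by apply: lee_wpmul2l => //; rewrite -sc'; exact: upperE.
Qed.

(* The mass outside the square is averaged over the translations by [Ssq r], so that [upper] bounds it on each translate. *)
Let average al n c :
  (((2 * r) ^+ 2)%:E * \int[mu2]_xi (G al n c xi)%:E =
   \int[mu2]_xi \int[mu2]_eta (F al n c (xi, eta))%:E)%E.
Proof.
pose I : R * R -> \bar R := fun xi => (\1_(Ssq r) xi)%:E.
have -> : ((2 * r) ^+ 2)%:E = (\int[mu2]_xi I xi)%E.
  by rewrite (@integral_indic _ _ R mu2 setT measurableT (Ssq r) (measurable_Ssq r)) setIT; exact: (esym (mu2_Ssq r0)).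
have mI : measurable_fun [set: R * R] I.
  by apply/measurable_EFinP; apply: measurable_indic; exact: measurable_Ssq.
have I0 xi : [set: R * R] xi -> (0 <= I xi)%E by move=> _; rewrite lee_fin.
have mGE : measurable_fun [set: R * R] (EFin \o G al n c) by apply/measurable_EFinP; exact: mG.
have GE0 x : (0 <= (EFin \o G al n c) x)%E by exact: G0.
have IG0 : (0 <= \int[mu2]_xi (G al n c xi)%:E)%E by apply: integral_ge0 => xi _; exact: G0.
apply: (eq_trans (esym (@ge0_integralZr _ _ R mu2 setT measurableT _ mI _ I0 IG0))).
apply: eq_integral => xi _.
have -> : (\int[mu2]_xi (G al n c xi)%:E = \int[mu2]_eta (G al n c (eta.1 + xi.1, eta.2 + xi.2))%:E)%E.
  exact: (esym (ge0_integral_shift2 xi mGE GE0)).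
have mGs : measurable_fun [set: R * R] (fun eta => (G al n c (eta.1 + xi.1, eta.2 + xi.2))%:E).
  exact: (measurable_shift2 xi mGE).
have Gs0 eta : [set: R * R] eta -> (0 <= (G al n c (eta.1 + xi.1, eta.2 + xi.2))%:E)%E.
  by move=> _; exact: G0.
exact: (esym (@ge0_integralZl _ _ R mu2 setT measurableT _ mGs _ Gs0 (I0 xi Logic.I))).
Qed.

Let averaged_le al n c : 1 <= al ->
  (\int[mu2]_eta \int[mu2]_xi (F al n c (xi, eta))%:E <= (B * (\sum_(j < n) csq (c j)) * D al * I1)%:E)%E.
Proof.
move=> al1; set s := \sum_(j < n) _.
have s0 : 0 <= s by apply: sumr_ge0 => j _; exact: csq_ge0.
have mewE : measurable_fun [set: R * R] (EFin \o (ew 1 : R * R -> R)).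
  by apply/measurable_EFinP; exact: measurable_ew.
have ew0E eta : [set: R * R] eta -> (0 <= (EFin \o (ew 1 : R * R -> R)) eta)%E by move=> _; exact: ew_ge0.
have cst0 : (0 <= (B * s * D al)%:E)%E by rewrite lee_fin; exact: (mulr_ge0 (mulr_ge0 (ltW B0) s0) (D0 al)).
have mFE : measurable_fun [set: (R * R) * (R * R)] (EFin \o F al n c) by apply/measurable_EFinP; exact: mF.
have F0E z : (0%R <= (EFin \o F al n c) z)%E by exact: F0.
have f1 eta : [set: R * R] eta -> (0 <= \int[mu2]_xi (F al n c (xi, eta))%:E)%E.
  by move=> _; apply: integral_ge0 => xi _; exact: F0.
have f2 : measurable_fun [set: R * R] (fun eta => \int[mu2]_xi (F al n c (xi, eta))%:E)%E.
  exact: (@measurable_fun_fubini_tonelli_G _ _ _ _ _ (@mu2_sf R) _ mFE F0E).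
have f3 : measurable_fun [set: R * R] (fun eta => (B * s * D al)%:E * (ew 1 eta)%:E)%E.
  by apply: emeasurable_funM; [exact: measurable_cst|].
have le1 eta : [set: R * R] eta -> (\int[mu2]_xi (F al n c (xi, eta))%:E <= (B * s * D al)%:E * (ew 1 eta)%:E)%E.
  move=> _; apply: le_trans (inner_le n c eta al1) _; rewrite -EFinM lee_fin -/s.
  by rewrite [leLHS](_ : _ = B * s * D al * ew 1 eta)//; ring.
apply: (le_trans (@ge0_le_integral _ _ R mu2 setT measurableT _ _ f1 f2 f3 le1)).
by rewrite (@ge0_integralZl _ _ R mu2 setT measurableT _ mewE _ ew0E cst0) [leRHS]EFinM -I1E.
Qed.

(** Tonelli exchanges the two integrals in [average]; dividing by the area of the averaging square
    then bounds the outer mass, with a factor exponentially small in [al]. *)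
Lemma tail_le al n c : 1 <= al ->
  (\int[mu2]_xi (((fun xi => (ew al xi * csq (expsum n c xi))%R) \_ (~` Ssq delta)) xi)%:E <=
   (tail_cst * expR (- (al * (delta / 2))) * \sum_(j < n) csq (c j))%:E)%E.
Proof.
move=> al1; rewrite -/(G al n c).
have mFE : measurable_fun [set: (R * R) * (R * R)] (EFin \o F al n c) by apply/measurable_EFinP; exact: mF.
have F0E z : (0%R <= (EFin \o F al n c) z)%E by exact: F0.
have sw := @fubini_tonelli _ _ _ _ _ (@mu2_sf R) (@mu2_sf R) _ mFE F0E.
have key := averaged_le n c al1.
have {sw}key : (((2 * r) ^+ 2)%:E * \int[mu2]_xi (G al n c xi)%:E <=
    (B * (\sum_(j < n) csq (c j)) * D al * I1)%:E)%E.
  by rewrite average; apply: le_trans key; rewrite -sw.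
have m0 : 0 < (2 * r) ^+ 2 by rewrite exprn_gt0// mulr_gt0.
have IG0 : (0 <= \int[mu2]_xi (G al n c xi)%:E)%E by apply: integral_ge0 => xi _; exact: G0.
(* An infinite mass times the positive area would exceed the finite bound [key]; finiteness is what
   permits the division. *)
have fG : (\int[mu2]_xi (G al n c xi)%:E \is a fin_num)%E.
  rewrite ge0_fin_numE// ltNge leye_eq; apply/negP => /eqP h; move: key.
  by rewrite h gt0_muley ?lte_fin.
move: key m0; rewrite -(fineK fG) -EFinM !lee_fin /tail_cst.
move: ((2 * r) ^+ 2) (fine _) => m x key m0.
rewrite [leRHS](_ : _ = m^-1 * (B * (\sum_(j < n) csq (c j)) * D al * I1)); last by rewrite /D; ring.
by rewrite ler_pdivlMl.
Qed.

End ExponentialSystem.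

(** * Weighted exponentials and their Gram matrix *)

Section WeightedExponentials.
Context {R : realType}.
Local Notation mu2 := (@mu2 R).

Definition ewexp (al : R) (x xi : R * R) : R[i] := (ew (al / 2) xi)%:C%C * expi (dot2 xi x).

Lemma csq_ew_mul (al : R) xi z : csq ((ew (al / 2) xi)%:C%C * z) = ew al xi * csq z.
Proof.
rewrite csqM {1}/csq reCr imCr expr0n addr0; congr (_ * _).
by rewrite expr2 /ew -expRD -opprD -mulrDl -splitr.
Qed.

Lemma L2_ewexp al x : 0 < al -> L2 (ewexp al x).
Proof.
move=> al0; apply: (@L2_dom _ _ (ew al) _ _ _ (integrable_ew al0)).
- rewrite (_ : (fun _ => _) = (fun xi => ew (al / 2) xi * cos (dot2 xi x))).
    by apply: measurable_funM; [exact: measurable_ew|exact: measurable_cos_dot2].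
  by apply/funext => xi; rewrite reCM imCr mul0r subr0 reC_expi.
- rewrite (_ : (fun _ => _) = (fun xi => ew (al / 2) xi * sin (dot2 xi x))).
    by apply: measurable_funM; [exact: measurable_ew|exact: measurable_sin_dot2].
  by apply/funext => xi; rewrite imCM imCr mul0r addr0 imC_expi.
by move=> xi; rewrite csq_ew_mul csq_expi mulr1.
Qed.

Lemma ip2_ewexp al x y : 0 < al ->
  ip2 (ewexp al x) (ewexp al y) = ((2 * pi) ^+ 2 * poisson al (sub2 x y))%:C%C.
Proof.
move=> al0; rewrite -cint_ew_expi//; apply: cint_ext => xi _.
rewrite dot2_sub2 expiD -conjC_expi /ewexp.
have -> : (ew al xi)%:C%C = (ew (al / 2) xi)%:C%C * (ew (al / 2) xi)%:C%C.
  rewrite [in LHS](_ : ew al xi = ew (al / 2) xi * ew (al / 2) xi).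
    by apply: complex_ext; rewrite !cE /=; ring.
  by rewrite /ew -expRD -opprD -mulrDl -splitr.
by apply: complex_ext; rewrite !cE /=; ring.
Qed.

Lemma ewexp_sum al (xs : nat -> R * R) n (c : nat -> R[i]) xi :
  (\sum_(j < n) c j *: (ewexp al (xs j) : R * R -> R[i]^o)) xi = (ew (al / 2) xi)%:C%C * expsum xs n c xi.
Proof.
elim: n => [|n IH]; first by rewrite /expsum !big_ord0 mulr0.
rewrite /expsum !big_ord_recr/= mulrDr -/(expsum xs n c xi) -IH; congr (_ + _).
by rewrite /ewexp mulrCA.
Qed.

End WeightedExponentials.

(** * Riesz bounds and approximation for the weighted exponentials *)

Section FrameBounds.
Context {R : realType}.
Local Notation mu2 := (@mu2 R).
Variables (delta A B : R) (xs : nat -> R * R).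
Hypotheses (delta0 : 0 < delta) (A0 : 0 < A) (B0 : 0 < B).
Local Notation S := (Ssq delta).
Implicit Types (g : R * R -> R) (c : nat -> R[i]).

Let integrable_restrict g (D : set (R * R)) : measurable D ->
  mu2.-integrable setT (EFin \o g) -> mu2.-integrable setT (EFin \o (g \_ D)).
Proof.
move=> mD ig; have mg : measurable_fun [set: R * R] g by apply/measurable_EFinP; exact: (measurable_int _ ig).
apply: (le_integrable measurableT _ _ ig).
  by apply/measurable_EFinP; apply/(measurable_restrictT _ mD); exact: measurable_funTS.
by move=> xi _; rewrite /= lee_fin patchE; case: ifP => // _; rewrite normr0.
Qed.

Let mS : measurable (S : set (R * R)). Proof. exact: measurable_Ssq. Qed.
Let mSc : measurable (~` S : set (R * R)). Proof. exact: measurableC. Qed.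

Let integrable_ew_mul al g K : 0 < al -> measurable_fun [set: R * R] g ->
  (forall xi, 0 <= g xi <= K) -> mu2.-integrable setT (EFin \o (fun xi => ew al xi * g xi)).
Proof.
move=> al0 mg gK; have i := integrableZl measurableT K (integrable_ew al0).
apply: (integrable_dom _ _ i); first by apply: measurable_funM => //; exact: measurable_ew.
move=> xi; have /andP[g0 gle] := gK xi.
by rewrite ger0_norm ?mulr_ge0 ?ew_ge0//= mulrC ler_wpM2r ?ew_ge0.
Qed.

Let integrable_in g K : measurable_fun [set: R * R] g ->
  (forall xi, 0 <= g xi <= K) -> mu2.-integrable setT (EFin \o (g \_ S)).
Proof.
move=> mg gK; apply: (integrable_bounded_Ssq (K := K)) => // xi.
by have /andP[g0 gle] := gK xi; rewrite ger0_norm.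
Qed.

Let weighted_le al g K t : 0 < al -> measurable_fun [set: R * R] g ->
  (forall xi, 0 <= g xi <= K) ->
  Rintegral mu2 setT ((fun xi => ew al xi * g xi) \_ (~` S)) <= t ->
  Rintegral mu2 setT (fun xi => ew al xi * g xi) <= Rintegral mu2 S g + t.
Proof.
move=> al0 mg gK ht.
have i := integrable_ew_mul al0 mg gK; have ic := integrable_restrict mSc i.
have iS := integrable_in mg gK.
rewrite (Rintegral_mkcond mu2 S g); apply: (le_trans _ (lerD (lexx _) ht)).
rewrite -(RintegralD measurableT iS ic).
apply: (le_Rintegral measurableT i); first exact: (integrableD measurableT iS ic).
move=> xi _ /=; have /andP[g0 _] := gK xi.
rewrite !patchE; have [hxi|hxi] := boolP (xi \in S).
  have /negbTE -> : xi \notin ~` S by rewrite notin_setE /= => /(_ (set_mem hxi)).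
  by rewrite addr0 ler_piMl// ew_le1// ltW.
rewrite ifT ?add0r// inE /=; move: hxi; rewrite notin_setE.
exact.
Qed.

Let weighted_ge al g K : 0 < al -> measurable_fun [set: R * R] g ->
  (forall xi, 0 <= g xi <= K) ->
  expR (- (al * (2 * delta))) * Rintegral mu2 S g <= Rintegral mu2 setT (fun xi => ew al xi * g xi).
Proof.
move=> al0 mg gK.
have i := integrable_ew_mul al0 mg gK; have iS := integrable_in mg gK.
rewrite Rintegral_mkcond -(RintegralZl _ measurableT iS).
apply: (le_Rintegral measurableT _ i); first exact: (integrableZl measurableT _ iS).
move=> xi _ /=; have /andP[g0 _] := gK xi; rewrite patchE; case: ifPn => [|_]; last first.
  by rewrite mulr0 mulr_ge0// ew_ge0.
rewrite inE => -[h1 h2]; apply: ler_wpM2r => //.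
rewrite /ew ler_expR lerN2 ler_pM2l//; apply: le_trans (norm2_le xi) _.
by rewrite mulr_natl mulr2n lerD.
Qed.

Hypothesis lower : forall n c,
  A * \sum_(j < n) csq (c j) <= Rintegral mu2 S (fun xi => csq (expsum xs n c xi)).
Hypothesis upper : forall n c,
  Rintegral mu2 S (fun xi => csq (expsum xs n c xi)) <= B * \sum_(j < n) csq (c j).

Let m_csq n c : measurable_fun [set: R * R] (fun xi => csq (expsum xs n c xi)).
Proof. by have [m1 m2] := measurable_expsum xs n c; exact: measurable_csq. Qed.

Let sum_ge0 n c : 0 <= \sum_(j < n) csq (c j).
Proof. by apply: sumr_ge0 => j _; exact: csq_ge0. Qed.

Local Notation T := (tail_cst delta B).

Let T0 : 0 <= T. Proof. exact: tail_cst_ge0. Qed.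

Let tail al n c : 1 <= al ->
  Rintegral mu2 setT ((fun xi => ew al xi * csq (expsum xs n c xi)) \_ (~` S)) <=
    T * expR (- (al * (delta / 2))) * \sum_(j < n) csq (c j).
Proof.
move=> al1; have al0 : 0 < al by exact: lt_le_trans al1.
have [K hK] := expsum_bounded xs n c.
have hK' xi : 0 <= csq (expsum xs n c xi) <= K by rewrite csq_ge0 hK.
have ic := integrable_restrict mSc (integrable_ew_mul al0 (m_csq n c) hK').
rewrite -lee_fin /Rintegral fineK; last exact: (integrable_fin_num measurableT ic).
exact: (tail_le delta0 B0 upper n c al1).
Qed.

(** Inside the square the weight is at most 1 and [upper] applies, outside [tail_le] does; the
    constant is uniform in [al >= 1]. *)
Lemma ew_expsum_upper al n c : 1 <= al ->
  Rintegral mu2 setT (fun xi => ew al xi * csq (expsum xs n c xi)) <= (B + T) * \sum_(j < n) csq (c j).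
Proof.
move=> al1; have al0 : 0 < al by exact: lt_le_trans al1.
have [K hK] := expsum_bounded xs n c.
have hK' xi : 0 <= csq (expsum xs n c xi) <= K by rewrite csq_ge0 hK.
apply: le_trans (weighted_le al0 (m_csq n c) hK' (tail n c al1)) _.
rewrite mulrDl; apply: lerD; first exact: upper.
apply: ler_wpM2r; first exact: sum_ge0.
by rewrite ler_piMr// -expR0 ler_expR oppr_le0 mulr_ge0 ?ltW// divr_gt0.
Qed.

(** On the square the weight is at least [expR (- (al * (2 * delta)))]. This constant degenerates as
    [al] grows, which is harmless for the existence of coefficients. *)
Lemma ew_expsum_lower al n c : 0 < al ->
  expR (- (al * (2 * delta))) * A * \sum_(j < n) csq (c j) <=
    Rintegral mu2 setT (fun xi => ew al xi * csq (expsum xs n c xi)).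
Proof.
move=> al0; have [K hK] := expsum_bounded xs n c.
have hK' xi : 0 <= csq (expsum xs n c xi) <= K by rewrite csq_ge0 hK.
apply: le_trans (weighted_ge al0 (m_csq n c) hK').
by rewrite -mulrA ler_wpM2l ?expR_ge0.
Qed.

Hypothesis dense : forall h, L2_on S h -> forall eps : R, 0 < eps ->
  exists n c, Rintegral mu2 S (fun xi => csq (h xi - expsum xs n c xi)) < eps.

Let M := Rintegral mu2 S (fun=> 1).
Let I1 := Rintegral mu2 setT (ew 1 : R * R -> R).

(** The two summands account, outside the square, for the character itself and for the approximating
    sum, whose coefficients have squared l^2 norm at most [(2 * M + 2) / A]. *)
Definition dist_cst : R := 2 * expR delta * I1 + 2 * (T * ((2 * M + 2) / A)).

(** [dense] gives accuracy [eta] on the square. Outside, the squared error is at most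
    [2 + 2 * csq (expsum xs n c xi)], and the weight makes both terms exponentially small. *)
Lemma ew_expsum_dist eta x : 0 < eta -> eta <= 1 -> exists n c, forall al, 1 <= al ->
  Rintegral mu2 setT (fun xi => ew al xi * csq (expi (dot2 xi x) - expsum xs n c xi)) <=
    eta + dist_cst * expR (- (al * (delta / 2))).
Proof.
move=> eta0 eta1.
have me1 : measurable_fun [set: R * R] (fun xi => reC (expi (dot2 xi x))) by exact: measurable_cos_dot2.
have me2 : measurable_fun [set: R * R] (fun xi => imC (expi (dot2 xi x))) by exact: measurable_sin_dot2.
have m1 : measurable_fun [set: R * R] (fun=> 1 : R) by exact: measurable_cst.
have i1 : mu2.-integrable setT (EFin \o ((fun=> 1 : R) \_ S)).
  by apply: (integrable_in (K := 1) m1) => xi; rewrite ler01 lexx.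
have LE : L2_on S (fun xi => expi (dot2 xi x)).
  split; [exact: measurable_funTS|exact: measurable_funTS|].
  have := integrable_lty measurableT i1.
  suff -> : (\int[mu2]_(xi in S) (csq (expi (dot2 xi x)))%:E =
    \int[mu2]_xi (((fun=> 1%R : R) \_ S) xi)%:E)%E by [].
  rewrite integral_mkcond; apply: eq_integral => xi _.
  by rewrite /= !patchE csq_expi; case: ifP.
have [n [c hc]] := dense LE eta0; exists n, c => al al1.
have al0 : 0 < al by exact: lt_le_trans al1.
pose g xi := csq (expi (dot2 xi x) - expsum xs n c xi).
have [K hK] := expsum_bounded xs n c.
have [mp1 mp2] := measurable_expsum xs n c.
have mg : measurable_fun [set: R * R] g.
  apply: measurable_csq.
    by under eq_fun do rewrite reCB; exact: measurable_funB.
  by under eq_fun do rewrite imCB; exact: measurable_funB.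
have g_le xi : g xi <= 2 + 2 * csq (expsum xs n c xi).
  by apply: le_trans (csqB _ _) _; rewrite csq_expi mulr1.
have gK xi : 0 <= g xi <= 2 + 2 * K.
  by rewrite csq_ge0/=; apply: le_trans (g_le xi) _; rewrite lerD2l ler_pM2l.
have hK' xi : 0 <= csq (expsum xs n c xi) <= K by rewrite csq_ge0 hK.
have igS := integrable_in mg gK; have ipS := integrable_in (m_csq n c) hK'.
(* A sum close to a unimodular function on the square has bounded norm there, hence bounded
   coefficients by [lower], uniformly in [x] and [eta <= 1]. *)
have cle : \sum_(j < n) csq (c j) <= (2 * M + 2) / A.
  rewrite ler_pdivlMr// mulrC; apply: le_trans (lower n c) _.
  apply: (@le_trans _ _ (2 * M + 2 * Rintegral mu2 S g)); last first.
    by rewrite lerD2l -[leRHS]mulr1 ler_pM2l//; exact: (le_trans (ltW hc) eta1).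
  rewrite /M (Rintegral_mkcond mu2 S (fun=> 1)) (Rintegral_mkcond mu2 S g)
    (Rintegral_mkcond mu2 S (fun xi => csq (expsum xs n c xi))) -(RintegralZl _ measurableT i1) -(RintegralZl _ measurableT igS).
  have j1 := integrableZl measurableT 2 i1; have jg := integrableZl measurableT 2 igS.
  rewrite -(RintegralD measurableT j1 jg).
  apply: (le_Rintegral measurableT ipS); first exact: (integrableD measurableT j1 jg).
  move=> xi _ /=; rewrite !patchE; case: ifP => _; last by rewrite !mulr0 addr0.
  by have := csqB (expi (dot2 xi x)) (expi (dot2 xi x) - expsum xs n c xi); rewrite subKr csq_expi.
have iew1 := integrable_ew (ltr01 : (0 : R) < 1).
pose q := expR (- (al * (delta / 2))).
have q0 : 0 <= q by exact: expR_ge0.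
have out : Rintegral mu2 setT ((fun xi => ew al xi * g xi) \_ (~` S)) <= dist_cst * q.
  have ig := integrable_restrict mSc (integrable_ew_mul al0 mg gK).
  have ip := integrable_restrict mSc (integrable_ew_mul al0 (m_csq n c) hK').
  apply: (@le_trans _ _ (2 * expR delta * q * I1 +
      2 * Rintegral mu2 setT ((fun xi => ew al xi * csq (expsum xs n c xi)) \_ (~` S)))).
    rewrite /I1 -(RintegralZl _ measurableT iew1) -(RintegralZl _ measurableT ip).
    have j1 := integrableZl measurableT (2 * expR delta * q) iew1.
    have j2 := integrableZl measurableT 2 ip.
    rewrite -(RintegralD measurableT j1 j2).
    apply: (le_Rintegral measurableT ig); first exact: (integrableD measurableT j1 j2).
    move=> xi _ /=; rewrite !patchE; case: ifPn => [|_]; last first.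
      by rewrite mulr0 addr0 mulr_ge0 ?ew_ge0// mulr_ge0// mulr_ge0// expR_ge0.
    rewrite inE => nS.
    have far : delta <= norm2 xi.
      have [e1 e2] := norm2_ge xi; rewrite leNgt; apply/negP => nl; apply: nS.
      by split; apply: ltW; exact: le_lt_trans nl.
    (* Write [al = 1 + (al - 1)] and use [norm2 xi >= delta] on the second part; the decay obtained,
       with exponent [al * delta], is weakened to match [q]. *)
    have ewle : ew al xi <= expR delta * q * ew 1 xi.
      rewrite /ew /q -!expRD ler_expR.
      have : (al - 1) * delta <= (al - 1) * norm2 xi by rewrite ler_wpM2l// subr_ge0.
      have : 0 < al * delta by rewrite mulr_gt0.
      rewrite !mulrBl !mul1r; move: (al * delta) (al * norm2 xi) (norm2 xi) (al * (delta / 2)) (mulrA al delta 2^-1) => u v w z ->.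
      by lra.
    apply: (@le_trans _ _ (ew al xi * (2 + 2 * csq (expsum xs n c xi)))).
      by rewrite ler_wpM2l ?ew_ge0.
    rewrite mulrDr mulrCA lerD2r mulrC -!mulrA ler_pM2l// mulrA.
    exact: ewle.
  rewrite /dist_cst [leRHS]mulrDl lerD//; first by rewrite mulrAC.
  rewrite -mulrA ler_pM2l//; apply: le_trans (tail n c al1) _.
  by rewrite mulrAC ler_wpM2r// ler_wpM2l.
apply: le_trans (weighted_le al0 mg gK out) _.
by rewrite lerD2r ltW.
Qed.

End FrameBounds.

(** * Poisson interpolation *)

Section Interpolation.
Context {R : realType}.
Local Notation mu2 := (@mu2 R).
Local Notation V := (R * R -> R[i]^o).
Variables (delta A B beta : R) (xs : nat -> R * R) (f G : R * R -> R[i]).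
Hypotheses (delta0 : 0 < delta) (A0 : 0 < A) (B0 : 0 < B).
Local Notation S := (Ssq delta).
Hypothesis lower : forall n (c : nat -> R[i]),
  A * \sum_(j < n) csq (c j) <= Rintegral mu2 S (fun xi => csq (expsum xs n c xi)).
Hypothesis upper : forall n (c : nat -> R[i]),
  Rintegral mu2 S (fun xi => csq (expsum xs n c xi)) <= B * \sum_(j < n) csq (c j).
Hypothesis dense : forall h, L2_on S h -> forall eps : R, 0 < eps ->
  exists n c, Rintegral mu2 S (fun xi => csq (h xi - expsum xs n c xi)) < eps.
Hypothesis LG : L2 G.
Hypothesis GB : forall xi, beta < norm2 xi -> G xi = 0.
Hypothesis fG : forall x, f x = ((2 * pi)^-1)%:C%C * cint setT (fun xi => G xi * expi (dot2 xi x)).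

Let pi20 : 0 < 2 * pi :> R. Proof. by rewrite mulr_gt0// pi_gt0. Qed.

Let conjCK (z : R[i]) : conjc (conjc z) = z.
Proof. by apply: complex_ext; rewrite !cE ?opprK. Qed.

Let csq_real (a : R) z : csq (a%:C%C * z) = a ^+ 2 * csq z.
Proof. by rewrite csqM {1}/csq reCr imCr expr0n addr0. Qed.

(** The growing weight cancels that of [ewexp], at a cost of at most exp(al beta / 2) in modulus on
    the support of [G]. The conjugate appears because [ip2] is linear in its first argument, so that
    [symbol] reproduces [conjc (f x)]. *)
Let Phi0 (al : R) : R * R -> R[i] := fun xi => conjc ((ew (- (al / 2)) xi)%:C%C * G xi).
Definition symbol (al : R) : R * R -> R[i] := fun xi => ((2 * pi)^-1)%:C%C * Phi0 al xi.

Let Phi0_le al xi : 0 < al -> csq (Phi0 al xi) <= expR (al * beta) * csq (G xi).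
Proof.
move=> al0; rewrite csqJ csq_real.
have [/GB ->|xB] := ltP beta (norm2 xi); first by rewrite csq0 !mulr0.
apply: ler_wpM2r; first exact: csq_ge0.
rewrite expr2 /ew -expRD ler_expR -opprD -mulrDl -opprD -splitr mulNr opprK.
by rewrite ler_pM2l.
Qed.

Let L2_Phi0 al : 0 < al -> L2 (Phi0 al).
Proof.
move=> al0; have [mg1 mg2 _] := LG.
have mw : measurable_fun [set: R * R] (ew (- (al / 2))) by exact: measurable_ew.
apply: (@L2_dom _ _ (fun xi => expR (al * beta) * csq (G xi))).
- rewrite (_ : (fun _ => _) = (fun xi => ew (- (al / 2)) xi * reC (G xi))).
    exact: measurable_funM.
  by apply/funext => xi; rewrite reCJ reCM imCr mul0r subr0.
- rewrite (_ : (fun _ => _) = (fun xi => - (ew (- (al / 2)) xi * imC (G xi)))).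
    by apply: measurable_funN; exact: measurable_funM.
  by apply/funext => xi; rewrite imCJ imCM imCr mul0r addr0.
- by move=> xi; exact: Phi0_le.
exact: (integrableZl measurableT _ (L2_integrable LG)).
Qed.

Let L2_symbol al : 0 < al -> L2 (symbol al).
Proof. by move=> al0; apply: L2_Z; exact: L2_Phi0. Qed.

Let K := (2 * pi)^-1 ^+ 2 * Rintegral mu2 setT (fun xi => csq (G xi)).

Let K0 : 0 <= K.
Proof. by rewrite mulr_ge0 ?sqr_ge0//; apply: Rintegral_ge0 => xi _; exact: csq_ge0. Qed.

Let symbol_nsq al : 0 < al -> reC (ip2 (symbol al) (symbol al)) <= expR (al * beta) * K.
Proof.
move=> al0; rewrite ip2_nsq /K mulrA -(RintegralZl _ measurableT (L2_integrable LG)).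
have i1 := L2_integrable (L2_symbol al0).
have i2 := integrableZl measurableT (expR (al * beta) * (2 * pi)^-1 ^+ 2) (L2_integrable LG).
apply: (le_Rintegral measurableT i1 i2) => xi _.
rewrite /symbol csq_real [leRHS](_ : _ = (2 * pi)^-1 ^+ 2 * (expR (al * beta) * csq (G xi))).
  by rewrite ler_wpM2l ?sqr_ge0//; exact: Phi0_le.
by rewrite -mulrA mulrCA.
Qed.

Let ip2_symbol al x : 0 < al -> ip2 (symbol al) (ewexp al x) = conjc (f x).
Proof.
move=> al0; have L1 := L2_Phi0 al0; have Lx := @L2_ewexp R al x al0.
rewrite /symbol (ip2Zl _ L1 Lx) (ip2C Lx L1) fG conjCM; congr (_ * conjc _).
  by apply: complex_ext; rewrite !cE /= ?oppr0.
apply: cint_ext => xi _; rewrite /Phi0 /ewexp.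
have e1 : ew (al / 2) xi * ew (- (al / 2)) xi = 1 by rewrite /ew -expRD -opprD -mulrDl subrr mul0r oppr0 expR0.
have e2 : (ew (al / 2) xi)%:C%C * (ew (- (al / 2)) xi)%:C%C = 1 :> R[i].
  by apply: complex_ext; rewrite !cE /= ?e1; ring.
by rewrite conjCK mulrACA e2 mul1r mulrC.
Qed.

Let lc al n (c : nat -> R[i]) : V := \sum_(j < n) c j *: (ewexp al (xs j) : V).

Let L2_lc al n c : 0 < al -> L2 (lc al n c).
Proof.
move=> al0; rewrite /lc; elim: n => [|n IH]; first by rewrite big_ord0; exact: L2_0.
rewrite big_ord_recr/=; apply: (L2_D IH); apply: L2_Z; exact: L2_ewexp.
Qed.

Let ip2_lc al n c x : 0 < al ->
  ip2 (lc al n c) (ewexp al x) = \sum_(j < n) c j * ((2 * pi) ^+ 2 * poisson al (sub2 x (xs j)))%:C%C.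
Proof.
move=> al0; have Lx := @L2_ewexp R al x al0.
elim: n => [|n IH].
  rewrite big_ord0 -(mul0r (ip2 (ewexp al x) (ewexp al x))) -(ip2Zl _ Lx Lx) /lc big_ord0.
  by congr ip2; apply/funext => xi; rewrite mul0r.
rewrite [RHS]big_ord_recr/= -IH -poissonN// -ip2_ewexp//.
have Ln := @L2_ewexp R al (xs n) al0.
rewrite -(ip2Zl _ Ln Lx) -(ip2Dl (L2_lc n c al0) (L2_Z (c n) Ln) Lx).
by rewrite /lc big_ord_recr.
Qed.

(** Passes from Poisson coefficients to those of the weighted exponentials: the kernel is real, so
    only a conjugation and the factor [(2 * pi) ^+ 2] of [ip2_ewexp] intervene. *)
Let cof (a : nat -> R[i]) j := (((2 * pi) ^+ 2)^-1)%:C%C * conjc (a j).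

Let partial_sum al n a x : 0 < al ->
  \sum_(j < n) poisson_terms al xs a x j = conjc (ip2 (lc al n (cof a)) (ewexp al x)).
Proof.
move=> al0; rewrite ip2_lc// conjC_sum; apply: eq_bigr => j _.
have p2 : (2 * pi) ^+ 2 != 0 :> R by rewrite gt_eqF// exprn_gt0.
rewrite /poisson_terms /cof; move: ((2 * pi) ^+ 2) p2 => p p0.
by apply: complex_ext; rewrite !cE /=; field.
Qed.

Let nsq_lc al n c : reC (ip2 (lc al n c) (lc al n c)) =
  Rintegral mu2 setT (fun xi => ew al xi * csq (expsum xs n c xi)).
Proof.
rewrite ip2_nsq; apply: eq_Rintegral => xi _.
by rewrite -csq_ew_mul /lc ewexp_sum.
Qed.

Let nsq_dist al x n c : reC (ip2 ((ewexp al x : V) - lc al n c) ((ewexp al x : V) - lc al n c)) =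
  Rintegral mu2 setT (fun xi => ew al xi * csq (expi (dot2 xi x) - expsum xs n c xi)).
Proof.
rewrite ip2_nsq; apply: eq_Rintegral => xi _.
by rewrite -csq_ew_mul mulrBr -ewexp_sum.
Qed.

Let T0 : 0 <= tail_cst delta B. Proof. exact: tail_cst_ge0. Qed.

(** [interp_exists] applied to [symbol al]; conjugating its equations turns them into the
    interpolation conditions. *)
Lemma poisson_coeffs_exist al : 1 <= al -> exists a, poisson_coeffs al xs f a.
Proof.
move=> al1; have al0 : 0 < al by exact: lt_le_trans al1.
have Le j : L2 (ewexp al (xs j) : V) by exact: L2_ewexp.
have a0 : 0 < expR (- (al * (2 * delta))) * A by rewrite mulr_gt0 ?expR_gt0.
have b0 : 0 < B + tail_cst delta B by rewrite ltr_wpDr.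
have lo n (c : nat -> R[i]) : expR (- (al * (2 * delta))) * A * \sum_(j < n) csq (c j) <= reC (ip2 (lc al n c) (lc al n c)).
  by rewrite nsq_lc; exact: (ew_expsum_lower lower n c al0).
have up n (c : nat -> R[i]) : reC (ip2 (lc al n c) (lc al n c)) <= (B + tail_cst delta B) * \sum_(j < n) csq (c j).
  by rewrite nsq_lc; exact: (ew_expsum_upper delta0 B0 upper n c al1).
have [c [[M hM] hc]] := @interp_exists R V (@L2 R) (@ip2 R) L2_0 L2_D L2_Z ip2Dl ip2Zl ip2C ip2_ge0
  (fun j => ewexp al (xs j)) Le _ _ a0 b0 lo up (symbol al) (L2_symbol al0).
(* Inverse of [cof]. *)
pose a j := conjc (((2 * pi) ^+ 2)%:C%C * c j).
have ca : cof a = c.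
  apply/funext => j; rewrite /cof /a.
  have p2 : (2 * pi) ^+ 2 != 0 :> R by rewrite gt_eqF// exprn_gt0.
  move: ((2 * pi) ^+ 2) p2 => p p0.
  by apply: complex_ext; rewrite !cE /=; field.
exists a; split.
  exists ((2 * pi) ^+ 2 ^+ 2 * M) => n.
  rewrite (eq_bigr (fun j : 'I_n => (2 * pi) ^+ 2 ^+ 2 * csq (c j))); last first.
    by move=> j _; rewrite csqJ csq_real.
  by rewrite -mulr_sumr; apply: ler_wpM2l; [exact: sqr_ge0|exact: hM].
move=> k; have := ccvgJ (hc k); rewrite ip2_symbol// conjCK.
suff -> : (fun n => conjc (ip2 (lc al n c) (ewexp al (xs k)))) =
    (fun n => \sum_(j < n) poisson_terms al xs a (xs k) j) by [].
by apply/funext => n; rewrite partial_sum// ca.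
Qed.

Definition error_cst : R := K * (1 + dist_cst delta A B).

(** The squared norm of [symbol al] is at most [expR (al * beta) * K] and the squared distance of
    [ewexp al x] to the combinations is of order [expR (- (al * (delta / 2)))]; their product is
    uniform in [x]. *)
Lemma poisson_error al a x : 1 <= al -> poisson_coeffs al xs f a ->
  exists2 v, series_to (poisson_terms al xs a x) v &
    csq (f x - v) <= error_cst * expR (- (al * (delta / 2 - beta))).
Proof.
move=> al1 [[M hM] ha]; have al0 : 0 < al by exact: lt_le_trans al1.
have Le j : L2 (ewexp al (xs j) : V) by exact: L2_ewexp.
have b0 : 0 < B + tail_cst delta B by rewrite ltr_wpDr.
have up n (c : nat -> R[i]) : reC (ip2 (lc al n c) (lc al n c)) <= (B + tail_cst delta B) * \sum_(j < n) csq (c j).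
  by rewrite nsq_lc; exact: (ew_expsum_upper delta0 B0 upper n c al1).
have cM : exists M, forall n, \sum_(j < n) csq (cof a j) <= M.
  exists (((2 * pi) ^+ 2)^-1 ^+ 2 * M) => n.
  rewrite (eq_bigr (fun j : 'I_n => ((2 * pi) ^+ 2)^-1 ^+ 2 * csq (a j))); last first.
    by move=> j _; rewrite /cof csq_real csqJ.
  by rewrite -mulr_sumr; apply: ler_wpM2l; [exact: sqr_ge0|exact: hM].
have cv k : ccvg (fun n => ip2 (lc al n (cof a)) (ewexp al (xs k))) (ip2 (symbol al) (ewexp al (xs k))).
  rewrite ip2_symbol// (_ : (fun n => ip2 _ _) = (fun n => conjc (\sum_(j < n) poisson_terms al xs a (xs k) j))).
    by apply: ccvgJ; exact: ha.
  by apply/funext => n; rewrite partial_sum// conjCK.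
have Lx : L2 (ewexp al x : V) by exact: L2_ewexp.
have [w cw hw] := @interp_error R V (@L2 R) (@ip2 R) L2_0 L2_D L2_Z ip2Dl ip2Zl ip2C ip2_ge0
  (fun j => ewexp al (xs j)) Le _ b0 up (symbol al) (cof a) (L2_symbol al0) cM cv (ewexp al x) Lx.
exists (conjc w).
  have := ccvgJ cw.
  rewrite (_ : (fun n => conjc _) = (fun n => \sum_(j < n) poisson_terms al xs a x j))//.
  by apply/funext => n; rewrite partial_sum.
pose q := expR (- (al * (delta / 2))).
have q0 : 0 < q by exact: expR_gt0.
have q1 : q <= 1 by rewrite -expR0 ler_expR oppr_le0 mulr_ge0 ?(ltW al0)// divr_ge0// ltW.
(* The tolerance on the square is [q] itself, so that it matches the contribution from outside. *)
have [n [c hc]] := ew_expsum_dist delta0 A0 B0 lower upper dense x q0 q1.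
have := hw n c; rewrite (ip2_symbol x al0) -/(lc al n c) (nsq_dist al x n c).
have -> : csq (conjc (f x) - w) = csq (f x - conjc w).
  by rewrite -csqJ; congr csq; apply: complex_ext; rewrite !cE; ring.
move=> h; apply: (le_trans h).
have n0 := ip2_ge0 (L2_symbol al0).
apply: (@le_trans _ _ (expR (al * beta) * K * (q + dist_cst delta A B * q))).
  apply: ler_pM => //; [|exact: symbol_nsq|exact: hc].
  by apply: Rintegral_ge0 => xi _; rewrite mulr_ge0 ?ew_ge0 ?csq_ge0.
rewrite /error_cst mulrBr opprB expRD -/q.
rewrite [leLHS](_ : _ = K * (1 + dist_cst delta A B) * (expR (al * beta) * q))//; ring.
Qed.

End Interpolation.

Theorem theorem3 (R : realType) (delta beta : R) (xs : nat -> R * R)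
  (f : R * R -> R[i]) :
  0 < delta ->
  complete_interpolating (Ssq delta) xs ->
  0 < beta -> beta < (3 - Num.sqrt 8) * delta ->
  PW (Bball beta) f ->
  forall eps : R, 0 < eps ->
  exists alpha0 : R, 0 < alpha0 /\
    forall alpha : R, alpha0 < alpha ->
      (exists a, poisson_coeffs alpha xs f a) /\
      (forall a, poisson_coeffs alpha xs f a ->
         forall x : R * R, exists v : R[i],
           series_to (poisson_terms alpha xs a x) v /\ cabs (f x - v) < eps).
Proof.
move=> delta0 [_ [A [B [A0 B0 AB]]] dense] beta0 hbeta [cre cim Lf [g [fg gB]]] eps eps0.
have lower n c := (AB n c).1; have upper n c := (AB n c).2.
have LG := L2_ftB beta fg.
have GB xi : beta < norm2 xi -> ftB g beta xi = 0.
  move=> h; rewrite /ftB /crestrict ifF//; apply/negP; rewrite inE /Bball /= => h'.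
  by have := lt_le_trans h h'; rewrite ltxx.
have fG := inversion cre cim Lf fg beta0 gB.
pose kappa := delta / 2 - beta.
have kappa0 : 0 < kappa.
  (* From [25 / 4 <= 8]; hence [3 - sqrt 8 <= 1 / 2] and [beta < delta / 2]. *)
  have s8 : 5 / 2 <= Num.sqrt (8 : R).
    rewrite -[leLHS]ger0_norm ?divr_ge0// -sqrtr_sqr ler_sqrt//; lra.
  have : (3 - Num.sqrt 8) * delta <= 1 / 2 * delta by rewrite ler_pM2r//; lra.
  by rewrite /kappa; move: hbeta; lra.
pose C := `|error_cst delta A B (ftB g beta)|.
have C0 : 0 <= C by exact: normr_ge0.
(* The summand 1 ensures [al >= 1]. The quotient gives [C < eps ^+ 2 * (al * kappa)], which beats
   the exponential factor through [t <= expR t]. *)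
exists (1 + C / (eps ^+ 2 * kappa)).
have ek0 : 0 < eps ^+ 2 * kappa by rewrite mulr_gt0// exprn_gt0.
have Cek : 0 <= C / (eps ^+ 2 * kappa) by rewrite divr_ge0// ltW.
split=> [|al hal]; first by rewrite ltr_wpDr.
have al1 : 1 <= al by apply: le_trans (ltW hal); rewrite lerDl.
have hal2 : C / (eps ^+ 2 * kappa) < al by apply: lt_trans hal; rewrite ltrDr.
split; first by have := poisson_coeffs_exist delta0 A0 B0 lower upper LG GB fG al1.
move=> a ha x.
have [v cv hv] := poisson_error delta0 A0 B0 lower upper dense LG GB fG x al1 ha.
exists v; split=> //.
rewrite /cabs -[ltRHS]ger0_norm ?(ltW eps0)// -sqrtr_sqr ltr_sqrt ?exprn_gt0//.
apply: (le_lt_trans hv).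
apply: (@le_lt_trans _ _ (C * expR (- (al * kappa)))); first by rewrite ler_wpM2r ?expR_ge0// ler_norm.
rewrite expRN ltr_pdivrMr ?expR_gt0//.
apply: (@lt_le_trans _ _ (eps ^+ 2 * (al * kappa))).
  by move: hal2; rewrite ltr_pdivrMr// mulrCA.
by rewrite ler_pM2l ?exprn_gt0//; apply: le_trans (expR_ge1Dx _); rewrite lerDr.
Qed.
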